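(* Let $l\geqslant 1$, the bump function $g$ and the single-site distribution $\mu$ be as in the context, and put $$\widetilde g:=g-\frac1l\int_0^l g(t)\,dt,\qquad c_2:=\frac{3\,\|\widetilde g\|_{L_2(0,l)}^2}{2\,l^3},\qquad c_3:=\frac{3\,\|\widetilde g\|_{L_2(0,l)}^2}{5000\,l^7},$$ $$I_N:=\left[\frac{2\,N^{\frac1\gamma-\frac14}}{\mathbb{E}\{\omega_k\}\sqrt{c_2}}\,,\; c_3\,N^{-\frac{15}{2\gamma}}\right].$$ Let $\gamma>34$, and let $N_1$ and $c_4>0$ (with $c_4$ depending only on $\mu$) be constants such that for all $N\in\mathbb{N}$ with $N\geqslant N_1$ the interval $I_N$ is non-empty and for all $\kappa\in I_N$ $$\mathbb{P}\left(\omega\in\Omega \mid \lambda_{\kappa,\omega}(N)-1\leqslant N^{-\frac12}\right)\leqslant N^{1-\frac1\gamma}\,e^{-c_4N^{1/\gamma}}$$ (such constants exist). Let $N\geqslant N_1$, $L:=Nl$, $\kappa\in I_N\cap[0,1]$, let $\alpha,\beta\geqslant 2$, and set $$A:=\{x\in\mathbb{R}^2\mid 0\leqslant x_1\leqslant\alpha,\ \kappa G(x_1,\omega)<x_2<\kappa G(x_1,\omega)+\pi\},$$ $$B:=\{x\in\mathbb{R}^2\mid L-\beta\leqslant x_1\leqslant L,\ \kappa G(x_1,\omega)<x_2<\kappa G(x_1,\omega)+\pi\},$$ where it is assumed that $A,B\subset D_{\kappa,\omega}(N)$ (up to Lebesgue null sets). Then $$\mathbb{P}\left(\omega\in\Omega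 \,\Big|\, \forall\,\lambda\in\Big[1,1+\tfrac{1}{2\sqrt N}\Big]:\ \big\|\chi_A(\mathcal{H}_{\kappa,\omega}(N)-\lambda)^{-1}\chi_B\big\|\leqslant 2\sqrt N\,e^{-\frac{\operatorname{dist}(A,B)}{48\sqrt N}}\right)\geqslant 1-N^{1-\frac1\gamma}\,e^{-c_4N^{1/\gamma}}.$$
   Context: Let $l\geqslant 1$ and let $g\in C_0^2(0,l)$ be real-valued (twice continuously differentiable with compact support in $(0,l)$, extended by $0$ to $\mathbb{R}$), normalized by $\max\{\|g\|_{C[0,l]},\|g'\|_{C[0,l]},\|g''\|_{C[0,l]}\}=1$. Let $(\omega_k)_{k\in\mathbb{Z}}$ be independent, identically distributed, non-negative, non-trivial (not almost surely equal to $0$) random variables with common distribution $\mu$, a probability measure on $[0,\infty)$ with support in $[0,1]$. The configuration space is $\Omega=\times_{k\in\mathbb{Z}}[0,\infty)$ with product measure $\mathbb{P}=\bigotimes_{k\in\mathbb{Z}}\mu$; its elements are $\omega=(\omega_k)_{k\in\mathbb{Z}}$. $\mathbb{E}\{\omega_k\}$ is the expectation of any one $\omega_k$. Put $G(x_1,\omega):=\sum_{k\in\mathbb{Z}}\omega_k\,g(x_1-kl)$. For $\kappa>0$ and $N\in\mathbb{N}$ define the waveguide segment $$D_{\kappa,\omega}(N):=\{x\in\mathbb{R}^2\mid 0<x_1<Nl,\ \kappa G(x_1,\omega)<x_2<\kappa G(x_1,\omega)+\pi\},$$ and let $\Gamma_{\kappa,\omega}(N)$ be the lower and upper part of its boundary,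 i.e. the points with $0<x_1<Nl$ and $x_2=\kappa G(x_1,\omega)$ or $x_2=\kappa G(x_1,\omega)+\pi$. Let $\mathcal{H}_{\kappa,\omega}(N)$ be the negative Laplace operator on $D_{\kappa,\omega}(N)$ with Dirichlet boundary conditions on $\Gamma_{\kappa,\omega}(N)$ and Neumann boundary conditions on the rest of the boundary (the vertical sides), and let $\lambda_{\kappa,\omega}(N)$ be its lowest eigenvalue. $\chi_A,\chi_B$ denote the multiplication operators on $L_2(D_{\kappa,\omega}(N))$ by the indicator functions of $A,B$; $\|\cdot\|$ is the operator norm on $L_2(D_{\kappa,\omega}(N))$; $\operatorname{dist}(A,B)$ is the Euclidean distance of the sets. The norm bound is understood to include that $\lambda$ lies in the resolvent set of $\mathcal{H}_{\kappa,\omega}(N)$. *)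

(* Defs.v *)
From HB Require Import structures.
From mathcomp Require Import all_boot all_order all_algebra complex.
From mathcomp Require Import all_classical all_reals all_analysis.

Set Implicit Arguments.
Unset Strict Implicit.
Unset Printing Implicit Defensive.

Import Order.TTheory GRing.Theory Num.Theory.
Import numFieldNormedType.Exports.

Local Open Scope classical_set_scope.
Local Open Scope ring_scope.
Local Open Scope complex_scope.

Definition config (R : realType) := int -> {nonneg R}.

HB.instance Definition _ (R : realType) := Choice.on (config R).
HB.instance Definition _ (R : realType) :=
  isPointed.Build (config R) (fun=> 0%:nng).

(* The product sigma-algebra is the one generated by the preimages of Borel
   sets under the coordinate maps. *)
Definition coordinate_events (R : realType) : set (set (config R)) :=
  [set E | exists (k : int) (X : set R),
     measurable X /\ E = [set w | X (w k)%:num]].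

Definition Omega (R : realType) := g_sigma_algebraType (@coordinate_events R).

(* [P] is the product over [int] of copies of [mu].  By the pi-lambda theorem
   this property determines [P]. *)
Definition is_product_measure (R : realType) (mu : probability (measurableTypeR R) R)
    (P : probability (Omega R) R) : Prop :=
  forall (s : seq int) (X : int -> set R), uniq s ->
    (forall k, measurable (X k)) ->
    P [set w : Omega R | forall k, k \in s -> X k (w k)%:num] =
    (\prod_(k <- s) mu (X k))%E.

(* Probabilities of events whose measurability is not part of the data: the
   outer and the inner measure of the event.  Both are equal to [P E] when [E]
   is measurable (see [outer_probE] and [inner_probE]). *)
Definition outer_prob (R : realType) (P : probability (Omega R) R)
    (E : set (Omega R)) : \bar R :=
  ereal_inf [set P F | F in [set F | measurable F /\ E `<=` F]].

Definition inner_prob (R : realType) (P : probability (Omega R) R)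
    (E : set (Omega R)) : \bar R :=
  ereal_sup [set P F | F in [set F | measurable F /\ F `<=` E]].

Lemma outer_probE (R : realType) (P : probability (Omega R) R)
  (E : set (Omega R)) : measurable E -> outer_prob P E = P E.
Proof.
move=> mE; apply/eqP; rewrite eq_le; apply/andP; split.
  by apply: ereal_inf_lbound; exists E => //; split.
by apply: le_ereal_inf_tmp => _ [F [mF EF] <-]; apply: le_measure; rewrite ?inE.
Qed.

Lemma inner_probE (R : realType) (P : probability (Omega R) R)
  (E : set (Omega R)) : measurable E -> inner_prob P E = P E.
Proof.
move=> mE; apply/eqP; rewrite eq_le; apply/andP; split.
  by apply: ge_ereal_sup => _ [F [mF EF] <-]; apply: le_measure; rewrite ?inE.
by apply: ereal_sup_ubound; exists E => //; split.
Qed.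

Definition mean_coordinate (R : realType) (P : probability (Omega R) R) : R :=
  fine ('E_P[fun w : Omega R => (w (0 : int))%:num])%E.

Definition C2_compact_support (R : realType) (l : R) (g : R -> R) : Prop :=
  [/\ (forall x, derivable g x 1), (forall x, derivable (derive1 g) x 1),
      continuous (derive1n 2 g) & closure [set x | g x != 0] `<=` `]0, l[].

Definition sup_norm (R : realType) (l : R) (f : R -> R) : R :=
  sup [set `|f x| | x in `[0, l]].

Definition normalized_profile (R : realType) (l : R) (g : R -> R) : Prop :=
  Num.max (Num.max (sup_norm l g) (sup_norm l (derive1 g)))
          (sup_norm l (derive1n 2 g)) = 1.

Definition gtilde (R : realType) (l : R) (g : R -> R) (x : R) : R :=
  g x - l^-1 * \int[@lebesgue_measure R]_(t in `[0, l]) g t.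

Definition gtilde_sqnorm (R : realType) (l : R) (g : R -> R) : R :=
  \int[@lebesgue_measure R]_(x in `[0, l]) (gtilde l g x ^+ 2).

Definition const2 (R : realType) (l : R) (g : R -> R) : R :=
  3 * gtilde_sqnorm l g / (2 * l ^+ 3).

Definition const3 (R : realType) (l : R) (g : R -> R) : R :=
  3 * gtilde_sqnorm l g / (5000 * l ^+ 7).

Definition kappa_interval (R : realType) (P : probability (Omega R) R)
    (l : R) (g : R -> R) (gamma : R) (N : nat) : set R :=
  `[ 2 * N%:R `^ (gamma^-1 - 4^-1)
       / (mean_coordinate P * Num.sqrt (const2 l g)),
     const3 l g * N%:R `^ (- (15 / (2 * gamma))) ].

(* A sum of finite support: at each point at most one term is nonzero. *)
Definition randomG (R : realType) (l : R) (g : R -> R) (w : Omega R) (x : R)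
    : R :=
  \sum_(k \in [set: int]) (w k)%:num * g (x - k%:~R * l).

Definition strip (R : realType) (kappa l : R) (g : R -> R) (w : Omega R)
    (I : set R) : set (R * R) :=
  [set x | I x.1 /\ kappa * randomG l g w x.1 < x.2
                 < kappa * randomG l g w x.1 + pi].

Definition waveguide (R : realType) (kappa l : R) (g : R -> R) (w : Omega R)
    (N : nat) : set (R * R) :=
  strip kappa l g w `]0, N%:R * l[.

Definition waveguide_walls (R : realType) (kappa l : R) (g : R -> R)
    (w : Omega R) (N : nat) : set (R * R) :=
  [set x | 0 < x.1 < N%:R * l /\
     (x.2 = kappa * randomG l g w x.1 \/
      x.2 = kappa * randomG l g w x.1 + pi)].

Definition euclidean_dist (R : realType) (A B : set (R * R)) : R :=
  inf [set Num.sqrt ((x.1 - y.1) ^+ 2 + (x.2 - y.2) ^+ 2) | x in A & y in B].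

Definition plane_measure (R : realType)
    : {measure set (measurableTypeR R * measurableTypeR R) -> \bar R} :=
  (@lebesgue_measure R \x @lebesgue_measure R)%E.

Definition abs2 (R : realType) (z : R[i]) : R := complex.Re z ^+ 2 + complex.Im z ^+ 2.

Definition L2sqnorm (R : realType) (D : set (R * R)) (u : R * R -> R[i])
    : \bar R :=
  (\int[plane_measure R]_(x in D) (abs2 (u x))%:E)%E.

Definition in_L2 (R : realType) (D : set (R * R)) (u : R * R -> R[i]) : Prop :=
  [/\ measurable_fun D (fun x => complex.Re (u x)), measurable_fun D (fun x => complex.Im (u x))
    & (L2sqnorm D u < +oo)%E].

Definition L2norm (R : realType) (D : set (R * R)) (u : R * R -> R[i]) : R :=
  Num.sqrt (fine (L2sqnorm D u)).

Definition L2inner (R : realType) (D : set (R * R)) (u v : R * R -> R[i])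
    : R[i] :=
  (\int[plane_measure R]_(x in D) complex.Re (u x * (v x)^*))
  +i* (\int[plane_measure R]_(x in D) complex.Im (u x * (v x)^*)).

Definition partial (R : realType) (e : R * R) (phi : R * R -> R[i])
    (x : R * R) : R[i] :=
  'D_e (fun y => complex.Re (phi y)) x +i* 'D_e (fun y => complex.Im (phi y)) x.

Definition C1_real (R : realType) (f : R * R -> R) : Prop :=
  [/\ (forall x, differentiable f x),
      continuous (fun x => 'D_((1, 0) : R * R) f x)
    & continuous (fun x => 'D_((0, 1) : R * R) f x)].

Definition C1 (R : realType) (phi : R * R -> R[i]) : Prop :=
  C1_real (fun x => complex.Re (phi x)) /\ C1_real (fun x => complex.Im (phi x)).

(* [u] belongs to the closure in H^1(D) of the C^1 functions on the plane that
   vanish on [Gam], and [(p, q)] is its (weak) gradient.  For the waveguide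
   this closure is the space of all H^1 functions with zero trace on [Gam]. *)
Definition form_domain (R : realType) (D Gam : set (R * R))
    (u p q : R * R -> R[i]) : Prop :=
  [/\ in_L2 D u, in_L2 D p, in_L2 D q &
    forall eps : R, 0 < eps -> exists phi : R * R -> R[i],
      [/\ C1 phi, (forall x, Gam x -> phi x = 0) &
        (L2sqnorm D (fun x => (phi x - u x)%R)
         + L2sqnorm D (fun x => (partial (1, 0) phi x - p x)%R)
         + L2sqnorm D (fun x => (partial (0, 1) phi x - q x)%R) < eps%:E)%E]].

(* [u] is in the domain of the negative Laplacian on [D], with Dirichlet
   conditions on [Gam] and Neumann conditions on the rest of the boundary, and
   this operator maps [u] to [f]: the self-adjoint operator of the closed form
   [u |-> \int_D |\nabla u|^2] on [form_domain D Gam].  The Neumann conditions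
   are the natural ones. *)
Definition mixed_laplacian (R : realType) (D Gam : set (R * R))
    (u f : R * R -> R[i]) : Prop :=
  in_L2 D f /\
  exists p q, form_domain D Gam u p q /\
    forall v r s, form_domain D Gam v r s ->
      L2inner D p r + L2inner D q s = L2inner D f v.

(* Unbounded operators on [L^2(D)] are given by their graphs: [H u f] means
   that [u] is in the domain and is mapped to [f].  Functions equal almost
   everywhere on [D] are not identified. *)

Definition graph (R : realType) := (R * R -> R[i]) -> (R * R -> R[i]) -> Prop.

Definition eigenvalue (R : realType) (D : set (R * R)) (H : graph R)
    (lam : R) : Prop :=
  exists u, L2sqnorm D u != 0%E /\ H u (fun x => lam%:C * u x).

(* The default value 0 is never used for an operator with a lowest
   eigenvalue. *)
Definition lowest_eigenvalue (R : realType) (D : set (R * R)) (H : graph R)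
    : R :=
  xget 0 [set lam | eigenvalue D H lam /\
                    forall lam', eigenvalue D H lam' -> lam <= lam'].

Definition resolvent (R : realType) (H : graph R) (lam : R) : graph R :=
  fun f u => H u (fun x => f x + lam%:C * u x).

Definition in_resolvent_set (R : realType) (D : set (R * R)) (H : graph R)
    (lam : R) : Prop :=
  exists2 C : R, 0 <= C & forall f, in_L2 D f ->
    exists u, [/\ resolvent H lam f u,
      (forall u', resolvent H lam f u' ->
         L2sqnorm D (fun x => u' x - u x) = 0%E) &
      L2norm D u <= C * L2norm D f].

Definition indicator_mul (R : realType) (A : set (R * R)) (u : R * R -> R[i])
    (x : R * R) : R[i] :=
  (\1_A x)%:C * u x.

(* The graph of [chi_A (H - lam)^-1 chi_B]. *)
Definition cut_resolvent (R : realType) (H : graph R) (lam : R)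
    (A B : set (R * R)) : graph R :=
  fun f v => exists2 u, resolvent H lam (indicator_mul B f) u
                      & v = indicator_mul A u.

Definition operator_norm (R : realType) (D : set (R * R)) (T : graph R)
    : \bar R :=
  ereal_sup [set (L2norm D v)%:E | v in
    [set v | exists f, [/\ in_L2 D f, L2norm D f <= 1 & T f v]]].

Definition waveguide_laplacian (R : realType) (kappa l : R) (g : R -> R)
    (w : Omega R) (N : nat) : graph R :=
  mixed_laplacian (waveguide kappa l g w N) (waveguide_walls kappa l g w N).

Definition waveguide_lowest (R : realType) (kappa l : R) (g : R -> R)
    (w : Omega R) (N : nat) : R :=
  lowest_eigenvalue (waveguide kappa l g w N)
                    (waveguide_laplacian kappa l g w N).

(* Main.v *)
Require Import Defs.
From HB Require Import structures.
From mathcomp Require Import all_boot all_order all_algebra complex.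
From mathcomp Require Import all_classical all_reals all_analysis.
From mathcomp Require Import measurable_realfun ring lra.

(* On the event that the lowest eigenvalue exceeds [1 + N^(-1/2)] the
   statement is deterministic. (The default value [0] of [lowest_eigenvalue]
   lies in the excluded event, so a lowest eigenvalue then exists.)

   Shearing the waveguide to a rectangle and applying Poincare's inequality on
   small cells shows that the form domain embeds compactly into [L^2].
   Minimizing sequences of the Rayleigh quotient therefore converge, so the
   infimum of the quotient is an eigenvalue, and the quadratic form dominates
   [1 + N^(-1/2)] times the squared [L^2] norm. For [lam <= 1 + 1/(2 sqrt N)]
   the form shifted by [lam] is thus coercive with constant
   [delta >= 1/(2 sqrt N)], which gives the resolvent.

   The decay is a Combes-Thomas estimate with the weight
   [eta x = exp (s (c - x.1))], [c = L - beta], which is at most [1] on [B] and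
   at least [exp (s t)] on [A], where [t = L - beta - alpha]. Testing the
   equation [(H - lam) u = f] with [eta^2 u] gives
   [(delta - s^2) |eta u|^2 <= (f, eta^2 u) <= |f| |eta u|_B]. Since [A] and
   [B] are disjoint, keeping both [|eta u|_A] and [|eta u|_B] on the left and
   using [4 X Y <= (X + Y)^2] yields
   [2 (delta - s^2) exp (s t) |u|_A <= |f|]. The factor [2] gained in this way
   allows [s^2 = 1/(4 sqrt N)] without any loss in the prefactor
   [2 sqrt N]. *)

Set Implicit Arguments.
Unset Strict Implicit.
Unset Printing Implicit Defensive.

Import Order.TTheory GRing.Theory Num.Theory.
Import numFieldNormedType.Exports.

Local Open Scope classical_set_scope.
Local Open Scope ring_scope.

(** * Quadratic forms on a real vector space *)

(** Functions are not identified almost everywhere, so no Hilbert space is at hand: the abstract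
    part uses a subspace of a real vector space with semidefinite forms, and completeness is asked
    only of sequences with a fixed geometric rate. An element of the form domain carries its
    gradient along, and the domain is a closure of C^1 test functions; estimates are proved for
    these by calculus along curves and pass to the closure, without traces, extensions or weak
    derivatives. Since the forms have real coefficients, the complex problem splits into two real
    ones. Compactness is an inequality: the mass is at most a small multiple of the energy plus
    finitely many squared functionals. An ultrafilter on the indices makes all bounded functionals
    Cauchy at once and replaces subsequences. The weight sees only the horizontal gap [t], whereas
    the claim concerns the Euclidean distance. That the distance is at most the positive part of [t]
    rests on [kappa], the profile and, almost surely, all couplings being bounded by 1. The rate [s]
    is N^(-1/4) / 2, so 1 / (48 sqrt N) leaves ample room. *)

Section Forms.
Variables (R : realType) (E : lmodType R) (V : set E).

Definition subspace := [/\ V 0, forall u v, V u -> V v -> V (u + v)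
  & forall c u, V u -> V (c *: u)].

Definition psd_form (b : E -> E -> R) := [/\
  forall u v, V u -> V v -> b u v = b v u,
  forall u v w, V u -> V v -> V w -> b (u + v) w = b u w + b v w,
  forall c u v, V u -> V v -> b (c *: u) v = c * b u v
  & forall u, V u -> 0 <= b u u].

Definition linear_on (F : E -> R) :=
  (forall u v, V u -> V v -> F (u + v) = F u + F v) /\
  (forall c u, V u -> F (c *: u) = c * F u).

Hypothesis VS : subspace.

Lemma subspace_comb u t v : V u -> V v -> V (u + t *: v).
Proof. by case: VS => _ VD VZ Vu Vv; apply/VD/VZ. Qed.

Lemma subspaceB u v : V u -> V v -> V (u - v).
Proof. by move=> Vu Vv; rewrite -scaleN1r; exact: subspace_comb. Qed.

Section OneForm.
Variables (b : E -> E -> R) (pb : psd_form b).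

Lemma form_combl u t v w : V u -> V v -> V w ->
  b (u + t *: v) w = b u w + t * b v w.
Proof.
by case: pb => _ bD bZ _ Vu Vv Vw; case: VS => _ _ VZ;
  rewrite bD ?bZ //; exact: VZ.
Qed.

Lemma form_comb u t v : V u -> V v ->
  b (u + t *: v) (u + t *: v) = b u u + 2 * t * b u v + t ^+ 2 * b v v.
Proof.
move=> Vu Vv; have Vc := subspace_comb t Vu Vv; have [bC _ _ _] := pb.
rewrite form_combl // (bC u) // (bC v) // !form_combl // (bC v u) //; ring.
Qed.

Lemma formB u v : V u -> V v -> b (u - v) (u - v) = b u u - 2 * b u v + b v v.
Proof. by move=> Vu Vv; rewrite -scaleN1r form_comb //; ring. Qed.

Lemma formD u v : V u -> V v -> b (u + v) (u + v) = b u u + 2 * b u v + b v v.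
Proof. by move=> Vu Vv; rewrite -[v]scale1r form_comb // scale1r; ring. Qed.

Lemma form_ge0 u : V u -> 0 <= b u u.
Proof. by case: pb => _ _ _; apply. Qed.

Lemma formZ c u : V u -> b (c *: u) (c *: u) = c ^+ 2 * b u u.
Proof.
case: pb => bC _ bZ _; case: VS => _ _ VZ Vu; have Vcu := VZ c _ Vu.
by rewrite bZ // bC // bZ //; ring.
Qed.

(** The difference of the two sides is the value of [b] on the diagonal at u - 2v. *)
Lemma form_le2 u v : V u -> V v -> b u u <= 2 * b v v + 2 * b (u - v) (u - v).
Proof.
move=> Vu Vv; have := form_ge0 (subspace_comb (- 2) Vu Vv).
by rewrite form_comb // formB //; lra.
Qed.

Lemma formD_le2 u v : V u -> V v -> b (u + v) (u + v) <= 2 * b u u + 2 * b v v.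
Proof.
by move=> Vu Vv; have := form_ge0 (subspaceB Vu Vv); rewrite formB // formD //; lra.
Qed.

Lemma formB_le2 u v : V u -> V v -> b (u - v) (u - v) <= 2 * b u u + 2 * b v v.
Proof.
move=> Vu Vv; have := form_ge0 (subspace_comb 1 Vu Vv).
by rewrite form_comb // formB //; lra.
Qed.

(** A quadratic polynomial without negative values has nonpositive discriminant. This serves both
    Cauchy-Schwarz and the first variation at an almost minimizer. *)
Lemma form_discriminant (B C : R) v : V v ->
  (forall t, 0 <= C + 2 * t * B + t ^+ 2 * b v v) -> B ^+ 2 <= C * b v v.
Proof.
move=> Vv H; have A0 := form_ge0 Vv.
have [A0'|An0] := eqVneq (b v v) 0.
  have [->|Bn0] := eqVneq B 0; first by rewrite A0' expr0n /= mulr0.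
  (* The leading coefficient vanishes; at this [t] the remaining affine function equals -1. *)
  have := H (- (C + 1) / (2 * B)); rewrite A0'.
  have -> : C + 2 * (- (C + 1) / (2 * B)) * B
    + (- (C + 1) / (2 * B)) ^+ 2 * 0 = -1 by field.
  by rewrite ler0N1.
have Ap : 0 < b v v by rewrite lt_def An0.
have := H (- B / b v v); rewrite -subr_ge0 => H1.
have := mulr_ge0 A0 H1.
have -> : b v v * (C + 2 * (- B / b v v) * B + (- B / b v v) ^+ 2 * b v v - 0)
  = C * b v v - B ^+ 2 by field.
by rewrite subr_ge0.
Qed.

Lemma form_cauchy_schwarz u v : V u -> V v -> b u v ^+ 2 <= b u u * b v v.
Proof.
move=> Vu Vv; apply: form_discriminant => // t.
by rewrite -form_comb //; exact/form_ge0/subspace_comb.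
Qed.

End OneForm.

(* The rate [8^-1 ^+ m] makes almost everywhere convergence in [L^2] a matter
   of geometric series. *)
Definition rapidly_complete (q : E -> E -> R) :=
  forall w : nat -> E, (forall n, V (w n)) ->
    (forall m n, (m <= n)%N -> q (w n - w m) (w n - w m) <= 8^-1 ^+ m) ->
    exists2 u, V u & exists C, forall n, q (u - w n) (u - w n) <= C * 8^-1 ^+ n.

Lemma ler_geometric_eq0 (x C : R) : 0 <= x ->
  (forall n : nat, x <= C * 8^-1 ^+ n) -> x = 0.
Proof.
move=> x0 H; apply/eqP; rewrite eq_le x0 andbT.
have : (fun n : nat => C * 8^-1 ^+ n) @ \oo --> C * 0.
  apply: cvgMr; apply: cvg_expr.
  by rewrite ger0_norm ?invr_ge0// invf_lt1 // ltr1n.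
rewrite mulr0 => h; case: leP => // xp.
have [n _ /(_ n (leqnn n))/= hn] := cvgr_lt _ h _ xp.
by have := H n; rewrite leNgt hn.
Qed.

(** Riesz representation by the direct method: the solution is the limit of a minimizing sequence of
    [J], which is Cauchy by the parallelogram identity. Since [b] may be degenerate, everything is
    measured by [b] itself. *)
Lemma coercive_form_solution (b : E -> E -> R) (F : E -> R) (C : R) :
  psd_form b -> rapidly_complete b -> linear_on F ->
  (forall v, V v -> F v ^+ 2 <= C * b v v) ->
  exists2 u, V u & forall v, V v -> b u v = F v.
Proof.
move=> pb cb [FD FZ] FC.
have [V0 VD VZ] := VS.
pose J u := b u u - 2 * F u.
have Fcomb u t v : V u -> V v -> F (u + t *: v) = F u + t * F v.
  by move=> Vu Vv; rewrite FD ?FZ //; exact: VZ.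
(* The bound 2F <= |C| + b follows from (2F)^2 <= 4|C|b <= (|C| + b)^2. *)
have Jlb u : V u -> - `|C| <= J u.
  move=> Vu; have b0 := form_ge0 pb Vu.
  have : F u ^+ 2 <= `|C| * b u u.
    by apply: (le_trans (FC _ Vu)); rewrite ler_wpM2r // ler_norm.
  have : 0 <= `|C| by [].
  rewrite /J; move: (`|C|) (b u u) (F u) b0 => c x f x0 c0 fcx.
  have : 2 * f <= c + x.
    have : (2 * f) ^+ 2 <= (c + x) ^+ 2.
      by have := sqr_ge0 (c - x); nra.
    rewrite -ler_sqrt ?sqr_ge0// !sqrtr_sqr => h.
    apply: (le_trans (ler_norm _)); apply: (le_trans h).
    by rewrite ger0_norm // addr_ge0.
  lra.
pose S := [set J u | u in V].
have S0 : S !=set0 by exists (J 0), 0.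
have lS : has_lbound S by exists (- `|C|) => _ [u Vu <-]; exact: Jlb.
pose m := inf S.
have mle u : V u -> m <= J u by move=> Vu; apply: ge_inf => //; exists u.
(* With this tolerance the parallelogram identity bounds [b] of the difference of the terms [n] and
   [m'] by half of [8^-1 ^+ n + 8^-1 ^+ m'], which is the rate that [rapidly_complete] asks for. *)
have ex n : exists u, V u /\ J u <= m + 4^-1 * 8^-1 ^+ n.
  have e0 : 0 < 4^-1 * 8^-1 ^+ n :> R by rewrite mulr_gt0 ?exprn_gt0 ?invr_gt0.
  have [_ [u Vu <-] h] := inf_adherent e0 (conj S0 lS).
  by exists u; split => //; exact: ltW.
have [w /all_and2[Vw Jw]] := choice ex.
have par u v : V u -> V v ->
    b (u - v) (u - v) = 2 * J u + 2 * J v - 4 * J (2^-1 *: (u + v)).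
  move=> Vu Vv; rewrite /J.
  have Vuv : V (2^-1 *: (u + v)) by apply/VZ/VD.
  rewrite (formZ pb); last exact: VD.
  rewrite FZ ?FD ?(formB pb) ?(formD pb) //; first by field.
  exact: VD.
have /(cb _ Vw)[u Vu [K uw]] : forall m' n, (m' <= n)%N ->
    b (w n - w m') (w n - w m') <= 8^-1 ^+ m'.
  move=> m' n mn; have Vh : V (2^-1 *: (w n + w m')) by apply/VZ/VD.
  rewrite par //; have := mle _ Vh; have := Jw n; have := Jw m'.
  have : 8^-1 ^+ n <= 8^-1 ^+ m' :> R.
    by apply: ler_wiXn2l => //; rewrite ?invr_ge0// invf_le1// ler1n.
  lra.
exists u => // v Vv.
apply/eqP; rewrite -subr_eq0 -sqrf_eq0; apply/eqP.
apply: (@ler_geometric_eq0 _ ((2 * K + 2) * b v v)); first exact: sqr_ge0.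
move=> n.
(* First variation: along [w n + t *: v] the functional [J] stays above its infimum and at t = 0
   exceeds it by at most the tolerance, so the discriminant controls the linear coefficient in
   [t]. *)
have b1 : (b (w n) v - F v) ^+ 2 <= (4^-1 * 8^-1 ^+ n) * b v v.
  apply: form_discriminant => // t.
  have := mle _ (subspace_comb t (Vw n) Vv); rewrite /J (form_comb pb) // Fcomb //.
  have := Jw n; rewrite /J; lra.
have b2 := form_cauchy_schwarz pb (subspaceB Vu (Vw n)) Vv.
have b3 : b (u - w n) v = b u v - b (w n) v.
  by rewrite -scaleN1r (form_combl pb) //; ring.
have := ler_wpM2r (form_ge0 pb Vv) (uw n).
move: b1 b2; rewrite b3 => b1 b2 b4.
have := sqr_ge0 ((b u v - b (w n) v) - (b (w n) v - F v)).
have : 0 <= 8^-1 ^+ n * b v v by rewrite mulr_ge0 ?form_ge0 ?exprn_ge0 ?invr_ge0.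
nra.
Qed.

(** A segment is compact, and an ultrafilter converges to each of its cluster points. *)
Lemma bounded_ultra_cauchy (U : set_system nat) (x : nat -> R) (M e : R) :
  UltraFilter U -> (forall n, `|x n| <= M) -> 0 < e ->
  exists2 A, U A & forall m n, A m -> A n -> `|x n - x m| <= e.
Proof.
move=> UU xM e0.
have Ux : U [set n | x n \in `[- M, M]].
  by apply: filterE => n; rewrite /= in_itv /= -ler_norml.
have [p [_ clp]] := @segment_compact _ (- M) M (x @ U) _ Ux.
pose A := [set n | `|x n - p| < e / 2].
exists A; last first.
  move=> m n /= /ltW Am /ltW An.
  have -> : x n - x m = (x n - p) - (x m - p) by ring.
  by apply: (le_trans (ler_normB _ _)); lra.
have [//|UA] := in_ultra_setVsetC A UU.
have e20 : 0 < e / 2 by rewrite divr_gt0.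
have [y []] := clp [set y | ~ (`|y - p| < e / 2)] (ball p (e / 2)) UA (nbhsx_ballx _ _ e20).
by rewrite /ball /= => h1; rewrite distrC => /h1.
Qed.

(** Compactness of the embedding from the norm of [a + b] into that of [b], in a form free of
    sequences. For the waveguide the functionals are cell averages, whose number grows as [e]
    shrinks. *)
Definition relatively_compact (a b : E -> E -> R) :=
  forall e : R, 0 < e -> exists (I : finType) (F : I -> E -> R) (C : R),
    [/\ forall i, linear_on (F i),
        forall i u, V u -> F i u ^+ 2 <= C * b u u
      & forall u, V u -> b u u <= e * a u u + \sum_i F i u ^+ 2].

(** * Attainment of the infimum of the Rayleigh quotient *)

Section LowestEigenvalue.
Variables a b : E -> E -> R.
Hypotheses (pa : psd_form a) (pb : psd_form b).
Hypothesis compl : rapidly_complete (fun u v => a u v + b u v).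
Hypothesis comp : relatively_compact a b.

Lemma linear_onB F u v : linear_on F -> V u -> V v -> F (u - v) = F u - F v.
Proof.
case: VS => _ _ VZ [FD FZ] Vu Vv; rewrite -scaleN1r FD ?FZ //; last exact: VZ.
by ring.
Qed.

(** Each of the finitely many functionals is Cauchy along [U], and finitely many sets of [U]
    intersect in a set of [U]. *)
Lemma bounded_ultra_form_cauchy (U : set_system nat) (w : nat -> E) (M e : R) :
  UltraFilter U -> (forall n, V (w n)) ->
  (forall n, a (w n) (w n) <= M) -> (forall n, b (w n) (w n) <= M) -> 0 < e ->
  exists2 A, U A & forall m n, A m -> A n -> b (w n - w m) (w n - w m) <= e.
Proof.
move=> UU Vw aM bM e0.
have M0 : 0 <= M by apply: (le_trans (form_ge0 pa (Vw 0%N))).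
have M40 : 0 < 4 * M + 1 by lra.
(* Differences have energy at most 4M, so with this parameter the energy term contributes at most
   e/2; the added 1 covers M = 0. *)
have ep : 0 < e / (2 * (4 * M + 1)) by rewrite divr_gt0 // mulr_gt0.
have [I [F [C [FL FC Fb]]]] := comp ep.
pose k := #|I|.
(* Each of the [k] squared functionals will be at most [eta], together at most e/2; the added 1
   covers k = 0. *)
pose eta := e / (2 * (k%:R + 1)).
have k1 : 0 < k%:R + 1 :> R by rewrite ltr_wpDl.
have eta0 : 0 < eta by rewrite divr_gt0 // mulr_gt0.
have seta0 : 0 < Num.sqrt eta by rewrite sqrtr_gt0.
have Fbd i n : `|F i (w n)| <= `|C| * M + 1.
  have CM : 0 <= `|C| * M by rewrite mulr_ge0.
  have h : F i (w n) ^+ 2 <= `|C| * M.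
    apply: (le_trans (FC i _ (Vw n))); apply: (@le_trans _ _ (`|C| * b (w n) (w n))).
      by rewrite ler_wpM2r ?(form_ge0 pb) // ler_norm.
    by rewrite ler_wpM2l.
  rewrite -(@ler_pXn2r _ 2) ?nnegrE //; last by rewrite addr_ge0.
  rewrite real_normK ?num_real //; nra.
have /choice[A /all_and2[UA hA]] : forall i, exists A, U A /\
    forall m n, A m -> A n -> `|F i (w n) - F i (w m)| <= Num.sqrt eta.
  move=> i; have [A ? ?] := bounded_ultra_cauchy UU (Fbd i) seta0.
  by exists A.
exists [set n | forall i, A i n]; first exact: filter_forall.
move=> m n Am An.
apply: (le_trans (Fb _ (subspaceB (Vw n) (Vw m)))).
have h1 : a (w n - w m) (w n - w m) <= 4 * M + 1.
  by have := formB_le2 pa (Vw n) (Vw m); have := aM n; have := aM m; lra.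
have h2 : e / (2 * (4 * M + 1)) * a (w n - w m) (w n - w m) <= e / 2.
  apply: (le_trans (ler_wpM2l (ltW ep) h1)).
  by rewrite le_eqVlt; apply/orP; left; apply/eqP; field; lra.
have h3 : \sum_i F i (w n - w m) ^+ 2 <= \sum_(i in I) eta.
  apply: ler_sum => i _; rewrite linear_onB //.
  rewrite -[leLHS]real_normK ?num_real // -[leRHS]sqr_sqrtr; last exact: ltW.
  by rewrite ler_pXn2r ?nnegrE // ?hA.
have h4 : \sum_(i in I) eta <= e / 2.
  rewrite sumr_const -/k -mulr_natr /eta.
  rewrite -subr_ge0 (_ : _ - _ = e / (2 * (k%:R + 1))); last by field; lra.
  exact: ltW.
lra.
Qed.

(** By contradiction: a Rayleigh quotient below [ls] puts the infimum [s] below [ls], and a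
    minimizer makes [s] a weak eigenvalue. *)
Lemma lowest_eigenvalue_le_form (ls : R) :
  (forall lam u, V u -> 0 < b u u ->
     (forall v, V v -> a u v = lam * b u v) -> ls <= lam) ->
  forall u, V u -> ls * b u u <= a u u.
Proof.
move=> hls u0 Vu0; rewrite leNgt; apply/negP => lt0.
have [V0 VD VZ] := VS.
have bu0 : 0 < b u0 u0.
  rewrite lt_def (form_ge0 pb) // andbT; apply/negP => /eqP b0.
  by move: lt0; rewrite b0 mulr0 ltNge (form_ge0 pa).
have norm u : V u -> 0 < b u u -> exists c, [/\ V (c *: u), b (c *: u) (c *: u) = 1
    & a (c *: u) (c *: u) = a u u / b u u].
  move=> Vu bu; exists (Num.sqrt (b u u))^-1; split; first exact: VZ.
    by rewrite (formZ pb) // exprVn sqr_sqrtr ?ltW // mulVf // gt_eqF.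
  by rewrite (formZ pa) // exprVn sqr_sqrtr ?ltW // mulrC.
pose S := [set r | exists u, [/\ V u, b u u = 1 & a u u = r]].
have S0 : S !=set0.
  by have [c [? ? ?]] := norm _ Vu0 bu0; exists (a u0 u0 / b u0 u0), (c *: u0).
have lS : has_lbound S by exists 0 => _ [u [Vu _ <-]]; exact: (form_ge0 pa).
pose s := inf S.
have sge0 : 0 <= s by apply: lb_le_inf => // _ [u [Vu _ <-]]; exact: (form_ge0 pa).
have sle u : V u -> s * b u u <= a u u.
  move=> Vu; have [->|bn0] := eqVneq (b u u) 0; first by rewrite mulr0 (form_ge0 pa).
  have bp : 0 < b u u by rewrite lt_def bn0 (form_ge0 pb).
  have [c [? ? ?]] := norm _ Vu bp.
  by rewrite -ler_pdivlMr //; apply: ge_inf => //; exists (c *: u).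
have sls : s < ls.
  apply: (@le_lt_trans _ _ (a u0 u0 / b u0 u0)); first by rewrite ler_pdivlMr // sle.
  by rewrite ltr_pdivrMr.
have ex (n : nat) : exists u, [/\ V u, b u u = 1 & a u u <= s + n.+1%:R^-1].
  have e0 : 0 < n.+1%:R^-1 :> R by rewrite invr_gt0.
  have [_ [u [Vu bu <-]] h] := inf_adherent e0 (conj S0 lS).
  by exists u; split => //; exact: ltW.
have [w /all_and3[Vw bw aw]] := choice ex.
(* [U] refines the eventual filter, so it contains every tail and [w] stays minimizing along it. *)
have [U [UU subU]] := ultraFilterLemma (@eventually_filter : ProperFilter \oo).
have aM n : a (w n) (w n) <= s + 1.
  by apply: (le_trans (aw n)); rewrite lerD2l invf_le1 // ler1n.
have bM n : b (w n) (w n) <= s + 1 by rewrite bw; lra.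
have large (e : R) : 0 < e -> exists2 A, U A & forall n, A n -> n.+1%:R^-1 <= e.
  move=> e0; exists [set n | n.+1%:R^-1 <= e] => //.
  apply: subU; have := @cvg_harmonic R => /cvgr0_norm_lt /(_ _ e0); apply: filterS => n /=.
  by move=> /ltW; apply: le_trans; rewrite ler_norm.
(* Parallelogram identity for [a]: since a >= s b at the sum and b = 1 along the sequence, [a] of a
   difference is at most small terms plus [s] times [b] of the difference. Being Cauchy for [b] thus
   implies being Cauchy for a + b. *)
have cauchy (e : R) : 0 < e -> exists A, U A /\ forall m n, A m -> A n ->
    a (w n - w m) (w n - w m) + b (w n - w m) (w n - w m) <= e
    /\ a (w n) (w n) <= s + e.
  move=> e0.
  have e1 : 0 < e / (2 * (s + 1)) by rewrite divr_gt0 //; lra.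
  have e2 : 0 < e / 8 by rewrite divr_gt0.
  have [A UA hA] := bounded_ultra_form_cauchy UU Vw aM bM e1.
  have [B UB hB] := large _ e2.
  exists (A `&` B); split; first exact: filterI.
  move=> m n [Am Bm] [An Bn].
  have hab := hA m n Am An.
  have : (s + 1) * b (w n - w m) (w n - w m) <= e / 2.
    rewrite -ler_pdivlMl; last lra.
    by apply: (le_trans hab); rewrite le_eqVlt; apply/orP; left; apply/eqP; field; lra.
  have := aw n; have := aw m; have := hB _ Bm; have := hB _ Bn.
  have := sle _ (VD _ _ (Vw n) (Vw m)).
  rewrite !(formB pa) // !(formB pb) // !(formD pa) // !(formD pb) // !bw.
  move: (a (w n) (w n)) (a (w m) (w m)) (a (w n) (w m)) (b (w n) (w m)) n.+1%:R^-1 m.+1%:R^-1.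
  by move=> *; split; lra.
have ck (k : nat) : exists A, U A /\ forall m n, A m -> A n ->
    a (w n - w m) (w n - w m) + b (w n - w m) (w n - w m) <= 8^-1 ^+ k
    /\ a (w n) (w n) <= s + 8^-1 ^+ k.
  by apply: cauchy; apply: exprn_gt0; rewrite ?invr_gt0.
have [A /all_and2[UA hA]] := choice ck.
(* The sets [A j] are not nested, so an index is taken from [A 0], ..., [A k] simultaneously; two
   such indices are compared inside the set of the smaller level. *)
have exn (k : nat) : exists n, forall j, (j <= k)%N -> A j n.
  have : U [set n | forall j : 'I_k.+1, A j n].
    by apply: filter_forall => j; exact: UA.
  by move=> /filter_ex[n hn]; exists n => j jk; have := hn (Ordinal (jk : (j < k.+1)%N)).
have [nk hnk] := choice exn.
have [u Vu [K uw]] := compl (fun k => Vw (nk k))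
  (fun m n mn => (hA m _ _ (hnk m m (leqnn m)) (hnk n m mn)).1).
have anw k : a (w (nk k)) (w (nk k)) <= s + 8^-1 ^+ k.
  exact: (hA k _ _ (hnk k k (leqnn k)) (hnk k k (leqnn k))).2.
have buk k : 1 <= 2 * b u u + (2 * K) * 8^-1 ^+ k.
  have := form_le2 pb (Vw (nk k)) Vu; have := uw k; rewrite bw.
  have := form_ge0 pa (subspaceB Vu (Vw (nk k))).
  rewrite (formB pa) // !(formB pb) // bw; case: pb => bC _ _ _; rewrite (bC u) //.
  by lra.
(* The limit is not degenerate because every [w n] has mass 1. *)
have bup : 0 < b u u.
  rewrite lt_def (form_ge0 pb) // andbT; apply/negP => /eqP bu.
  have : (1 : R) = 0.
    apply: (@ler_geometric_eq0 _ (2 * K)) => // k.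
    by have := buk k; rewrite bu mulr0 add0r.
  by apply/eqP; rewrite oner_eq0.
(* The form a - s b is semidefinite and vanishes at [u]; by Cauchy-Schwarz [u] lies in its kernel,
   which is the weak eigenvalue equation. *)
have pc : psd_form (fun x y => a x y - s * b x y).
  case: pa => aC aD aZ _; case: pb => bC bD bZ _; split => /=.
  - by move=> x y Vx Vy; rewrite aC // bC.
  - by move=> x y z Vx Vy Vz; rewrite aD // bD //; ring.
  - by move=> c x y Vx Vy; rewrite aZ // bZ //; ring.
  - by move=> x Vx; rewrite subr_ge0 sle.
have cu0 : a u u - s * b u u = 0.
  apply: (@ler_geometric_eq0 _ (2 + 2 * K)); first by rewrite subr_ge0 sle.
  move=> k; have := form_le2 pc Vu (Vw (nk k)) => /=.
  have := anw k; have := uw k; rewrite bw.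
  have := form_ge0 pa (subspaceB Vu (Vw (nk k))).
  have := form_ge0 pb (subspaceB Vu (Vw (nk k))).
  by nra.
have := hls s u Vu bup; rewrite leNgt sls => /(_ _)/negP; apply => // v Vv.
have := form_cauchy_schwarz pc Vu Vv => /=.
rewrite cu0 mul0r => h; apply/eqP; rewrite -subr_eq0 -sqrf_eq0 eq_le h.
exact: sqr_ge0.
Qed.

End LowestEigenvalue.

End Forms.

(** * Square-integrable functions *)

Section SquareIntegrable.
Context d (T : measurableType d) (R : realType).
Variables (mu : {measure set T -> \bar R}) (D : set T).
Hypothesis mD : measurable D.
Implicit Types f g h : T -> R.

Definition sqnorm f : \bar R := (\int[mu]_(x in D) (f x ^+ 2)%:E)%E.

Definition L2 f := measurable_fun D f /\ (sqnorm f < +oo)%E.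

Definition dot f g : R := \int[mu]_(x in D) (f x * g x).

Lemma sqnorm_ge0 f : (0 <= sqnorm f)%E.
Proof. by apply: integral_ge0 => x _; rewrite lee_fin sqr_ge0. Qed.

Lemma measurable_sqr f : measurable_fun D f ->
  measurable_fun D (fun x => (f x ^+ 2)%:E).
Proof. by move=> mf; apply/measurable_EFinP; exact: measurable_funX. Qed.

Lemma integrable_sqr f : L2 f -> mu.-integrable D (EFin \o (fun x => f x ^+ 2)).
Proof.
move=> [mf ff]; apply/integrableP; split; first exact: measurable_sqr.
rewrite (eq_integral (fun x => (f x ^+ 2)%:E)) // => x _ /=.
by rewrite ger0_norm // sqr_ge0.
Qed.

Lemma integrableM f g : L2 f -> L2 g ->
  mu.-integrable D (EFin \o (fun x => f x * g x)).
Proof.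
move=> Lf Lg; have [[mf _] [mg _]] := (Lf, Lg).
have := integrableD mD (integrable_sqr Lf) (integrable_sqr Lg).
apply: le_integrable => //.
  by apply/measurable_EFinP; exact: measurable_funM.
move=> x _ /=; rewrite lee_fin normrM (ger0_norm (addr_ge0 (sqr_ge0 _) (sqr_ge0 _))).
rewrite -(real_normK (num_real (f x))) -(real_normK (num_real (g x))).
have := sqr_ge0 (`|f x| - `|g x|); have := normr_ge0 (f x); have := normr_ge0 (g x).
nra.
Qed.

Lemma integral_dot f g : L2 f -> L2 g ->
  (\int[mu]_(x in D) (f x * g x)%:E = (dot f g)%:E)%E.
Proof.
by move=> Lf Lg; rewrite /dot /Rintegral fineK //; apply: integrable_fin_num => //;
  exact: integrableM.
Qed.

Lemma sqnormE f : L2 f -> sqnorm f = (dot f f)%:E.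
Proof.
by move=> Lf; rewrite -integral_dot //; apply: eq_integral => x _; rewrite expr2.
Qed.

Lemma L2_0 : L2 (fun=> 0).
Proof.
split; first exact: measurable_cst.
by rewrite /sqnorm integral0_eq ?ltry // => x _; rewrite expr0n.
Qed.

Lemma le_sqnorm f g C : 0 <= C -> measurable_fun D f -> measurable_fun D g ->
  (forall x, D x -> f x ^+ 2 <= C * g x ^+ 2) ->
  (sqnorm f <= C%:E * sqnorm g)%E.
Proof.
move=> C0 mf mg fg.
rewrite /sqnorm -ge0_integralZl_EFin //; first last.
- exact: measurable_sqr.
- by move=> x _; rewrite lee_fin sqr_ge0.
apply: ge0_le_integral => //.
- by move=> x _; rewrite lee_fin sqr_ge0.
- exact: measurable_sqr.
- by apply: measurable_funeM; exact: measurable_sqr.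
Qed.

Lemma L2_le f g C : 0 <= C -> L2 g -> measurable_fun D f ->
  (forall x, D x -> f x ^+ 2 <= C * g x ^+ 2) -> L2 f.
Proof.
move=> C0 [mg fing] mf fg; split => //.
by apply: (le_lt_trans (le_sqnorm C0 mf mg fg)); rewrite lte_mul_pinfty.
Qed.

Lemma L2Z c f : L2 f -> L2 (fun x => c * f x).
Proof.
move=> Lf; apply: (@L2_le _ f (c ^+ 2)) => //; first exact: sqr_ge0.
  by apply: measurable_funM => //; case: Lf.
by move=> x _; rewrite exprMn.
Qed.

Lemma L2D f g : L2 f -> L2 g -> L2 (fun x => f x + g x).
Proof.
move=> Lf Lg; have [[mf ff] [mg fg]] := (Lf, Lg).
split; first exact: measurable_funD.
apply: (@le_lt_trans _ _ (\int[mu]_(x in D) (2%:E * ((f x ^+ 2)%:E + (g x ^+ 2)%:E)))%E).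
  apply: ge0_le_integral => //.
  - by move=> x _; rewrite lee_fin sqr_ge0.
  - by apply: measurable_sqr; exact: measurable_funD.
  - by apply: measurable_funeM; apply: emeasurable_funD; exact: measurable_sqr.
  - move=> x _; rewrite -EFinD -EFinM lee_fin; have := sqr_ge0 (f x - g x); nra.
rewrite ge0_integralZl_EFin //.
- rewrite ge0_integralD //.
  + by rewrite lte_mul_pinfty // lte_add_pinfty.
  + by move=> x _; rewrite lee_fin sqr_ge0.
  + exact: measurable_sqr.
  + by move=> x _; rewrite lee_fin sqr_ge0.
  + exact: measurable_sqr.
- by move=> x _; rewrite -EFinD lee_fin addr_ge0 // sqr_ge0.
- by apply: emeasurable_funD; exact: measurable_sqr.
Qed.

Lemma L2B f g : L2 f -> L2 g -> L2 (fun x => f x - g x).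
Proof.
move=> Lf Lg; have := L2D Lf (L2Z (-1) Lg); congr L2.
by apply/funext => x; rewrite mulN1r.
Qed.

Lemma dotC f g : dot f g = dot g f.
Proof. by apply: eq_Rintegral => x _; rewrite mulrC. Qed.

Lemma dotDl f g h : L2 f -> L2 g -> L2 h ->
  dot (fun x => f x + g x) h = dot f h + dot g h.
Proof.
move=> Lf Lg Lh; rewrite /dot -RintegralD //; try exact: integrableM.
by apply: eq_Rintegral => x _; rewrite mulrDl.
Qed.

Lemma dotZl c f h : L2 f -> L2 h -> dot (fun x => c * f x) h = c * dot f h.
Proof.
move=> Lf Lh; rewrite /dot -RintegralZl //; try exact: integrableM.
by apply: eq_Rintegral => x _; rewrite mulrA.
Qed.

Lemma dot_ge0 f : 0 <= dot f f.
Proof. by apply: Rintegral_ge0 => x _; rewrite -expr2 sqr_ge0. Qed.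

Lemma dot_le f g C : 0 <= C -> L2 f -> L2 g ->
  (forall x, D x -> f x ^+ 2 <= C * g x ^+ 2) -> dot f f <= C * dot g g.
Proof.
move=> C0 Lf Lg fg; rewrite -lee_fin EFinM -!sqnormE //.
by apply: le_sqnorm => //; [case: Lf | case: Lg].
Qed.

(** Consecutive terms differ by at most [Num.sqrt M * 2^-1 ^+ k], so the telescoping series is
    dominated by a geometric one. *)
Lemma cvg_of_rapid (w : nat -> R) (M : R) :
  (forall k, 4 ^+ k * (w k.+1 - w k) ^+ 2 <= M) -> cvgn w.
Proof.
move=> h.
have M0 : 0 <= M by apply: (le_trans _ (h 0%N)); rewrite expr0 mul1r sqr_ge0.
have -> : w = (fun n => w 0%N + series (telescope w) n).
  by apply/funext => n; rewrite telescopeK /=; ring.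
apply: is_cvgD; first exact: is_cvg_cst.
apply: normed_cvg.
apply: (@series_le_cvg _ _ (geometric (Num.sqrt M) 2^-1)).
- by move=> n; exact: normr_ge0.
- by move=> n; rewrite /geometric /= mulr_ge0 ?sqrtr_ge0 // exprn_ge0 // invr_ge0.
- move=> n; have g0 : 0 <= Num.sqrt M * 2^-1 ^+ n.
    by rewrite mulr_ge0 ?sqrtr_ge0 // exprn_ge0 // invr_ge0.
  rewrite /telescope /geometric /= -(@ler_pXn2r _ 2) ?nnegrE //.
  rewrite real_normK ?num_real // exprMn sqr_sqrtr //.
  have -> : (2^-1 ^+ n) ^+ 2 = (4 ^+ n)^-1 :> R.
    by rewrite -exprM mulnC exprM -exprVn; congr (_ ^+ _); field.
  by rewrite ler_pdivlMr ?exprn_gt0 // mulrC.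
- by apply: is_cvg_geometric_series; rewrite ger0_norm ?invr_ge0 // invf_lt1 // ltr1n.
Qed.

(** The rate splits as 1/8 = 1/4 * 1/2: the squared increments weighted by [4 ^+ k] have integrals
    summing to at most 2, so their sum is finite almost everywhere and bounds the increments at such
    a point geometrically. *)
Lemma ae_cvg_of_rapid (w : nat -> T -> R) : (forall n, L2 (w n)) ->
  (forall n, dot (fun x => w n.+1 x - w n x) (fun x => w n.+1 x - w n x) <= 8^-1 ^+ n) ->
  {ae mu, forall x, D x -> cvgn (w^~ x)}.
Proof.
move=> Lw hw.
pose f k x := (4 ^+ k * (w k.+1 x - w k x) ^+ 2)%:E.
have f0 k x : D x -> (0 <= f k x)%E.
  by move=> _; rewrite lee_fin; apply: mulr_ge0; [exact: exprn_ge0|exact: sqr_ge0].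
have Ld k := L2B (Lw k.+1) (Lw k).
have mf k : measurable_fun D (f k).
  apply/measurable_EFinP; apply: measurable_funM => //; apply: measurable_funX.
  by case: (Ld k).
have fi k : (\int[mu]_(x in D) f k x <= (2^-1 ^+ k)%:E)%E.
  have -> : (\int[mu]_(x in D) f k x = (4 ^+ k)%:E * sqnorm (fun x => (w k.+1 x - w k x)%R))%E.
    rewrite -ge0_integralZl_EFin ?exprn_ge0 //.
      by move=> x _; rewrite lee_fin sqr_ge0.
    by apply: measurable_sqr; case: (Ld k).
  rewrite sqnormE // -EFinM lee_fin.
  apply: (le_trans (ler_wpM2l _ (hw k))); first by rewrite exprn_ge0.
  by rewrite -exprMn (_ : 4 * 8^-1 = 2^-1 :> R) //; field.
pose S x := (\sum_(k <oo) f k x)%E.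
have S0 x : D x -> (0 <= S x)%E by move=> Dx; apply: nneseries_ge0 => n _ _; exact: f0.
have mS : measurable_fun D S.
  by apply: ge0_emeasurable_sum => // k x Dx _; exact: f0.
have Si : (\int[mu]_(x in D) S x < +oo)%E.
  rewrite integral_nneseries //.
  apply: (@le_lt_trans _ _ (\sum_(k <oo) (2^-1 ^+ k)%:E)%E).
    by apply: lee_nneseries => // k _ _; apply: integral_ge0 => x Dx; exact: f0.
  apply: (@le_lt_trans _ _ 2%:E); last exact: ltry.
  apply: lime_le; first exact: is_cvg_nneseries.
  apply: nearW => n; rewrite sumEFin lee_fin.
  have := @geometric_le_lim R n 1 2^-1; rewrite mul1r (_ : (1 - 2^-1)^-1 = 2); last by field.
  rewrite /series /geometric /= => h; apply: (le_trans _ (h _ _ _)) => //.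
  - by under [leRHS]eq_bigr do rewrite mul1r.
  - by rewrite ger0_norm // invf_lt1 // ltr1n.
have iS : mu.-integrable D S.
  apply/integrableP; split => //.
  by rewrite (eq_integral S) // => x; rewrite inE => Dx; rewrite gee0_abs // S0.
apply: filterS (integrable_ae mD iS) => x h Dx.
have Sfin := h Dx.
apply: (@cvg_of_rapid _ (fine (S x))) => k.
rewrite -lee_fin fineK //.
apply: (@le_trans _ _ (\sum_(0 <= i < k.+1) f i x)%E).
  by rewrite big_nat_recr //= leeDr // sume_ge0 // => i _; exact: f0.
by apply: nneseries_lim_ge => i _ _; exact: f0.
Qed.

Lemma limn_einf_le (u : (\bar R)^nat) (c : \bar R) :
  (\forall n \near \oo, u n <= c)%E -> (limn_einf u <= c)%E.
Proof.
move=> uc; rewrite limn_einf_lim; apply: lime_le; first exact: is_cvg_einfs.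
apply: filterS uc => n; apply: le_trans; apply: ereal_inf_lbound.
by exists n => //=.
Qed.

(** Riesz-Fischer: the pointwise limit exists almost everywhere, and Fatou's lemma carries the
    Cauchy bound over to it. *)
Lemma L2_rapidly_complete (w : nat -> T -> R) : (forall n, L2 (w n)) ->
  (forall m n, (m <= n)%N ->
    dot (fun x => w n x - w m x) (fun x => w n x - w m x) <= 8^-1 ^+ m) ->
  exists2 u, L2 u &
    forall n, dot (fun x => u x - w n x) (fun x => u x - w n x) <= 8^-1 ^+ n.
Proof.
move=> Lw hw.
have aec := ae_cvg_of_rapid Lw (fun n => hw n n.+1 (leqnSn n)).
(* The upper limit is measurable on all of [D], also where [w] diverges; [fine] turns infinite
   values into 0, which affects a null set only. *)
pose u x := fine (limn_esup (fun n => (w n x)%:E)).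
have mw n : measurable_fun D (w n) by case: (Lw n).
have mu_ : measurable_fun D u.
  apply: measurableT_comp => //.
  by apply: measurable_fun_limn_esup => n; apply/measurable_EFinP.
have ulim x : cvgn (w^~ x) -> w ^~ x @ \oo --> u x.
  move=> cw; rewrite /u is_cvg_limn_esupE; last first.
    by apply/cvg_ex; exists (limn (w^~ x))%:E; apply/fine_cvgP; split => //; exact: nearW.
  by rewrite EFin_lim.
have Ld n m := L2B (Lw n) (Lw m).
have bound n : (sqnorm (fun x => u x - w n x)%R <= (8^-1 ^+ n)%:E)%E.
  pose g m x := ((w m x - w n x) ^+ 2)%:E.
  have mg m : measurable_fun D (g m) by apply: measurable_sqr; case: (Ld m n).
  apply: (@le_trans _ _ (\int[mu]_(x in D) limn_einf (g^~ x))%E).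
    apply: ae_ge0_le_integral => //.
    - by move=> x _; rewrite lee_fin sqr_ge0.
    - by apply: measurable_sqr; exact: measurable_funB.
    - move=> x Dx; rewrite limn_einf_lim; apply: lime_ge; first exact: is_cvg_einfs.
      apply: nearW => m; apply: le_ereal_inf_tmp => _ [k _ <-].
      by rewrite lee_fin sqr_ge0.
    - apply: measurableT_comp => //; apply: measurable_fun_limn_esup => m.
      by apply: measurableT_comp.
    - apply: filterS aec => x h Dx.
      have cg : g^~ x @ \oo --> ((u x - w n x) ^+ 2)%:E.
        apply/fine_cvgP; split; first exact: nearW.
        have hu : (fun m => w m x - w n x) @ \oo --> u x - w n x.
          by apply: cvgB; [exact/ulim/h | exact: cvg_cst].
        rewrite expr2 (_ : _ \o _ = (fun m => (w m x - w n x) * (w m x - w n x))).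
          exact: cvgM.
        by apply/funext => m; rewrite /= expr2.
      by rewrite is_cvg_limn_einfE ?(cvg_lim _ cg) //; apply/cvg_ex; exists ((u x - w n x) ^+ 2)%:E.
  apply: (le_trans (fatou _ _ _ _)) => //.
    by move=> m x _; rewrite lee_fin sqr_ge0.
  apply: limn_einf_le; exists n => // m /= nm.
  by have := hw n m nm; rewrite -lee_fin -sqnormE.
have Lu n : L2 (fun x => u x - w n x).
  split; first exact: measurable_funB.
  by apply: (le_lt_trans (bound n)); rewrite ltry.
exists u => [|n]; last by rewrite -lee_fin -sqnormE.
have := L2D (Lu 0%N) (Lw 0%N); congr L2.
by apply/funext => x; rewrite subrK.
Qed.

End SquareIntegrable.

Section L2Form.
Context d (T : measurableType d) (R : realType).
Variables (mu : {measure set T -> \bar R}) (D : set T).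
Hypothesis mD : measurable D.

Lemma L2_subspace : subspace (L2 mu D : set (T -> R)).
Proof.
split; [exact: L2_0 | by move=> u v; exact: L2D | by move=> c u; exact: L2Z].
Qed.

Lemma dot_psd : psd_form (L2 mu D : set (T -> R)) (dot mu D).
Proof.
split.
- by move=> u v _ _; exact: dotC.
- by move=> u v w; exact: dotDl.
- by move=> c u v; exact: dotZl.
- by move=> u _; exact: dot_ge0.
Qed.

Lemma dot_cauchy_schwarz f g : L2 mu D f -> L2 mu D g ->
  dot mu D f g ^+ 2 <= dot mu D f f * dot mu D g g.
Proof. exact: (form_cauchy_schwarz L2_subspace dot_psd). Qed.

Hypothesis muD : (mu D < +oo)%E.

Lemma L2_cst c : L2 mu D (fun=> c).
Proof.
split => //; rewrite /sqnorm integral_cst // lte_mul_pinfty //.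
by rewrite lee_fin sqr_ge0.
Qed.

Lemma dot_cst1 : dot mu D (fun=> 1) (fun=> 1) = fine (mu D).
Proof. by rewrite /dot Rintegral_cst // !mul1r. Qed.

(* The variance of [f] is the minimum over [c] of the mean of [(f - c)^2]. *)
Lemma sqnorm_le_oscillation f (e k : T -> \bar R) : L2 mu D f ->
  measurable_fun D e -> measurable_fun D k ->
  (forall z, D z -> 0 <= e z)%E -> (forall z, D z -> 0 <= k z)%E ->
  (forall z z', D z -> D z' -> ((f z - f z') ^+ 2)%:E <= 2%:E * e z + 2%:E * k z')%E ->
  (sqnorm mu D f <= (dot mu D f (fun=> 1%R) ^+ 2 / fine (mu D))%:E
     + 2%:E * \int[mu]_(z in D) e z + 2%:E * \int[mu]_(z in D) k z)%E.
Proof.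
move=> Lf me mk e0 k0 ek.
have finD : mu D \is a fin_num by rewrite ge0_fin_numE.
pose m := fine (mu D).
have mE : mu D = m%:E by rewrite fineK.
have m0 : 0 <= m by rewrite fine_ge0.
have ie0 : (0 <= \int[mu]_(z in D) e z)%E by exact: integral_ge0.
have ik0 : (0 <= \int[mu]_(z in D) k z)%E by exact: integral_ge0.
(* On a null set the quotient by [m] is 0 by convention, and the left-hand side vanishes as well. *)
have [mz|mn0] := eqVneq m 0.
  have -> : sqnorm mu D f = 0%E.
    rewrite /sqnorm; apply: null_set_integral => //; last by rewrite mE mz.
    by apply: measurable_sqr; case: Lf.
  by rewrite !adde_ge0 ?mule_ge0 // lee_fin divr_ge0 // sqr_ge0.
have mp : 0 < m by rewrite lt_def mn0.
have L1 := L2_cst 1.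
pose s := dot mu D f (fun=> 1).
pose C := m * dot mu D f f - s ^+ 2.
have Ld c : L2 mu D (fun z => f z - c) := L2B mD Lf (L2_cst c).
have Cle c : C <= m * dot mu D (fun z => f z - c) (fun z => f z - c).
  have -> : dot mu D (fun z => f z - c) (fun z => f z - c)
      = dot mu D f f - 2 * c * s + c ^+ 2 * m.
    have -> : (fun z => f z - c) = (f + (- c) *: (fun=> 1 : R)) :> (T -> R).
      by apply/funext => z; rewrite -[RHS]/(f z + - c * 1) mulr1.
    by rewrite (form_comb L2_subspace dot_psd) // dot_cst1 /s -/m; ring.
  by rewrite /C; have := sqr_ge0 (s - c * m); nra.
have C0 : 0 <= C.
  have := dot_cauchy_schwarz Lf L1; rewrite dot_cst1 -/m /C -/s; lra.
(* [C / m] is the least integral of (f - c)^2 over constants c. Choosing c = f z' and integrating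
   the oscillation bound in [z] leaves a bound for each [z'], which is then integrated over [z']. *)
have step z' : D z' -> ((C / m)%:E <= 2%:E * \int[mu]_(z in D) e z + (2 * m)%:E * k z')%E.
  move=> Dz'.
  have : (sqnorm mu D (fun z => f z - f z')%R
      <= \int[mu]_(z in D) (2%:E * e z + 2%:E * k z'))%E.
    apply: ge0_le_integral => //.
    - by move=> z _; rewrite lee_fin sqr_ge0.
    - by apply: measurable_sqr; case: (Ld (f z')).
    - by apply: emeasurable_funD => //; exact: measurable_funeM.
    - by move=> z Dz; exact: ek.
  rewrite ge0_integralD //; first last.
  - by move=> z _; rewrite mule_ge0 ?k0.
  - exact: measurable_funeM.
  - by move=> z Dz; rewrite mule_ge0 ?e0.
  rewrite ge0_integralZl_EFin // integral_cst // mE sqnormE // -muleA [(_ * m%:E)%E]muleC muleA -EFinM.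
  apply: le_trans; rewrite lee_fin ler_pdivrMr // mulrC; exact: Cle.
have : (\int[mu]_(z in D) (C / m)%:E <=
    \int[mu]_(z' in D) (2%:E * \int[mu]_(z in D) e z + (2 * m)%:E * k z'))%E.
  apply: ge0_le_integral => //.
  - by move=> z _; rewrite lee_fin divr_ge0.
  - by apply: emeasurable_funD => //; exact: measurable_funeM.
rewrite integral_cst // mE ge0_integralD //; first last.
- exact: measurable_funeM.
- by move=> z Dz; rewrite mule_ge0 ?k0 // lee_fin mulr_ge0.
- by move=> z Dz; rewrite mule_ge0.
rewrite integral_cst // ge0_integralZl_EFin ?mulr_ge0 // mE.
move: ie0 ik0; move: (\int[mu]_(z in D) e z)%E (\int[mu]_(z in D) k z)%E => E K E0 K0.
rewrite [leRHS](_ : _ = (m%:E * (2%:E * E + 2%:E * K))%E); last first.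
  rewrite ge0_muleDr ?mule_ge0 // [(2%:E * E * _)%E]muleC; congr (_ + _)%E.
  by rewrite muleA -EFinM [m * 2]mulrC.
rewrite [leLHS]muleC.
rewrite lee_pmul2l // => h.
rewrite sqnormE // -addeA (_ : dot mu D f f = s ^+ 2 / m + C / m); last by rewrite /C; field.
by rewrite EFinD leeD2l.
Qed.

End L2Form.

(** * Plane integrals, shears and Tonelli's theorem *)

Section Plane.
Variable R : realType.
Local Notation leb := (@lebesgue_measure R).
Local Notation plane := (measurableTypeR R * measurableTypeR R)%type.

Definition shear (h : R -> R) (z : plane) : plane := (z.1, h z.1 + z.2).

Lemma measurable_shear (h : R -> R) : measurable_fun setT h ->
  measurable_fun setT (shear h).
Proof.
move=> mh; apply/measurable_fun_pairP; split => /=.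
  exact: measurable_fst.
rewrite (_ : _ \o _ = (h \o fst) \+ snd) //.
by apply: measurable_funD; [exact: measurableT_comp|exact: measurable_snd].
Qed.

Lemma lebesgue_translate (c : R) (A : set R) : measurable A ->
  leb ((fun y => c + y) @^-1` A) = leb A.
Proof.
move=> mA.
have mc : measurable_fun setT ((fun y => c + y) : measurableTypeR R -> measurableTypeR R).
  by apply: measurable_funD => //; exact: measurable_cst.
apply/esym; rewrite -[RHS]/(pushforward leb ((fun y => c + y) : measurableTypeR R -> measurableTypeR R) A).
apply: lebesgue_measure_unique => //= _ [[a b]] _ <-.
rewrite /pushforward (_ : _ @^-1` _ = `]a - c, b - c]%classic).
  rewrite !lebesgue_measure_itv /= !lte_fin ltrD2r; case: ifPn => // _.
  by rewrite -!EFinB; congr EFin; ring.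
by apply/seteqP; split => y /=; rewrite !in_itv /=; lra.
Qed.

(** A product measure is determined by rectangles, and the shear translates each vertical section of
    a rectangle. *)
Lemma shear_measure_preserving (h : R -> R) (A : set plane) :
  measurable_fun setT h -> measurable A ->
  plane_measure R (shear h @^-1` A) = plane_measure R A.
Proof.
move=> mh mA.
have ms := measurable_shear mh.
apply/esym; rewrite -[RHS]/(pushforward (plane_measure R) (shear h) A).
apply: product_measure_unique => // X Y mX mY.
rewrite -[LHS]/(\int[leb]_x (leb (xsection (shear h @^-1` (X `*` Y)) x)))%E.
rewrite (eq_integral (fun x => (leb Y * (\1_X x)%:E)%E)).
  rewrite ge0_integralZl //; last by apply/measurable_EFinP; exact: measurable_indic.
  rewrite (_ : (\int[leb]_x (\1_X x)%:E)%E = leb X) 1?muleC //.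
  by have := @integral_indic _ _ _ leb setT measurableT X mX; rewrite setIT.
move=> x _ /=; rewrite indicE.
case: (boolP (x \in X)) => xX.
  rewrite mule1 -(lebesgue_translate (h x) mY); congr (leb _).
  apply/seteqP; split => y; rewrite /xsection /= inE /shear /=.
    by case.
  by move=> Yy; split => //; rewrite inE in xX.
rewrite mule0 (_ : xsection _ _ = set0) ?measure0 //.
apply/seteqP; split => y //; rewrite /xsection /= inE /shear /= => -[xX' _].
by move: xX; rewrite notin_setE.
Qed.

Lemma ge0_integral_shear (h : R -> R) (A : set plane) (f : plane -> \bar R) :
  measurable_fun setT h -> measurable A -> measurable_fun A f ->
  (forall z, A z -> (0 <= f z)%E) ->
  (\int[plane_measure R]_(z in A) f z =
   \int[plane_measure R]_(z in shear h @^-1` A) f (shear h z))%E.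
Proof.
move=> mh mA mf f0.
have ms := measurable_shear mh.
have f0' : {in A, forall z, (0 <= f z)%E} by move=> z; rewrite inE; exact: f0.
have <- := ge0_integral_pushforward ms (plane_measure R) mA mf f0'.
apply: eq_measure_integral => B mB BA.
exact/esym/(shear_measure_preserving mh mB).
Qed.

(** The plane carries the product sigma-algebra, so an open set is written as a countable union of
    boxes with rational centres and radii 1/(n+1). *)
Lemma plane_open_measurable (A : set (R * R)) : open A -> measurable (A : set plane).
Proof.
move=> oA.
pose box (i : rat * rat * nat) : set plane :=
  ball (ratr i.1.1 : R) i.2.+1%:R^-1 `*` ball (ratr i.1.2 : R) i.2.+1%:R^-1.
have -> : A = \bigcup_(i in [set: rat * rat * nat])
    (if pselect (box i `<=` A) then box i else set0).
  apply/seteqP; split; last first.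
    by move=> z [i _]; case: pselect => // h /h.
  move=> z Az.
  have /nbhs_ballP[e /= e0 he] : nbhs z A by exact: open_nbhs_nbhs.
  have e20 : 0 < e / 2 by rewrite divr_gt0.
  have [n _ /(_ n (leqnn n)) /= hn] := cvgr0_norm_lt _ (@cvg_harmonic R) _ e20.
  rewrite ger0_norm ?invr_ge0 // in hn.
  have n0 : 0 < n.+1%:R^-1 :> R by rewrite invr_gt0.
  have near_rat (r x : R) : 0 < r -> exists q : rat, ball (ratr q : R) r x.
    move=> r0; have /rat_in_itvoo[q] : x - r < x + r by lra.
    rewrite in_itv /= => /andP[h1 h2]; exists q.
    by rewrite /ball /= ltr_norml; apply/andP; split; lra.
  have [q1 h1] := near_rat _ z.1 n0; have [q2 h2] := near_rat _ z.2 n0.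
  exists (q1, q2, n) => //; case: pselect => [sub|[]]; first by split.
  move=> y [/= y1 y2]; apply: he.
  have tri (q a b : R) : ball q n.+1%:R^-1 a -> ball q n.+1%:R^-1 b -> ball a e b.
    move=> qa qb; apply: (@le_ball _ _ _ (n.+1%:R^-1 + n.+1%:R^-1)).
      by move: (n.+1%:R^-1) hn => r hr; lra.
    by apply: ball_triangle qb; exact: ball_sym.
  by split; [exact: tri h1 y1|exact: tri h2 y2].
apply: countable_bigcupT_measurable => // i; case: pselect => // sub.
  by apply: measurableX; apply: open_measurable; apply: ball_open; rewrite invr_gt0.
exact: measurable0.
Qed.

Lemma plane_continuous_measurable (f : R * R -> R) : continuous f ->
  measurable_fun setT (f : plane -> R).
Proof.
move=> /continuousP cf; apply: (measurability _ (RGenOpens.measurableE R)).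
move=> _ [_ [a [b ->] <-]]; rewrite setTI; apply: plane_open_measurable.
exact/cf/interval_open.
Qed.

Section Tonelli.
Variables (I J : set R) (F : plane -> \bar R).
Hypotheses (mI : measurable I) (mJ : measurable J).
Hypotheses (mF : measurable_fun setT F) (F0 : forall z, (0 <= F z)%E).

Let F' := F \_ (I `*` J).
Let mF' : measurable_fun setT F'.
Proof.
apply/(measurable_restrictT F (measurableX mI mJ)).
exact: measurable_funTS.
Qed.
Let F'0 z : (0 <= F' z)%E.
Proof. by rewrite /F' patchE; case: ifP. Qed.

Lemma tonelli_setX1 :
  (\int[plane_measure R]_(z in I `*` J) F z = \int[leb]_(x in I) \int[leb]_(y in J) F (x, y))%E.
Proof.
rewrite [LHS]integral_mkcond.
transitivity (\int[leb]_x fubini_F leb F' x)%E; first exact: fubini_tonelli1.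
rewrite [RHS]integral_mkcond; apply: eq_integral => x _.
rewrite /fubini_F patchE; case: ifPn => xI.
  rewrite [RHS]integral_mkcond; apply: eq_integral => y _.
  by rewrite /F' !patchE in_setX xI.
by rewrite integral0_eq // => y _; rewrite /F' patchE in_setX (negbTE xI).
Qed.

Lemma tonelli_setX2 :
  (\int[plane_measure R]_(z in I `*` J) F z = \int[leb]_(y in J) \int[leb]_(x in I) F (x, y))%E.
Proof.
rewrite [LHS]integral_mkcond.
transitivity (\int[leb]_y fubini_G leb F' y)%E; first exact: fubini_tonelli2.
rewrite [RHS]integral_mkcond; apply: eq_integral => y _.
rewrite /fubini_G patchE; case: ifPn => yJ.
  rewrite [RHS]integral_mkcond; apply: eq_integral => x _.
  by rewrite /F' !patchE in_setX yJ andbT.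
by rewrite integral0_eq // => x _; rewrite /F' patchE in_setX (negbTE yJ) andbF.
Qed.

End Tonelli.

Lemma measurable_slice1 (J : set R) (F : plane -> \bar R) : measurable J ->
  measurable_fun setT F -> (forall z, 0 <= F z)%E ->
  measurable_fun setT (fun x => \int[leb]_(y in J) F (x, y))%E.
Proof.
move=> mJ mF F0.
pose F' := F \_ (setT `*` J).
have -> : (fun x => \int[leb]_(y in J) F (x, y))%E = fubini_F leb F'.
  apply/funext => x; rewrite [LHS]integral_mkcond; apply: eq_integral => y _.
  by rewrite /F' !patchE in_setX in_setT.
apply: measurable_fun_fubini_tonelli_F => [|z]; last by rewrite /F' patchE; case: ifP.
apply/(measurable_restrictT F (measurableX measurableT mJ)).
exact: measurable_funTS.
Qed.

Lemma measurable_slice2 (I : set R) (F : plane -> \bar R) : measurable I ->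
  measurable_fun setT F -> (forall z, 0 <= F z)%E ->
  measurable_fun setT (fun y => \int[leb]_(x in I) F (x, y))%E.
Proof.
move=> mI mF F0.
pose F' := F \_ (I `*` setT).
have -> : (fun y => \int[leb]_(x in I) F (x, y))%E = fubini_G leb F'.
  apply/funext => y; rewrite [LHS]integral_mkcond; apply: eq_integral => x _.
  by rewrite /F' !patchE in_setX in_setT andbT.
apply: measurable_fun_fubini_tonelli_G => [|z]; last by rewrite /F' patchE; case: ifP.
apply/(measurable_restrictT F (measurableX mI measurableT)).
exact: measurable_funTS.
Qed.

Lemma integral_slice1 (I J : set R) (F : plane -> \bar R) : measurable I ->
  measurable J -> measurable_fun setT F -> (forall z, 0 <= F z)%E ->
  (\int[plane_measure R]_(z in I `*` J) \int[leb]_(t in J) F (z.1, t) =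
   leb J * \int[plane_measure R]_(z in I `*` J) F z)%E.
Proof.
move=> mI mJ mF F0.
have ms := measurable_slice1 mJ mF F0.
rewrite !tonelli_setX1 //; first last.
- by move=> z; exact: integral_ge0.
- exact: measurableT_comp ms measurable_fst.
rewrite -ge0_integralZl //; first last.
- by move=> x _; exact: integral_ge0.
- exact: measurable_funTS.
by apply: eq_integral => x _ /=; rewrite integral_cst // muleC.
Qed.

Lemma integral_slice2 (I J : set R) (F : plane -> \bar R) : measurable I ->
  measurable J -> measurable_fun setT F -> (forall z, 0 <= F z)%E ->
  (\int[plane_measure R]_(z in I `*` J) \int[leb]_(t in I) F (t, z.2) =
   leb I * \int[plane_measure R]_(z in I `*` J) F z)%E.
Proof.
move=> mI mJ mF F0.
have ms := measurable_slice2 mI mF F0.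
rewrite !tonelli_setX2 //; first last.
- by move=> z; exact: integral_ge0.
- exact: measurableT_comp ms measurable_snd.
rewrite -ge0_integralZl //; first last.
- by move=> x _; exact: integral_ge0.
- exact: measurable_funTS.
by apply: eq_integral => x _ /=; rewrite integral_cst // muleC.
Qed.

(** The fundamental theorem of calculus and Cauchy-Schwarz between the two points; enlarging the
    segment to [I] makes the bound independent of them. *)
Lemma sqr_increment_le (I : set R) (f df : R -> R) (x x' : R) : is_interval I ->
  (forall t : R, is_derive t (1 : R) f (df t)) -> continuous df -> I x -> I x' ->
  (((f x - f x') ^+ 2)%:E <= leb I * \int[leb]_(t in I) ((df t) ^+ 2)%:E)%E.
Proof.
move=> itvI fdf cdf; have mI := is_interval_measurable itvI.
wlog : x x' / x' < x => [wh|lt] Ix Ix'.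
  case: (ltgtP x x') => [lt|lt|->].
  - by rewrite -sqrrN opprB; exact: wh.
  - exact: wh.
  - rewrite subrr expr0n /= mule_ge0 ?measure_ge0 // integral_ge0 // => t _.
    by rewrite lee_fin sqr_ge0.
pose D : set R := `[x', x]%classic.
have mD : measurable D by exact: measurable_itv.
have DI : D `<=` I.
  by move=> t; rewrite /D /= in_itv /=; exact: itvI.
have muDE : leb D = (x - x')%:E by rewrite /D lebesgue_measure_itv /= lte_fin lt.
have muD : (leb D < +oo)%E by rewrite muDE ltry.
have cont (h : R -> R) : continuous h -> leb.-integrable D (EFin \o h).
  move=> ch; apply: continuous_compact_integrable; first exact: segment_compact.
  exact: continuous_subspaceT.
have L2df : L2 leb D df.
  split; first by apply: measurable_funTS; exact: continuous_measurable_fun.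
  have cdf2 : continuous (fun t => df t * df t) by move=> t; apply: cvgM; exact: cdf.
  have /integrableP[_] := cont _ cdf2.
  apply: le_lt_trans; rewrite le_eqVlt; apply/orP; left; apply/eqP.
  by apply: eq_integral => t _ /=; rewrite expr2 ger0_norm // -expr2 sqr_ge0.
have ftc : dot leb D df (fun=> 1) = f x - f x'.
  have -> : dot leb D df (fun=> 1) = \int[leb]_(t in D) df t.
    by apply: eq_Rintegral => t _; rewrite mulr1.
  rewrite /Rintegral (continuous_FTC2 lt _ _ (F := f)) //.
  - exact: continuous_subspaceT.
  - have cf t : {for t, continuous f}.
      by apply/differentiable_continuous/derivable1_diffP; exact: @ex_derive (fdf t).
    split; first by move=> t _; exact: @ex_derive (fdf t).
      by apply: cvg_at_right_filter; exact: cf.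
    by apply: cvg_at_left_filter; exact: cf.
  - by move=> t _; rewrite derive1E; exact: @derive_val _ _ _ _ _ _ _ (fdf t).
have c1 : dot leb D (fun=> 1) (fun=> 1) = x - x'.
  have h : fine (leb D) = x - x' by rewrite muDE.
  by rewrite -h; exact: (@dot_cst1 _ _ _ leb D mD).
have := @dot_cauchy_schwarz _ _ _ leb D mD _ _ L2df (@L2_cst _ _ _ leb D mD muD 1).
rewrite ftc c1 => cs.
apply: (@le_trans _ _ (leb D * sqnorm leb D df)%E).
  by rewrite sqnormE // muDE -EFinM lee_fin mulrC.
apply: lee_pmul => //; first exact: sqnorm_ge0.
- by apply: le_measure; rewrite ?inE.
- apply: ge0_subset_integral => //.
  + by apply: measurable_funTS; apply: measurable_sqr; exact: continuous_measurable_fun.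
  + by move=> t _; rewrite lee_fin sqr_ge0.
Qed.

End Plane.

(** * A Poincare inequality on curved cells *)

Lemma continuous_pair (T U V : topologicalType) (f : T -> U) (g : T -> V) :
  continuous f -> continuous g -> continuous (fun z => (f z, g z)).
Proof.
move=> cf cg z.
by apply: (@cvg_pair _ _ _ (nbhs z) (nbhs (f z)) (nbhs (g z))); [exact: cf|exact: cg].
Qed.

Lemma continuous_fst (T U : topologicalType) : continuous (@fst T U).
Proof. by move=> z; exact: cvg_fst. Qed.

Lemma continuous_snd (T U : topologicalType) : continuous (@snd T U).
Proof. by move=> z; exact: cvg_snd. Qed.

Section Rellich.
Variable R : realType.
Local Notation leb := (@lebesgue_measure R).
Local Notation plane := (measurableTypeR R * measurableTypeR R)%type.
Local Notation pm := (plane_measure R).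

Definition dx (f : R * R -> R) (z : R * R) : R := 'D_((1, 0) : R * R) f z.
Definition dy (f : R * R -> R) (z : R * R) : R := 'D_((0, 1) : R * R) f z.

Lemma chain_rule_curve (f : R * R -> R) (a b : R -> R) (da db t : R) :
  differentiable f (a t, b t) ->
  is_derive t (1 : R) a da -> is_derive t (1 : R) b db ->
  is_derive t (1 : R) (fun s => f (a s, b s))
    (da * dx f (a t, b t) + db * dy f (a t, b t)).
Proof.
move=> df [Da Ea] [Db Eb].
have da' : differentiable a t by exact/derivable1_diffP.
have db' : differentiable b t by exact/derivable1_diffP.
have dp : differentiable (fun s => (a s, b s)) t by exact: differentiable_pair.
have dc : differentiable (f \o (fun s => (a s, b s))) t by exact: differentiable_comp.
split; first exact/derivable1_diffP.
rewrite -[LHS]/('D_1 (f \o (fun s => (a s, b s))) t) deriveE // diff_comp //=.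
rewrite diff_pair // -!deriveE // Ea Eb /dx /dy !deriveE //.
rewrite -!linearZ -linearD /=; congr ('d f _ _).
rewrite [RHS](_ : _ = (da * 1 + db * 0, da * 0 + db * 1)) //.
by rewrite !mulr0 !mulr1 addr0 add0r.
Qed.

Variables (h dh : R -> R).
Hypothesis hdh : forall t : R, is_derive t (1 : R) h (dh t).
Hypothesis cdh : continuous dh.

Lemma profile_continuous : continuous h.
Proof.
move=> t; apply/differentiable_continuous/derivable1_diffP.
exact: @ex_derive (hdh t).
Qed.

Let ch := profile_continuous.

Lemma continuous_sheared (f : R * R -> R) : continuous f ->
  continuous (fun z : R * R => f (z.1, h z.1 + z.2)).
Proof.
move=> cf z; apply: (@continuous_comp _ _ _ (fun z : R * R => (z.1, h z.1 + z.2)) f); last exact: cf.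
apply: continuous_pair; first exact: continuous_fst.
move=> y; apply: cvgD; last exact: continuous_snd.
by apply: (@continuous_comp _ _ _ fst h); [exact: continuous_fst|exact: ch].
Qed.

Let mh : measurable_fun setT (h : measurableTypeR R -> measurableTypeR R).
Proof. exact: continuous_measurable_fun. Qed.

(** The image of a rectangle with sides [I] and [J] under [shear h]; the waveguide and the cells
    that subdivide it are all of this kind. *)
Definition curved_cell (I J : set R) : set plane :=
  [set z | I z.1 /\ J (z.2 - h z.1)].

Lemma shear_preimage_cell I J : shear h @^-1` curved_cell I J = I `*` J.
Proof.
apply/seteqP; split => -[x y]; rewrite /curved_cell /shear /=;
  by rewrite addrAC subrr add0r.
Qed.

Lemma curved_cellE I J : curved_cell I J = shear (fun x => - h x) @^-1` (I `*` J).
Proof.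
by apply/seteqP; split => -[x y]; rewrite /curved_cell /shear /= addrC.
Qed.

Lemma curved_cell_measurable I J : measurable I -> measurable J ->
  measurable (curved_cell I J).
Proof.
move=> mI mJ; rewrite curved_cellE.
have mhN : measurable_fun setT ((fun x => - h x) : measurableTypeR R -> measurableTypeR R).
  exact: measurable_funN.
by rewrite -[X in measurable X]setTI; apply: (measurable_shear mhN) => //; exact: measurableX.
Qed.

Lemma curved_cell_measure I J : measurable I -> measurable J ->
  (pm (curved_cell I J) = leb I * leb J)%E.
Proof.
move=> mI mJ; rewrite -(shear_measure_preserving mh) ?shear_preimage_cell.
  exact: product_measure1E.
exact: curved_cell_measurable.
Qed.

Lemma integral_curved_cell I J (F : plane -> \bar R) : measurable I -> measurable J ->
  measurable_fun setT F -> (forall z, 0 <= F z)%E ->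
  (\int[pm]_(z in curved_cell I J) F z = \int[pm]_(z in I `*` J) F (shear h z))%E.
Proof.
move=> mI mJ mF F0; rewrite -(shear_preimage_cell I J).
apply: ge0_integral_shear => //; first exact: curved_cell_measurable.
exact: measurable_funTS.
Qed.

Variable f : R * R -> R.
Hypothesis C1f : C1_real f.

(* The derivative of [f (x, h x + y)] in [x] at constant [y]. *)
Definition dx_sheared (z : R * R) : R := dx f z + dh z.1 * dy f z.

Lemma continuous_dx_sheared : continuous dx_sheared.
Proof.
case: C1f => _ c1 c2 z; apply: cvgD; first exact: c1.
apply: cvgM; last exact: c2.
by apply: (@continuous_comp _ _ _ fst dh); [exact: continuous_fst|exact: cdh].
Qed.

(** A curved cell need not be convex, so two points are joined inside it by a vertical segment and
    an arc at constant height above the graph of [h]. The increment along each leg is bounded by an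
    integral over a full slice, depending on one sheared coordinate of one endpoint only. *)
Lemma curved_cell_poincare (I J : set R) : is_interval I -> is_interval J ->
  (leb I < +oo)%E -> (leb J < +oo)%E ->
  let Q := curved_cell I J in L2 pm Q f ->
  (sqnorm pm Q f <= (dot pm Q f (fun=> 1%R) ^+ 2 / fine (pm Q))%:E
    + 2%:E * (leb J * (leb J * sqnorm pm Q (dy f)))
    + 2%:E * (leb I * (leb I * sqnorm pm Q dx_sheared)))%E.
Proof.
move=> iI iJ fI fJ Q Lf.
have mI := is_interval_measurable iI.
have mJ := is_interval_measurable iJ.
have mQ : measurable Q by exact: curved_cell_measurable.
have fQ : (pm Q < +oo)%E.
  by rewrite curved_cell_measure // lte_mul_pinfty // ge0_fin_numE.
have [df cdx cdy] := C1f.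
pose F1 (z : plane) := ((dx_sheared (z.1, h z.1 + z.2)) ^+ 2)%:E.
pose F2 (z : plane) := ((dy f (z.1, h z.1 + z.2)) ^+ 2)%:E.
have F10 z : (0 <= F1 z)%E by rewrite lee_fin sqr_ge0.
have F20 z : (0 <= F2 z)%E by rewrite lee_fin sqr_ge0.
have mF1 : measurable_fun setT F1.
  apply/measurable_EFinP; apply: measurable_funX.
  apply: plane_continuous_measurable; apply: continuous_sheared.
  exact: continuous_dx_sheared.
have mF2 : measurable_fun setT F2.
  apply/measurable_EFinP; apply: measurable_funX.
  by apply: plane_continuous_measurable; exact: continuous_sheared.
pose e (z : plane) := (leb J * \int[leb]_(t in J) F2 (z.1, t))%E.
pose k (z : plane) := (leb I * \int[leb]_(t in I) F1 (t, (shear (fun x => (- h x)%R) z).2))%E.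
have e0 z : (0 <= e z)%E by rewrite mule_ge0 // integral_ge0.
have k0 z : (0 <= k z)%E by rewrite mule_ge0 // integral_ge0.
have mhN : measurable_fun setT ((fun x => - h x) : measurableTypeR R -> measurableTypeR R).
  exact: measurable_funN.
have me : measurable_fun setT e.
  apply: measurable_funeM.
  exact: measurableT_comp (measurable_slice1 mJ mF2 F20) measurable_fst.
have mk : measurable_fun setT k.
  apply: measurable_funeM.
  apply: measurableT_comp (measurable_slice2 mI mF1 F10) _.
  exact: measurableT_comp measurable_snd (measurable_shear mhN).
have osc z z' : Q z -> Q z' ->
    (((f z - f z') ^+ 2)%:E <= 2%:E * e z + 2%:E * k z')%E.
  case: z z' => [x y] [x' y'] [/= Ix Jy] [/= Ix' Jy'].
  rewrite [y' - h x']addrC in Jy'.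
  (* The value at the corner of the path: abscissa of the first point, height above the graph of the
     second. *)
  pose u := f (x, h x + (- h x' + y')).
  have h1 : (((f (x, y) - u) ^+ 2)%:E <= e (x, y))%E.
    have := @sqr_increment_le _ J (fun t => f (x, h x + t)) (fun t => dy f (x, h x + t)) (y - h x) (- h x' + y') iJ.
    rewrite [h x + (y - h x)]addrC subrK; apply => //.
      move=> t; have d2 : is_derive t (1 : R) (fun s => h x + s) 1.
        have := @is_deriveD _ _ _ (cst (h x)) id t 1 0 1 (is_derive_cst _ _ _) (is_derive_id _ _).
        by rewrite add0r.
      have := chain_rule_curve (df (x, h x + t)) (is_derive_cst x t (1 : R)) d2.
      by rewrite mul0r add0r mul1r.
    move=> t; apply: (@continuous_comp _ _ _ (fun t => (x, h x + t)) (dy f)); last exact: cdy.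
    by apply: continuous_pair => y0; [exact: cvg_cst|apply: cvgD; [exact: cvg_cst|exact: cvg_id]].
  have h2 : (((u - f (x', y')) ^+ 2)%:E <= k (x', y'))%E.
    have := @sqr_increment_le _ I (fun s => f (s, h s + (- h x' + y'))) (fun s => dx_sheared (s, h s + (- h x' + y'))) x x' iI.
    rewrite addNKr; apply => //.
      move=> t; have d2 : is_derive t (1 : R) (fun s => h s + (- h x' + y')) (dh t).
        have := @is_deriveD _ _ _ h (cst (- h x' + y')) t 1 _ 0 (hdh t) (is_derive_cst _ _ _).
        by rewrite addr0.
      have := @chain_rule_curve f id (fun s => h s + (- h x' + y')) 1 (dh t) t
        (df (t, h t + (- h x' + y'))) (is_derive_id t (1 : R)) d2.
      by rewrite mul1r.
    move=> t; apply: (@continuous_comp _ _ _ (fun t => (t, h t + (- h x' + y'))) dx_sheared); last exact: continuous_dx_sheared.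
    by apply: continuous_pair => y0; [exact: cvg_id|apply: cvgD; [exact: ch|exact: cvg_cst]].
  apply: (@le_trans _ _ (2%:E * ((f (x, y) - u) ^+ 2)%:E + 2%:E * ((u - f (x', y')) ^+ 2)%:E)%E).
    by rewrite -!EFinM -EFinD lee_fin; have := sqr_ge0 (f (x, y) - u - (u - f (x', y'))); nra.
  by apply: leeD; rewrite lee_pmul2l.
have := sqnorm_le_oscillation mQ fQ Lf (measurable_funTS me) (measurable_funTS mk)
  (fun z _ => e0 z) (fun z _ => k0 z) osc.
rewrite (integral_curved_cell mI mJ me e0) (integral_curved_cell mI mJ mk k0).
have mIJ : measurable (I `*` J : set plane) by exact: measurableX.
(* One factor [leb J] stems from Cauchy-Schwarz on the slice, the other from integrating a function
   of [z.1] alone over the rectangle. *)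
have Ey : (\int[pm]_(z in I `*` J) e (shear h z) = leb J * (leb J * sqnorm pm Q (dy f)))%E.
  transitivity (leb J * \int[pm]_(z in I `*` J) \int[leb]_(t in J) F2 (z.1, t))%E.
    apply: ge0_integralZl => //; last by move=> z _; exact: integral_ge0.
    apply: measurable_funTS.
    exact: measurableT_comp (measurable_slice1 mJ mF2 F20) measurable_fst.
  transitivity (leb J * (leb J * \int[pm]_(z in I `*` J) F2 z))%E.
    exact: (congr1 (fun r => leb J * r)%E (integral_slice1 mI mJ mF2 F20)).
  suff Eq : (\int[pm]_(z in I `*` J) F2 z = sqnorm pm Q (dy f))%E.
    exact: (congr1 (fun r => leb J * (leb J * r))%E Eq).
  apply/esym; apply: integral_curved_cell => //; last by move=> z; rewrite lee_fin sqr_ge0.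
  by apply: measurable_sqr; exact: plane_continuous_measurable.
have Ex : (\int[pm]_(z in I `*` J) k (shear h z) = leb I * (leb I * sqnorm pm Q dx_sheared))%E.
  transitivity (leb I * \int[pm]_(z in I `*` J) \int[leb]_(t in I) F1 (t, z.2))%E.
    transitivity (\int[pm]_(z in I `*` J) (leb I * \int[leb]_(t in I) F1 (t, z.2)))%E.
      by apply: eq_integral => -[x y] _; rewrite /k /shear /= addKr.
    apply: ge0_integralZl => //; last by move=> z _; exact: integral_ge0.
    apply: measurable_funTS.
    exact: measurableT_comp (measurable_slice2 mI mF1 F10) measurable_snd.
  transitivity (leb I * (leb I * \int[pm]_(z in I `*` J) F1 z))%E.
    exact: (congr1 (fun r => leb I * r)%E (integral_slice2 mI mJ mF1 F10)).
  suff Eq : (\int[pm]_(z in I `*` J) F1 z = sqnorm pm Q dx_sheared)%E.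
    exact: (congr1 (fun r => leb I * (leb I * r))%E Eq).
  apply/esym; apply: integral_curved_cell => //; last by move=> z; rewrite lee_fin sqr_ge0.
  apply: measurable_sqr; apply: plane_continuous_measurable.
  exact: continuous_dx_sheared.
by rewrite Ex Ey.
Qed.

End Rellich.

(** * Form closures *)

Section Closure.
Variables (R : realType) (E : lmodType R) (W G : set E) (a b : E -> E -> R).
Hypotheses (WS : subspace W) (GS : subspace G) (GW : G `<=` W).
Hypotheses (pa : psd_form W a) (pb : psd_form W b).

Definition form_sum (u v : E) : R := a u v + b u v.
Local Notation q := form_sum.

Lemma form_sum_psd : psd_form W q.
Proof.
case: pa => aC aD aZ a0; case: pb => bC bD bZ b0; split; rewrite /q.
- by move=> u v Wu Wv; rewrite aC // bC.
- by move=> u v w Wu Wv Ww; rewrite aD // bD //; ring.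
- by move=> c u v Wu Wv; rewrite aZ // bZ //; ring.
- by move=> u Wu; rewrite addr_ge0 ?a0 ?b0.
Qed.
Let pq := form_sum_psd.

Definition form_closure : set E :=
  [set u | W u /\ forall e : R, 0 < e -> exists2 g, G g & q (g - u) (g - u) < e].
Local Notation V := form_closure.

Lemma form_closureW : V `<=` W. Proof. by move=> u []. Qed.

Lemma psd_formW c : psd_form W c -> psd_form V c.
Proof.
case=> cC cD cZ c0; split.
- by move=> u v /form_closureW Wu /form_closureW Wv; exact: cC.
- by move=> u v w /form_closureW Wu /form_closureW Wv /form_closureW Ww; exact: cD.
- by move=> r u v /form_closureW Wu /form_closureW Wv; exact: cZ.
- by move=> u /form_closureW Wu; exact: c0.
Qed.

Lemma form_closure_subspace : subspace V.
Proof.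
have [W0 WD WZ] := WS; have [G0 GD GZ] := GS.
split.
- split=> // e e0; exists 0 => //; rewrite subr0.
  by rewrite -(scale0r (0 : E)) (formZ WS pq) // expr0n mul0r.
- move=> u v [Wu hu] [Wv hv]; split; first exact: WD.
  move=> e e0; have e4 : 0 < e / 4 by rewrite divr_gt0.
  have [g Gg hg] := hu _ e4; have [k Gk hk] := hv _ e4.
  exists (g + k); first exact: GD.
  have -> : g + k - (u + v) = (g - u) + (k - v) by rewrite opprD addrACA.
  apply: (le_lt_trans (formD_le2 WS pq _ _)).
  + by apply: subspaceB => //; exact: GW.
  + by apply: subspaceB => //; exact: GW.
  + lra.
- move=> c u [Wu hu]; split; first exact: WZ.
  move=> e e0; have ec : 0 < e / (c ^+ 2 + 1).
    by rewrite divr_gt0 // ltr_wpDl // sqr_ge0.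
  have [g Gg hg] := hu _ ec; exists (c *: g); first exact: GZ.
  rewrite -scalerBr (formZ WS pq); last by apply: subspaceB => //; exact: GW.
  move: hg; rewrite ltr_pdivlMr; last by rewrite ltr_wpDl // sqr_ge0.
  apply: le_lt_trans; rewrite mulrC ler_wpM2l //; last by rewrite lerDl.
  by apply: (form_ge0 pq); apply: subspaceB => //; exact: GW.
Qed.

Lemma form_closure_complete : rapidly_complete W q -> rapidly_complete V q.
Proof.
move=> cW w Vw rw.
have Ww n := form_closureW (Vw n).
have [u Wu [C uw]] := cW _ Ww rw.
exists u; last by exists C.
split=> // e e0.
have [n hn] : exists n : nat, C * 8^-1 ^+ n < e / 4.
  have : (fun n : nat => C * 8^-1 ^+ n) @ \oo --> C * 0.
    apply: cvgMr; apply: cvg_expr.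
    by rewrite ger0_norm ?invr_ge0// invf_lt1 // ltr1n.
  rewrite mulr0 => h; have e4 : 0 < e / 4 by rewrite divr_gt0.
  by have [n _ /(_ n (leqnn n))/= hn] := cvgr_lt _ h _ e4; exists n.
have e4 : 0 < e / 4 by rewrite divr_gt0.
have [_ /(_ _ e4)[g Gg hg]] := Vw n.
exists g => //.
have -> : g - u = (g - w n) - (u - w n) by rewrite opprB addrA subrK.
apply: (le_lt_trans (formB_le2 WS pq _ _)).
- by apply: subspaceB => //; exact: GW.
- exact: subspaceB.
- by have := uw n; lra.
Qed.

(** An element [u] of the closure is replaced by a close [g] in [G] and back. Each passage doubles
    squares, which explains e/4 and the functionals [2 * F i]. *)
Lemma form_closure_compact :
  (forall e : R, 0 < e -> exists (I : finType) (F : I -> E -> R),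
    [/\ forall i, linear_on W (F i),
        forall i u, W u -> F i u ^+ 2 <= b u u
      & forall u, G u -> b u u <= e * a u u + \sum_i F i u ^+ 2]) ->
  relatively_compact V a b.
Proof.
move=> comp e e0; have e4 : 0 < e / 4 by rewrite divr_gt0.
have [I [F [FL FC Fb]]] := comp _ e4.
exists I, (fun i u => 2 * F i u), 4; split.
- move=> i; have [FD FZ] := FL i; split.
    by move=> u v /form_closureW Wu /form_closureW Wv; rewrite FD // mulrDr.
  by move=> c u /form_closureW Wu; rewrite FZ // mulrCA.
- move=> i u /form_closureW Wu; have := FC i u Wu; rewrite exprMn; lra.
- move=> u [Wu hu].
  (* [K] times the squared distance [s] of [g] to [u] collects the errors: 2s from [b], e s from [a]
     and 4s from each functional. *)
  pose K := 2 + e + 4 * #|I|%:R.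
  have K0 : 0 < K by rewrite /K; have : 0 <= #|I|%:R :> R by []; lra.
  suff H r : 0 < r -> b u u <= e * a u u + \sum_i (2 * F i u) ^+ 2 + r.
    by apply/ler_addgt0Pr => r r0; exact: H.
  move=> r0; have rK : 0 < r / K by rewrite divr_gt0.
  have [g Gg] := hu _ rK; set s := q (g - u) (g - u) => hs.
  have Wg := GW Gg; have Wgu := subspaceB WS Wg Wu.
  have a1 : a (g - u) (g - u) <= s by rewrite /s /q lerDl (form_ge0 pb).
  have b1 : b (g - u) (g - u) <= s by rewrite /s /q lerDr (form_ge0 pa).
  have h1 := form_le2 WS pb Wu Wg.
  have b2 : b (u - g) (u - g) = b (g - u) (g - u).
    by rewrite !(formB WS pb) //; case: pb => bC _ _ _; rewrite (bC u g) //; ring.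
  have h2 := Fb _ Gg.
  have h3 := form_le2 WS pa Wg Wu.
  have h4 : \sum_i F i g ^+ 2 <= \sum_i (2 * F i u ^+ 2 + 2 * s).
    apply: ler_sum => i _.
    have := FC i _ Wgu; rewrite (linear_onB WS) //.
    have := sqr_ge0 (F i g - 2 * F i u); nra.
  rewrite big_split /= -mulr_sumr sumr_const -[_ *+ #|_|]mulr_natr -/(#|I|) in h4.
  have h5 : \sum_i (2 * F i u) ^+ 2 = 4 * \sum_i F i u ^+ 2.
    by rewrite mulr_sumr; apply: eq_bigr => i _; rewrite exprMn; ring.
  have h6 : s * K <= r by rewrite -ler_pdivlMr // ltW.
  have h7 : e / 4 * a g g <= e / 4 * (2 * a u u + 2 * s).
    by apply: ler_wpM2l; [exact: ltW|lra].
  rewrite h5; move: h1 h2 h7 h4 h6; rewrite b2 /K.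
  move: (\sum_i F i u ^+ 2) (\sum_i F i g ^+ 2) (#|I|%:R) => X Y Z.
  move: b1 a1; move: (a _ _) (a g g) (a u u) (b _ _) (b g g) (b u u) => a1 a2 a3 b1 b3 b4.
  by nra.
Qed.

End Closure.

(** * The Sobolev space of the form domain *)

Section Sobolev.
Variable R : realType.
Local Notation plane := (measurableTypeR R * measurableTypeR R)%type.
Local Notation pm := (plane_measure R).
Local Notation E := ((R * R -> R) * (R * R -> R) * (R * R -> R))%type.

Variables (D Gam : set plane).
Hypothesis mD : measurable D.
Local Notation L2 := (L2 pm D).
Local Notation dot := (dot pm D).
Local Notation sqnorm := (sqnorm pm D).

(* Elements of [E] are triples [(u, p, q)] where [(p, q)] stands for the gradient of [u]. *)
Definition L2_triple : set E := [set U | [/\ L2 U.1.1, L2 U.1.2 & L2 U.2]].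
Definition mass_form (U V : E) : R := dot U.1.1 V.1.1.
Definition grad_form (U V : E) : R := dot U.1.2 V.1.2 + dot U.2 V.2.

Lemma L2_triple_subspace : subspace L2_triple.
Proof.
split; first by split; exact: L2_0.
- move=> U V [u1 u2 u3] [v1 v2 v3].
  by split; [exact: (L2D mD u1 v1)|exact: (L2D mD u2 v2)|exact: (L2D mD u3 v3)].
- move=> c U [u1 u2 u3].
  by split; [exact: (L2Z mD c u1)|exact: (L2Z mD c u2)|exact: (L2Z mD c u3)].
Qed.

Lemma mass_psd : psd_form L2_triple mass_form.
Proof.
split.
- by move=> U V _ _; exact: dotC.
- by move=> U V X [u _ _] [v _ _] [x _ _]; exact: (dotDl mD u v x).
- by move=> c U V [u _ _] [v _ _]; exact: (dotZl mD c u v).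
- by move=> U _; exact: dot_ge0.
Qed.

Lemma grad_psd : psd_form L2_triple grad_form.
Proof.
split; rewrite /grad_form.
- by move=> U V _ _; rewrite dotC [X in _ + X]dotC.
- move=> U V X [_ u u'] [_ v v'] [_ x x'].
  by rewrite addrACA; congr (_ + _); [exact: (dotDl mD u v x)|exact: (dotDl mD u' v' x')].
- move=> c U V [_ u u'] [_ v v'].
  by rewrite mulrDr; congr (_ + _); [exact: (dotZl mD c u v)|exact: (dotZl mD c u' v')].
- by move=> U _; rewrite addr_ge0 ?dot_ge0.
Qed.

Lemma L2_triple_complete : rapidly_complete L2_triple (form_sum grad_form mass_form).
Proof.
move=> w Ww rw.
have comp (i : E -> R * R -> R) : (forall U V, i (U - V) = i U - i V) ->
    (forall n, L2 (i (w n))) ->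
    (forall U, dot (i U) (i U) <= form_sum grad_form mass_form U U) ->
    exists2 u, L2 u & forall n, dot (fun x => u x - i (w n) x) (fun x => u x - i (w n) x) <= 8^-1 ^+ n.
  move=> iB Li le; apply: L2_rapidly_complete => // m n mn.
  by apply: le_trans (rw m n mn); apply: le_trans (le _); rewrite iB.
have [| | |u Lu hu] := comp (fun U => U.1.1) => //.
- by move=> n; case: (Ww n).
- by move=> U; rewrite /form_sum /grad_form lerDr addr_ge0 ?dot_ge0.
have [| | |p Lp hp] := comp (fun U => U.1.2) => //.
- by move=> n; case: (Ww n).
- by move=> U; rewrite /form_sum /grad_form -addrA lerDl addr_ge0 ?dot_ge0.
have [| | |r Lr hr] := comp (fun U => U.2) => //.
- by move=> n; case: (Ww n).
- by move=> U; rewrite /form_sum /grad_form addrAC lerDr addr_ge0 ?dot_ge0.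
exists (u, p, r); first by split.
exists 3 => n; have := hu n; have := hp n; have := hr n.
rewrite /form_sum /grad_form /mass_form /=.
rewrite -[dot (fun x => u x - _) _]/(dot (u - (w n).1.1) (u - (w n).1.1)).
rewrite -[dot (fun x => p x - _) _]/(dot (p - (w n).1.2) (p - (w n).1.2)).
rewrite -[dot (fun x => r x - _) _]/(dot (r - (w n).2) (r - (w n).2)).
by lra.
Qed.

Definition gradient (f : R * R -> R) : E := (f, dx f, dy f).

Lemma continuous_add (T : topologicalType) (f g : T -> R) :
  continuous f -> continuous g -> continuous (fun x => f x + g x).
Proof. by move=> cf cg x; exact: (cvgD (cf x) (cg x)). Qed.

Lemma continuous_mul (T : topologicalType) (f g : T -> R) :
  continuous f -> continuous g -> continuous (fun x => f x * g x).
Proof. by move=> cf cg x; exact: (cvgM (cf x) (cg x)). Qed.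

Lemma C1_realD f g : C1_real f -> C1_real g ->
  C1_real (fun x => f x + g x) /\ gradient (fun x => f x + g x) = gradient f + gradient g.
Proof.
move=> [df fx fy] [dg gx gy].
have D1 v : (fun x => 'D_v (fun x => f x + g x) x) = (fun x => 'D_v f x + 'D_v g x).
  by apply/funext => x; rewrite -[RHS]deriveD //; exact: diff_derivable.
split; last by congr (_, _, _); exact: D1.
split.
- by move=> x; exact: (differentiableD (df x) (dg x)).
- by rewrite D1; exact: (continuous_add fx gx).
- by rewrite D1; exact: (continuous_add fy gy).
Qed.

Lemma C1_realM f g : C1_real f -> C1_real g ->
  C1_real (fun x => f x * g x) /\
  gradient (fun x => f x * g x) = (fun x => f x * g x,
    fun x => f x * dx g x + g x * dx f x, fun x => f x * dy g x + g x * dy f x).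
Proof.
move=> [df fx fy] [dg gx gy].
have cf : continuous f by move=> x; exact/differentiable_continuous.
have cg : continuous g by move=> x; exact/differentiable_continuous.
have D1 v : (fun x => 'D_v (fun x => f x * g x) x) = (fun x => f x * 'D_v g x + g x * 'D_v f x).
  by apply/funext => x; rewrite -[RHS]deriveM //; exact: diff_derivable.
split; last by congr (_, _, _); exact: D1.
split.
- by move=> x; exact: (differentiableM (df x) (dg x)).
- by rewrite D1; exact: (continuous_add (continuous_mul cf gx) (continuous_mul cg fx)).
- by rewrite D1; exact: (continuous_add (continuous_mul cf gy) (continuous_mul cg fy)).
Qed.

Lemma C1_real_cst c : C1_real (fun=> c) /\ gradient (fun=> c) = (fun=> c, fun=> 0, fun=> 0).
Proof.
have D0 (v : R * R) : (fun x : R * R => 'D_v (fun=> c) x) = (fun=> 0).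
  by apply/funext => x; rewrite derive_cst.
split; last by congr (_, _, _); exact: D0.
split; first by move=> x; exact: differentiable_cst.
- by rewrite D0; exact: cst_continuous.
- by rewrite D0; exact: cst_continuous.
Qed.

Definition test_gradients : set E := [set U | L2_triple U /\ exists f,
  [/\ C1_real f, forall x, Gam x -> f x = 0 & U = gradient f]].

Lemma test_gradients_subspace : subspace test_gradients.
Proof.
have [W0 WD WZ] := L2_triple_subspace.
split.
- split => //; exists (fun=> 0); have [h1 h2] := C1_real_cst 0.
  by split.
- move=> U V [WU [f [cf zf Uf]]] [WV [g [cg zg Vg]]]; split; first exact: WD.
  have [h1 h2] := C1_realD cf cg.
  exists (fun x => f x + g x); split => //; last by rewrite h2 Uf Vg.
  by move=> x Gx; rewrite zf // zg // addr0.
- move=> c U [WU [f [cf zf Uf]]]; split; first exact: WZ.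
  have [hc1 _] := C1_real_cst c; have [h1 h2] := C1_realM hc1 cf.
  exists (fun x => c * f x); split => //.
    by move=> x Gx; rewrite zf // mulr0.
  rewrite h2 Uf.
  have hx' x : dx (fun=> c) x = 0 by rewrite /dx derive_cst.
  have hy' x : dy (fun=> c) x = 0 by rewrite /dy derive_cst.
  by congr (_, _, _); apply/funext => x; rewrite ?hx' ?hy' mulr0 addr0.
Qed.

(** The real H^1 functions with zero trace on [Gam], realized as graph closure of the gradient; the
    gradient is part of the element, so its uniqueness is never an issue. *)
Definition sobolev : set E := form_closure L2_triple test_gradients grad_form mass_form.

Lemma test_gradientsW : test_gradients `<=` L2_triple. Proof. by move=> U []. Qed.

Lemma sobolev_subspace : subspace sobolev.
Proof.
exact: (form_closure_subspace L2_triple_subspace test_gradients_subspace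
  test_gradientsW grad_psd mass_psd).
Qed.

Lemma sobolev_complete : rapidly_complete sobolev (form_sum grad_form mass_form).
Proof.
exact: (form_closure_complete L2_triple_subspace test_gradientsW grad_psd mass_psd
  L2_triple_complete).
Qed.

Lemma sobolev_L2 U : sobolev U -> L2_triple U. Proof. by case. Qed.

Lemma sobolev_grad_psd : psd_form sobolev grad_form.
Proof. exact: psd_formW grad_psd. Qed.

Lemma sobolev_mass_psd : psd_form sobolev mass_form.
Proof. exact: psd_formW mass_psd. Qed.

End Sobolev.

(** * Compactness of the embedding on a curved strip *)

Section Cells.
Variable R : realType.
Local Notation leb := (@lebesgue_measure R).

(** Half-open cells partition the open interval exactly, not just up to null sets; the condition
    [0 < x < l] removes the endpoint [l] from the last one. *)
Definition cell (l : R) (n : nat) (i : 'I_n) : set R :=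
  [set x | 0 < x < l /\ i%:R * (l / n%:R) < x <= i.+1%:R * (l / n%:R)].

Lemma cell_is_interval l n (i : 'I_n) : is_interval (cell l i).
Proof.
move=> x y [/andP[x1 x2] /andP[x3 x4]] [/andP[y1 y2] /andP[y3 y4]] z /andP[xz zy].
by split; apply/andP; split; lra.
Qed.

Lemma cell_measure l n (i : 'I_n) : 0 < l -> (leb (cell l i) <= (l / n%:R)%:E)%E.
Proof.
move=> l0; have n0 : (0 < n)%N by apply: leq_trans (ltn_ord i).
have d0 : 0 < l / n%:R by rewrite divr_gt0 // ltr0n.
apply: (@le_trans _ _ (leb `]i%:R * (l / n%:R), i.+1%:R * (l / n%:R)]%classic)).
  apply: le_measure; rewrite ?inE; first by apply: is_interval_measurable; exact: cell_is_interval.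
    exact: measurable_itv.
  by move=> x [_]; rewrite /= in_itv.
rewrite lebesgue_measure_itv /= lte_fin ltr_pM2r // ltr_nat ltnSn -EFinB lee_fin.
by rewrite -mulrBl -natrB // subSnn mul1r.
Qed.

Lemma cell_cover l n x : (0 < n)%N -> 0 < x < l -> exists i : 'I_n, cell l i x.
Proof.
move=> n0 /andP[x0 xl]; have nn0 : n%:R != 0 :> R by rewrite pnatr_eq0 -lt0n.
suff H k : x <= k%:R * (l / n%:R) -> exists2 i : nat, (i < k)%N &
    i%:R * (l / n%:R) < x <= i.+1%:R * (l / n%:R).
  have [|i ltin hi] := H n; first by rewrite mulrCA divff // mulr1 ltW.
  by exists (Ordinal ltin); split => //; apply/andP.
elim: k => [|k IH]; first by rewrite mul0r leNgt x0.
case: (leP x (k%:R * (l / n%:R))) => [/IH[i ik hi] _|kx xk].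
  by exists i => //; exact: ltn_trans ik _.
by exists k => //; rewrite kx.
Qed.

Lemma cell_disjoint l n (i j : 'I_n) x : 0 < l -> cell l i x -> cell l j x -> i = j.
Proof.
move=> l0; have n0 : (0 < n)%N by apply: leq_trans (ltn_ord i).
have d0 : 0 < l / n%:R by rewrite divr_gt0 // ltr0n.
move=> [_ /andP[a1 a2]] [_ /andP[b1 b2]]; apply: val_inj => /=.
have := lt_le_trans a1 b2; have := lt_le_trans b1 a2.
rewrite !ltr_pM2r // !ltr_nat !ltnS => h1 h2.
by apply/eqP; rewrite eqn_leq h1 h2.
Qed.

End Cells.

Section Compactness.
Variable R : realType.
Local Notation leb := (@lebesgue_measure R).
Local Notation plane := (measurableTypeR R * measurableTypeR R)%type.
Local Notation pm := (plane_measure R).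

Lemma L2_subset (D Q : set plane) f : measurable D -> measurable Q -> Q `<=` D ->
  L2 pm D f -> L2 pm Q f /\ (sqnorm pm Q f <= sqnorm pm D f)%E.
Proof.
move=> mD mQ QD [mf ff].
have h : (sqnorm pm Q f <= sqnorm pm D f)%E.
  apply: ge0_subset_integral => //; first exact: measurable_sqr.
  by move=> z _; rewrite lee_fin sqr_ge0.
split => //; split; first exact: measurable_funS QD mf.
exact: le_lt_trans h ff.
Qed.

Lemma dot_partition (I : finType) (Q : I -> set plane) (D : set plane) f :
  measurable D -> (forall i, measurable (Q i)) -> (forall i, Q i `<=` D) ->
  (forall z, D z -> exists i, Q i z) -> (forall i j z, Q i z -> Q j z -> i = j) ->
  L2 pm D f -> dot pm D f f = \sum_i dot pm (Q i) f f.
Proof.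
move=> mD mQ QD cov dis Lf.
have LQ i := (L2_subset mD (mQ i) (QD i) Lf).1.
apply: EFin_inj; rewrite -sqnormE // -sumEFin.
rewrite (eq_bigr (fun i => sqnorm pm (Q i) f)); last by move=> i _; rewrite sqnormE.
have DE : D = \big[setU/set0]_(i <- index_enum I) Q i.
  rewrite -bigcup_seq; apply/seteqP; split.
    by move=> z /cov[i Qi]; exists i => //=; exact: mem_index_enum.
  by move=> z [i _ /QD].
rewrite {1}/sqnorm DE ge0_integral_bigsetU //.
- exact: index_enum_uniq.
- by move=> i j _ _ [z [Qi Qj]]; exact: dis Qi Qj.
- by rewrite -DE; apply: measurable_sqr; case: Lf.
- by move=> z _; rewrite lee_fin sqr_ge0.
Qed.

Variables (h dh : R -> R) (L : R) (Gam : set plane).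
Hypothesis hdh : forall t : R, is_derive t (1 : R) h (dh t).
Hypothesis cdh : continuous dh.
Hypothesis L0 : 0 < L.

Definition curved_strip : set plane :=
  curved_cell h `]0, L[%classic `]0, pi[%classic.
Local Notation D := curved_strip.

Lemma curved_strip_measurable : measurable D.
Proof. by apply: (curved_cell_measurable hdh); exact: measurable_itv. Qed.
Let mD := curved_strip_measurable.

Lemma profile_slope_bounded : exists2 H : R, 0 <= H & forall t, 0 < t < L -> dh t ^+ 2 <= H.
Proof.
have c2 : continuous (fun t => dh t * dh t) by exact: continuous_mul.
have [c _ hc] := EVT_max (ltW L0) (continuous_subspaceT c2).
exists (dh c * dh c); first by rewrite -expr2 sqr_ge0.
by move=> t /andP[t0 tL]; rewrite expr2; apply: hc; rewrite in_itv /= !ltW.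
Qed.

Let strip_cell n (i : 'I_n * 'I_n) : set plane := curved_cell h (cell L i.1) (cell pi i.2).

Let strip_cell_measurable n (i : 'I_n * 'I_n) : measurable (strip_cell i).
Proof.
by apply: (curved_cell_measurable hdh); apply: is_interval_measurable;
  exact: cell_is_interval.
Qed.

Let strip_cell_sub n (i : 'I_n * 'I_n) : strip_cell i `<=` D.
Proof.
by move=> z [[z1 _] [z2 _]]; split; rewrite /= in_itv.
Qed.

Let strip_cell_cover n z : (0 < n)%N -> D z -> exists i : 'I_n * 'I_n, strip_cell i z.
Proof.
move=> n0 []; rewrite /= !in_itv /= => /(cell_cover n0)[i hi] /(cell_cover n0)[j hj].
by exists (i, j).
Qed.

Let strip_cell_disjoint n (i j : 'I_n * 'I_n) z : strip_cell i z -> strip_cell j z -> i = j.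
Proof.
case: i j => [i1 i2] [j1 j2] [/= a1 a2] [/= b1 b2].
by rewrite (cell_disjoint L0 a1 b1) (cell_disjoint (pi_gt0 R) a2 b2).
Qed.

Let strip_cell_fin n (i : 'I_n * 'I_n) : (pm (strip_cell i) < +oo)%E.
Proof.
rewrite (curved_cell_measure hdh); try (by apply: is_interval_measurable; exact: cell_is_interval).
apply: lte_mul_pinfty => //.
  rewrite ge0_fin_numE //; apply: le_lt_trans (cell_measure _ L0) _; exact: ltry.
by apply: le_lt_trans (cell_measure _ (pi_gt0 R)) _; exact: ltry.
Qed.

Let strip_cell_poincare n (i : 'I_n * 'I_n) f : C1_real f ->
  L2 pm D f -> L2 pm D (dy f) -> L2 pm D (dx_sheared dh f) ->
  dot pm (strip_cell i) f f <= dot pm (strip_cell i) f (fun=> 1) ^+ 2 / fine (pm (strip_cell i))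
   + 2 * (pi / n%:R) ^+ 2 * dot pm (strip_cell i) (dy f) (dy f)
   + 2 * (L / n%:R) ^+ 2 * dot pm (strip_cell i) (dx_sheared dh f) (dx_sheared dh f).
Proof.
move=> C1f Lf Ly Lx.
have sub g : L2 pm D g -> L2 pm (strip_cell i) g.
  by move=> Lg; case: (L2_subset mD (strip_cell_measurable i) (@strip_cell_sub n i) Lg).
have n0 : (0 < n)%N by apply: leq_trans (ltn_ord i.1).
have fI : (leb (cell L i.1) < +oo)%E.
  by apply: le_lt_trans (cell_measure _ L0) _; exact: ltry.
have fJ : (leb (cell pi i.2) < +oo)%E.
  by apply: le_lt_trans (cell_measure _ (pi_gt0 R)) _; exact: ltry.
have := curved_cell_poincare hdh cdh C1f (@cell_is_interval _ L _ i.1)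
  (@cell_is_interval _ pi _ i.2) fI fJ (sub _ Lf).
rewrite -/(strip_cell i) !sqnormE; try exact: sub.
rewrite -lee_fin !EFinD => /le_trans; apply.
have sq (l d : R) (m : \bar R) : 0 <= d -> (0 <= m)%E -> (m <= (l / n%:R)%:E)%E ->
    (2%:E * (m * (m * d%:E)) <= (2 * (l / n%:R) ^+ 2 * d)%:E)%E.
  move=> d0; case: m => [m| |] // m0 ml; rewrite !lee_fin in m0 ml.
  rewrite -!EFinM lee_fin; move: (l / n%:R) ml => r mr.
  have := ler_wpM2r d0 (ler_pM m0 m0 mr mr); lra.
rewrite -EFinD; apply: leeD; first apply: leeD => //.
- by apply: sq; [exact: dot_ge0|exact: measure_ge0|exact: cell_measure (pi_gt0 R)].
- by apply: sq; [exact: dot_ge0|exact: measure_ge0|exact: cell_measure].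
all: exact: strip_cell_measurable.
Qed.

(** The component of [U.1.1] along the normalized constant function of the cell. Its square is the
    mean term of the Poincare inequality, also on a null cell, where both are 0. *)
Let strip_functional n (i : 'I_n * 'I_n) (U : (R * R -> R) * (R * R -> R) * (R * R -> R)) : R :=
  dot pm (strip_cell i) U.1.1 (fun=> 1) / Num.sqrt (fine (pm (strip_cell i))).

Let strip_functionalE n (i : 'I_n * 'I_n) U : strip_functional i U ^+ 2 =
  dot pm (strip_cell i) U.1.1 (fun=> 1) ^+ 2 / fine (pm (strip_cell i)).
Proof. by rewrite /strip_functional exprMn exprVn sqr_sqrtr // fine_ge0. Qed.

Lemma strip_relatively_compact :
  relatively_compact (sobolev D Gam) (grad_form D) (mass_form D).
Proof.
have L21 n (i : 'I_n * 'I_n) : L2 pm (strip_cell i) (fun=> 1).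
  exact: (L2_cst (strip_cell_measurable i) (strip_cell_fin i)).
apply: (form_closure_compact (L2_triple_subspace mD) (@test_gradientsW R D Gam)
  (grad_psd mD) (mass_psd mD)) => e e0.
have [H H0 hH] := profile_slope_bounded.
(* The Poincare terms of all cells add up to 2 (pi/n)^2 times the mass of [dy f] plus 2 (L/n)^2
   times that of [dx_sheared dh f], and the square of the latter is at most 2 (dx f)^2 + 2 H (dy
   f)^2. Hence the total is at most C/n^2 times the energy. *)
pose C := 2 * pi ^+ 2 + 4 * L ^+ 2 + 4 * L ^+ 2 * H.
have C0 : 0 <= C.
  have := sqr_ge0 (pi : R); have := sqr_ge0 L; have := mulr_ge0 (sqr_ge0 L) H0.
  by rewrite /C; lra.
have [n n0 hn] : exists2 n : nat, (0 < n)%N & C / n%:R ^+ 2 <= e.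
  have Ce0 : 0 < e / (C + 1) by rewrite divr_gt0 // ltr_wpDl.
  have [n _ /(_ n (leqnn n)) /=] := cvgr0_norm_lt _ (@cvg_harmonic R) _ Ce0.
  rewrite ger0_norm ?invr_ge0 // => hn; exists n.+1 => //.
  move: hn; rewrite -exprVn; have : n.+1%:R^-1 <= 1 :> R by rewrite invf_le1 // ler1n.
  have : 0 <= n.+1%:R^-1 :> R by rewrite invr_ge0.
  move: (n.+1%:R^-1) => r r0 r1; rewrite ltr_pdivlMr; last by rewrite ltr_wpDl.
  by nra.
exists ('I_n * 'I_n)%type, (@strip_functional n); split.
- move=> i; split.
    move=> U V [u _ _] [v _ _].
    have [u' _] := L2_subset mD (strip_cell_measurable i) (@strip_cell_sub n i) u.
    have [v' _] := L2_subset mD (strip_cell_measurable i) (@strip_cell_sub n i) v.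
    rewrite /strip_functional -mulrDl; congr (_ * _).
    exact: (dotDl (strip_cell_measurable i) u' v' (L21 n i)).
  move=> c U [u _ _].
  have [u' _] := L2_subset mD (strip_cell_measurable i) (@strip_cell_sub n i) u.
  rewrite /strip_functional mulrA; congr (_ * _).
  exact: (dotZl (strip_cell_measurable i) c u' (L21 n i)).
- move=> i U [u _ _]; rewrite strip_functionalE.
  have [u' le_u] := L2_subset mD (strip_cell_measurable i) (@strip_cell_sub n i) u.
  have cs := dot_cauchy_schwarz (strip_cell_measurable i) u' (L21 n i).
  rewrite (@dot_cst1 _ _ _ pm _ (strip_cell_measurable i)) in cs.
  have m0 : 0 <= fine (pm (strip_cell i)) by exact: fine_ge0.
  rewrite !sqnormE // lee_fin in le_u; apply: le_trans le_u.
  have [mz|mn0] := eqVneq (fine (pm (strip_cell i))) 0.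
    by rewrite mz invr0 mulr0 dot_ge0.
  by rewrite ler_pdivrMr // lt_def mn0.
move=> U [[Lu Lp Lq] [f [C1f _ Uf]]].
rewrite Uf /= in Lu Lp Lq *.
pose s (z : R * R) := dh z.1 * dy f z.
have sle z : D z -> s z ^+ 2 <= H * dy f z ^+ 2.
  move=> [z1 _]; rewrite /s exprMn ler_wpM2r ?sqr_ge0 //; apply: hH.
  by move: z1; rewrite /= in_itv.
have Ls : L2 pm D s.
  apply: (L2_le mD H0 Lq _ sle); apply: measurable_funM; last by case: Lq.
  apply: measurable_funTS; apply: measurableT_comp; last exact: measurable_fst.
  exact: continuous_measurable_fun.
have dsle := dot_le mD H0 Ls Lq sle.
have Lx : L2 pm D (dx_sheared dh f) := L2D mD Lp Ls.
have dxle : dot pm D (dx_sheared dh f) (dx_sheared dh f) <=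
    2 * dot pm D (dx f) (dx f) + 2 * dot pm D s s.
  have h2 := @formD_le2 _ _ _ (@L2_subspace _ _ _ pm D mD) _ (@dot_psd _ _ _ pm D mD) (dx f) s Lp Ls.
  exact: h2.
have split_D g : L2 pm D g -> dot pm D g g = \sum_(i : 'I_n * 'I_n) dot pm (strip_cell i) g g.
  exact: (@dot_partition _ (@strip_cell n) D g mD (@strip_cell_measurable n)
    (@strip_cell_sub n) (fun z => @strip_cell_cover n z n0) (@strip_cell_disjoint n)).
rewrite /mass_form /grad_form /= split_D //.
apply: (le_trans (ler_sum _ (fun i _ => strip_cell_poincare i C1f Lu Lq Lx))).
rewrite !big_split /= -!mulr_sumr -!split_D //.
under [X in X + _ + _ <= _]eq_bigr => i _ do rewrite -(strip_functionalE i (gradient f)).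
have p0 := dot_ge0 pm D (dx f); have q0 := dot_ge0 pm D (dy f).
have n2 : 0 <= n%:R^-1 ^+ 2 :> R by rewrite sqr_ge0.
move: dsle dxle p0 q0 hn n2; rewrite /C !exprMn -exprVn.
move: (\sum_i _) (dot pm D (dx f) _) (dot pm D (dy f) _) (dot pm D s s) (dot pm D (dx_sheared dh f) _) (n%:R^-1 ^+ 2).
move=> S x y t z r h1 h2 h3 h4 h5 h6.
have h7 := ler_wpM2r (addr_ge0 h3 h4) h5.
have L2r : 0 <= L ^+ 2 * r by apply: mulr_ge0 => //; exact: sqr_ge0.
have zle : z <= 2 * x + 2 * (H * y) by lra.
have h8 := ler_wpM2l L2r zle.
have h9 : 0 <= pi ^+ 2 * r * x by apply: mulr_ge0 => //; apply: mulr_ge0 => //; exact: sqr_ge0.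
have h10 := mulr_ge0 L2r h4.
have h11 := mulr_ge0 (mulr_ge0 L2r H0) h3.
by lra.
Qed.

End Compactness.

(** * Weak solutions and exponential weights *)

(** The rate required by [rapidly_complete] carries the constant 1, so the sequence is divided by
    the square root of [K] before completeness for [q] applies. *)
Lemma rapidly_complete_equiv (R : realType) (E : lmodType R) (V : set E)
    (q b : E -> E -> R) (K : R) : 0 < K -> subspace V -> psd_form V q -> psd_form V b ->
  (forall u, V u -> q u u <= K * b u u) -> (forall u, V u -> b u u <= K * q u u) ->
  rapidly_complete V q -> rapidly_complete V b.
Proof.
move=> K0 VS pq pb qb bq cq w Vw rw.
have [V0 VD VZ] := VS.
pose k := Num.sqrt K.
have k0 : 0 < k by rewrite sqrtr_gt0.
have kE : k ^+ 2 = K by rewrite sqr_sqrtr // ltW.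
have Vkw n : V (k^-1 *: w n) by exact: VZ.
have [||u Vu [C uC]] := cq (fun n => k^-1 *: w n) => //.
  move=> m n mn; have Vd := subspaceB VS (Vw n) (Vw m).
  rewrite -scalerBr (formZ VS pq) // (exprVn k) kE ler_pdivrMl //.
  by apply: (le_trans (qb _ Vd)); rewrite ler_pM2l // rw.
exists (k *: u); first exact: VZ.
exists (K * (K * C)) => n.
have -> : k *: u - w n = k *: (u - k^-1 *: w n).
  by rewrite scalerBr scalerA divff ?scale1r // gt_eqF.
rewrite (formZ VS pb); last exact: subspaceB.
rewrite kE -!mulrA ler_pM2l //.
apply: (le_trans (bq _ _)); first exact: subspaceB.
by rewrite ler_pM2l.
Qed.

Section WeakSolutions.
Variable R : realType.
Local Notation plane := (measurableTypeR R * measurableTypeR R)%type.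
Local Notation pm := (plane_measure R).
Local Notation E := ((R * R -> R) * (R * R -> R) * (R * R -> R))%type.

Variables (D Gam : set plane).
Hypothesis mD : measurable D.
Local Notation L2 := (L2 pm D).
Local Notation dot := (dot pm D).
Local Notation V := (sobolev D Gam).
Local Notation mass := (mass_form D).
Local Notation grad := (grad_form D).

Variables (ls lam : R).
Hypothesis grad_ge : forall U, V U -> ls * mass U U <= grad U U.
Hypothesis lam_lt : lam < ls.

Let delta := ls - lam.
Let delta0 : 0 < delta. Proof. by rewrite subr_gt0. Qed.

Definition shifted_form (U X : E) := grad U X - lam * mass U X.

Let VS := sobolev_subspace Gam mD.
Let pg := sobolev_grad_psd Gam mD.
Let pms := sobolev_mass_psd Gam mD.

Lemma shifted_form_ge U : V U -> delta * mass U U <= shifted_form U U.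
Proof. by move=> VU; have := grad_ge VU; rewrite /shifted_form /delta; lra. Qed.

Lemma shifted_form_psd : psd_form V shifted_form.
Proof.
case: (pg) => aC aD aZ a0; case: (pms) => bC bD bZ b0; split; rewrite /shifted_form.
- by move=> u v Vu Vv; rewrite aC // bC.
- by move=> u v w Vu Vv Vw; rewrite aD // bD //; ring.
- by move=> c u v Vu Vv; rewrite aZ // bZ //; ring.
- move=> u Vu; apply: le_trans (shifted_form_ge Vu).
  by rewrite mulr_ge0 ?b0 // ltW.
Qed.

Definition weak_solution (f : R * R -> R) (U : E) :=
  V U /\ forall X, V X -> shifted_form U X = dot f X.1.1.

Lemma weak_solution_exists f : L2 f -> exists U, weak_solution f U.
Proof.
move=> Lf.
(* The shifted form is at most 1 + |lam| times the form norm, and conversely the form norm is at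
   most 1 + (1 + |lam|) / delta times the shifted form; [K] dominates both factors. *)
pose K := 1 + `|lam| + (1 + `|lam|) / delta.
have l0 : 0 <= `|lam| by [].
have l1 : lam <= `|lam| := ler_norm lam.
have l2 : - lam <= `|lam| by rewrite -normrN ler_norm.
have d1 : 0 <= (1 + `|lam|) / delta by rewrite divr_ge0 ?ltW // ltr_pwDl.
have K0 : 0 < K by rewrite /K; lra.
have cb : rapidly_complete V shifted_form.
  have pq : psd_form V (form_sum grad mass) by exact: form_sum_psd pg pms.
  apply: (rapidly_complete_equiv K0 VS pq shifted_form_psd _ _ (@sobolev_complete _ _ Gam mD)).
  - move=> u Vu; have m0 := form_ge0 pms Vu; have s0 := shifted_form_ge Vu.
    have : mass u u <= shifted_form u u / delta by rewrite ler_pdivlMr // mulrC.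
    have h1 : grad u u = shifted_form u u + lam * mass u u by rewrite /shifted_form; ring.
    rewrite /form_sum h1 => h2.
    have h3 : lam * mass u u <= `|lam| * (shifted_form u u / delta).
      by apply: le_trans (ler_wpM2l l0 h2); rewrite ler_wpM2r.
    have h4 : 0 <= `|lam| * shifted_form u u.
      by rewrite mulr_ge0 //; exact: (form_ge0 shifted_form_psd).
    rewrite /K !mulrDl mul1r; lra.
  - move=> u Vu; have m0 := form_ge0 pms Vu; have g0 := form_ge0 pg Vu.
    rewrite /form_sum.
    have h1 : - lam * mass u u <= `|lam| * mass u u by rewrite ler_wpM2r.
    have h2 := mulr_ge0 l0 g0.
    have h3 := mulr_ge0 d1 (addr_ge0 g0 m0).
    rewrite /shifted_form /K mulrDl; move: h3.
    by move: ((1 + `|lam|) / delta * _) => X h3; lra.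
have [|v Vv|U VU hU] := @coercive_form_solution _ _ V VS shifted_form (fun X => dot f X.1.1)
   (dot f f / delta) shifted_form_psd cb.
- split.
  + move=> u v /sobolev_L2[Lu _ _] /sobolev_L2[Lv _ _].
    by rewrite dotC [dot f u.1.1]dotC [dot f v.1.1]dotC; exact: (dotDl mD Lu Lv Lf).
  + move=> c u /sobolev_L2[Lu _ _].
    by rewrite dotC [dot f u.1.1]dotC; exact: (dotZl mD c Lu Lf).
- have [Lv _ _] := sobolev_L2 Vv.
  apply: (le_trans (dot_cauchy_schwarz mD Lf Lv)).
  rewrite -mulrA ler_wpM2l ?dot_ge0 // ler_pdivlMl //.
  exact: shifted_form_ge.
- by exists U.
Qed.

(** Test the equation with [U] itself and use coercivity and Cauchy-Schwarz. *)
Lemma weak_solution_bound f U : L2 f -> weak_solution f U ->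
  delta ^+ 2 * mass U U <= dot f f.
Proof.
move=> Lf [VU hU]; have [Lu _ _] := sobolev_L2 VU.
have := shifted_form_ge VU; rewrite hU // => h1.
have := dot_cauchy_schwarz mD Lf Lu; rewrite -/(mass U U) => h2.
have m0 := form_ge0 pms VU; have f0 := dot_ge0 pm D f.
have [mz|mn0] := eqVneq (mass U U) 0; first by rewrite mz mulr0.
have mp : 0 < mass U U by rewrite lt_def mn0.
have h3 : (delta * mass U U) ^+ 2 <= dot f U.1.1 ^+ 2.
  have h4 : 0 <= delta * mass U U by rewrite mulr_ge0 // ltW.
  by rewrite ler_pXn2r // nnegrE; lra.
have := le_trans h3 h2; rewrite exprMn [mass U U ^+ 2]expr2 mulrA.
by rewrite ler_pM2r.
Qed.

Lemma weak_solution_unique f U U' : weak_solution f U -> weak_solution f U' ->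
  dot (fun z => U'.1.1 z - U.1.1 z) (fun z => U'.1.1 z - U.1.1 z) = 0.
Proof.
move=> [VU hU] [VU' hU'].
have VB := subspaceB VS VU' VU.
have w0 : weak_solution (fun=> 0) (U' - U).
  split => // X VX.
  have Lx : L2 X.1.1 by case: (sobolev_L2 VX).
  rewrite -scaleN1r (form_combl VS shifted_form_psd) // hU // hU' // mulN1r subrr.
  by rewrite /dot /Rintegral integral0_eq // => z _; rewrite mul0r.
have := weak_solution_bound (L2_0 pm D) w0.
have -> : dot (fun=> 0) (fun=> 0) = 0.
  by rewrite /dot /Rintegral integral0_eq // => z _; rewrite mul0r.
rewrite pmulr_rle0 ?exprn_gt0 // => h.
by apply/eqP; rewrite eq_le h dot_ge0.
Qed.

End WeakSolutions.

Section ExponentialWeight.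
Variable R : realType.
Local Notation plane := (measurableTypeR R * measurableTypeR R)%type.
Local Notation pm := (plane_measure R).
Local Notation E := ((R * R -> R) * (R * R -> R) * (R * R -> R))%type.
Variable c : R.

Definition exp_weight (s : R) (z : R * R) : R := expR (s * (c - z.1)).

Lemma exp_weightM s z : exp_weight s z * exp_weight s z = exp_weight (2 * s) z.
Proof. by rewrite /exp_weight -expRD; congr expR; ring. Qed.

Lemma C1_exp_weight s : C1_real (exp_weight s) /\ gradient (exp_weight s) =
  (exp_weight s, fun z => - s * exp_weight s z, fun=> 0).
Proof.
pose e1 (x : R) := expR (s * (c - x)).
have de (x : R) : is_derive x (1 : R) e1 (- s * e1 x).
  have d1 : is_derive x (1 : R) (fun x => s * (c - x)) (- s).
    have := @is_deriveZ _ _ _ (cst c - id) s x 1 _ (is_deriveB (is_derive_cst c x 1) (is_derive_id x 1)).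
    by rewrite sub0r /GRing.scale /= mulrN1.
  have := @is_derive1_comp _ expR (fun x => s * (c - x)) x _ _ (is_derive_expR _) d1.
  by rewrite mulrC.
have e1c : continuous e1.
  by move=> x; apply/differentiable_continuous/derivable1_diffP; exact: @ex_derive (de x).
have dfst (z : R * R) : differentiable (fst : R * R -> R) z.
  exact/linear_differentiable/continuous_fst.
have dw z : differentiable (exp_weight s) z.
  apply: (@differentiable_comp _ _ _ _ fst e1) => //.
  by apply/derivable1_diffP; exact: @ex_derive (de z.1).
have Dx : (fun z => 'D_((1, 0) : R * R) (exp_weight s) z) = (fun z => - s * exp_weight s z).
  apply/funext => z; rewrite -[LHS]/('D_(1 : R) e1 z.1).
  exact: @derive_val _ _ _ _ _ _ _ (de z.1).
have Dy : (fun z => 'D_((0, 1) : R * R) (exp_weight s) z) = (fun=> 0).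
  apply/funext => z; rewrite -[LHS]/('D_(0 : R) e1 z.1).
  rewrite deriveE ?linear0 //; apply/derivable1_diffP; exact: @ex_derive (de z.1).
have cw : continuous (exp_weight s) by move=> z; exact/differentiable_continuous.
split; last by congr (_, _, _); [exact: Dx|exact: Dy].
split; [exact: dw| |].
  by rewrite Dx; apply: continuous_mul => //; exact: cst_continuous.
by rewrite Dy; exact: cst_continuous.
Qed.

Variables (D Gam : set plane) (L : R).
Hypothesis mD : measurable D.
Hypothesis DL : forall z, D z -> 0 < z.1 < L.
Local Notation L2 := (L2 pm D).
Local Notation dot := (dot pm D).
Local Notation V := (sobolev D Gam).
Local Notation mass := (mass_form D).
Local Notation grad := (grad_form D).

(** A crude bound of the squared weight on [D], where |c - z.1| <= |c| + L. Only its finiteness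
    matters: it makes weighting continuous for the form norm. *)
Let M (s : R) := expR (2 * (`|s| * (`|c| + L))).

Let M0 s : 0 <= M s. Proof. exact: expR_ge0. Qed.

Lemma exp_weight_bounded s (f : R * R -> R) z : D z ->
  (exp_weight s z * f z) ^+ 2 <= M s * f z ^+ 2.
Proof.
move=> /DL/andP[z0 zL]; rewrite exprMn ler_wpM2r ?sqr_ge0 // expr2 exp_weightM.
rewrite ler_expR -mulrA ler_wpM2l //.
apply: (le_trans (ler_norm _)); rewrite normrM ler_wpM2l //.
apply: (le_trans (ler_normB _ _)); rewrite lerD2l ger0_norm ?ltW //.
Qed.

Lemma measurable_exp_weight s : measurable_fun D (exp_weight s).
Proof.
have [[dw _ _] _] := C1_exp_weight s.
apply: measurable_funTS; apply: plane_continuous_measurable.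
by move=> z; exact/differentiable_continuous.
Qed.

Lemma L2_exp_weight s f : L2 f -> L2 (fun z => exp_weight s z * f z).
Proof.
move=> Lf; apply: (L2_le mD (M0 s) Lf) => [|z Dz]; last exact: exp_weight_bounded.
by apply: measurable_funM; [exact: measurable_exp_weight|case: Lf].
Qed.

Lemma dot_exp_weight_le s f : L2 f ->
  dot (fun z => exp_weight s z * f z) (fun z => exp_weight s z * f z) <= M s * dot f f.
Proof.
move=> Lf; apply: (dot_le mD (M0 s) (L2_exp_weight s Lf) Lf) => z Dz.
exact: exp_weight_bounded.
Qed.

(* If [(p, q)] is the gradient of [u], these are [eta u] and its gradient. *)
Definition weighted (s : R) (U : E) : E :=
  (fun z => exp_weight s z * U.1.1 z,
   fun z => exp_weight s z * U.1.2 z - s * (exp_weight s z * U.1.1 z),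
   fun z => exp_weight s z * U.2 z).

Lemma weightedB s U X : weighted s (U - X) = weighted s U - weighted s X.
Proof.
congr (_, _, _); apply/funext => z.
- by rewrite -[LHS]/(exp_weight s z * (U.1.1 z - X.1.1 z)) mulrBr.
- rewrite -[LHS]/(exp_weight s z * (U.1.2 z - X.1.2 z) - s * (exp_weight s z * (U.1.1 z - X.1.1 z))).
  rewrite -[RHS]/((exp_weight s z * U.1.2 z - s * (exp_weight s z * U.1.1 z)) - (exp_weight s z * X.1.2 z - s * (exp_weight s z * X.1.1 z))).
  by ring.
- by rewrite -[LHS]/(exp_weight s z * (U.2 z - X.2 z)) mulrBr.
Qed.

Lemma L2_weighted s U : L2_triple D U -> L2_triple D (weighted s U).
Proof.
move=> [Lu Lp Lq]; split; [exact: L2_exp_weight| |exact: L2_exp_weight].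
by apply: (L2B mD); [exact: L2_exp_weight|apply: (L2Z mD); exact: L2_exp_weight].
Qed.

Lemma test_gradients_weighted s U : test_gradients D Gam U ->
  test_gradients D Gam (weighted s U).
Proof.
move=> [WU [f [C1f zf Uf]]]; split; first exact: L2_weighted.
have [C1w gw] := C1_exp_weight s.
have [C1wf gwf] := C1_realM C1w C1f.
exists (fun z => exp_weight s z * f z); split => //.
  by move=> z Gz; rewrite zf // mulr0.
case: gw => wx wy; rewrite gwf Uf.
have wx' z : dx (exp_weight s) z = - s * exp_weight s z := congr1 (fun k => k z) wx.
have wy' z : dy (exp_weight s) z = 0 := congr1 (fun k => k z) wy.
by congr (_, _, _); apply/funext => z; rewrite /= ?wx' ?wy'; ring.
Qed.

Lemma form_sum_weighted_le s U : L2_triple D U ->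
  form_sum grad mass (weighted s U) (weighted s U) <=
  (3 * M s + 2 * s ^+ 2 * M s) * form_sum grad mass U U.
Proof.
move=> [Lu Lp Lq]; rewrite /form_sum /grad_form /mass_form /=.
have Lwu := L2_exp_weight s Lu; have Lwp := L2_exp_weight s Lp.
have h1 := dot_exp_weight_le s Lu; have h2 := dot_exp_weight_le s Lp.
have h3 := dot_exp_weight_le s Lq.
have h4 := @formB_le2 _ _ _ (@L2_subspace _ _ _ pm D mD) _ (@dot_psd _ _ _ pm D mD) _ _ Lwp (L2Z mD s Lwu).
have h5 : dot (fun z => s * (exp_weight s z * U.1.1 z)) (fun z => s * (exp_weight s z * U.1.1 z))
    = s ^+ 2 * dot (fun z => exp_weight s z * U.1.1 z) (fun z => exp_weight s z * U.1.1 z).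
  exact: (@formZ _ _ _ (@L2_subspace _ _ _ pm D mD) _ (@dot_psd _ _ _ pm D mD) s _ Lwu).
rewrite h5 in h4; apply: (@le_trans _ _ (2 * dot (fun z => exp_weight s z * U.1.2 z) (fun z => exp_weight s z * U.1.2 z)
   + 2 * (s ^+ 2 * dot (fun z => exp_weight s z * U.1.1 z) (fun z => exp_weight s z * U.1.1 z))
   + M s * dot U.2 U.2 + M s * dot U.1.1 U.1.1)).
  by apply: lerD => //; apply: lerD => //; exact: h4.
have h6 := ler_wpM2l (sqr_ge0 s) h1.
have u0 := mulr_ge0 (M0 s) (dot_ge0 pm D U.1.1).
have p0 := mulr_ge0 (M0 s) (dot_ge0 pm D U.1.2).
have q0 := mulr_ge0 (M0 s) (dot_ge0 pm D U.2).
have s0 := sqr_ge0 s.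
have sp := mulr_ge0 s0 p0; have sq := mulr_ge0 s0 q0.
move: h2 h6 u0 p0 q0 sp sq.
move: (dot (fun z => exp_weight s z * U.1.1 z) _) (dot (fun z => exp_weight s z * U.1.2 z) _) => y x.
move: (dot U.1.1 U.1.1) (dot U.1.2 U.1.2) (dot U.2 U.2) => u p q.
by move: (M s) (s ^+ 2) => m r *; lra.
Qed.

(** Weighting maps test functions to test functions and is bounded for the form norm, so it
    preserves the closure. *)
Lemma sobolev_weighted s U : V U -> V (weighted s U).
Proof.
move=> [WU hU]; split; first exact: L2_weighted.
move=> e e0; pose K := 3 * M s + 2 * s ^+ 2 * M s.
have K0 : 0 <= K by have := mulr_ge0 (sqr_ge0 s) (M0 s); have := M0 s; rewrite /K; lra.
have eK : 0 < e / (K + 1) by rewrite divr_gt0 // ltr_wpDl.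
have [g Gg hg] := hU _ eK.
exists (weighted s g); first exact: test_gradients_weighted.
rewrite -weightedB; apply: (le_lt_trans (form_sum_weighted_le s _)).
  by apply: (subspaceB (L2_triple_subspace mD)) => //; exact: test_gradientsW Gg.
rewrite -/K; move: hg; rewrite ltr_pdivlMr; last by rewrite ltr_wpDl.
have : 0 <= form_sum grad mass (g - U) (g - U).
  by rewrite /form_sum /grad_form !addr_ge0 ?dot_ge0.
by move: (form_sum _ _ _ _) => r r0; lra.
Qed.

Lemma mass_weighted2 s U : mass U (weighted (2 * s) U) = mass (weighted s U) (weighted s U).
Proof.
apply: eq_Rintegral => z _ /=; rewrite -exp_weightM; ring.
Qed.

(** The localization identity: the gradients of u and eta^2 u pair to |grad (eta u)|^2 - |grad
    eta|^2 u^2, and here |grad eta| = s eta. The cross terms cancel because everything is real. *)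
Lemma grad_weighted2 s U : L2_triple D U ->
  grad U (weighted (2 * s) U) =
  grad (weighted s U) (weighted s U) - s ^+ 2 * mass (weighted s U) (weighted s U).
Proof.
move=> [Lu Lp Lq]; rewrite /grad_form /mass_form /=.
have Lwu := L2_exp_weight s Lu; have Lwp := L2_exp_weight s Lp.
have Lwu2 := L2_exp_weight (2 * s) Lu; have Lwp2 := L2_exp_weight (2 * s) Lp.
have e1 : dot U.2 (fun z => exp_weight (2 * s) z * U.2 z) =
    dot (fun z => exp_weight s z * U.2 z) (fun z => exp_weight s z * U.2 z).
  by apply: eq_Rintegral => z _ /=; rewrite -exp_weightM; ring.
have e2 : dot U.1.2 (fun z => exp_weight (2 * s) z * U.1.2 z - 2 * s * (exp_weight (2 * s) z * U.1.1 z))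
    = dot (fun z => exp_weight s z * U.1.2 z) (fun z => exp_weight s z * U.1.2 z)
      - 2 * s * dot (fun z => exp_weight s z * U.1.2 z) (fun z => exp_weight s z * U.1.1 z).
  have -> : dot (fun z => exp_weight s z * U.1.2 z) (fun z => exp_weight s z * U.1.2 z)
      = dot (fun z => exp_weight (2 * s) z * U.1.2 z) U.1.2.
    by apply: eq_Rintegral => z _ /=; rewrite -exp_weightM; ring.
  have -> : dot (fun z => exp_weight s z * U.1.2 z) (fun z => exp_weight s z * U.1.1 z)
      = dot (fun z => exp_weight (2 * s) z * U.1.1 z) U.1.2.
    by apply: eq_Rintegral => z _ /=; rewrite -exp_weightM; ring.
  rewrite dotC -mulNr -(dotZl mD (- (2 * s)) Lwu2 Lp).
  rewrite -(dotDl mD Lwp2 (L2Z mD (- (2 * s)) Lwu2) Lp).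
  by apply: eq_Rintegral => z _ /=; rewrite mulNr.
have e3 : dot (fun z => exp_weight s z * U.1.2 z - s * (exp_weight s z * U.1.1 z))
      (fun z => exp_weight s z * U.1.2 z - s * (exp_weight s z * U.1.1 z))
    = dot (fun z => exp_weight s z * U.1.2 z) (fun z => exp_weight s z * U.1.2 z)
      - 2 * s * dot (fun z => exp_weight s z * U.1.2 z) (fun z => exp_weight s z * U.1.1 z)
      + s ^+ 2 * dot (fun z => exp_weight s z * U.1.1 z) (fun z => exp_weight s z * U.1.1 z).
  have := @form_comb _ _ _ (@L2_subspace _ _ _ pm D mD) _ (@dot_psd _ _ _ pm D mD) _ (- s) _ Lwp Lwu.
  rewrite (_ : _ + _ = (fun z => exp_weight s z * U.1.2 z - s * (exp_weight s z * U.1.1 z))).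
    by move=> ->; ring.
  by apply/funext => z; rewrite -[LHS]/(exp_weight s z * U.1.2 z + - s * (exp_weight s z * U.1.1 z)) mulNr.
by rewrite e1 e2 e3; ring.
Qed.

End ExponentialWeight.

(** * The Combes-Thomas estimate *)

Section CombesThomas.
Variable R : realType.
Local Notation plane := (measurableTypeR R * measurableTypeR R)%type.
Local Notation pm := (plane_measure R).
Local Notation E := ((R * R -> R) * (R * R -> R) * (R * R -> R))%type.

Variables (D Gam : set plane) (L : R).
Hypothesis mD : measurable D.
Hypothesis DL : forall z, D z -> 0 < z.1 < L.
Local Notation L2 := (L2 pm D).
Local Notation dot := (dot pm D).
Local Notation V := (sobolev D Gam).
Local Notation mass := (mass_form D).
Local Notation grad := (grad_form D).

Variables (ls lam : R).
Hypothesis grad_ge : forall U, V U -> ls * mass U U <= grad U U.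

Lemma L2_indic (A : set plane) f : measurable A -> L2 f -> L2 (fun z => \1_A z * f z).
Proof.
move=> mA Lf; apply: (L2_le mD ler01 Lf).
  by apply: measurable_funM; [exact: measurable_indic|case: Lf].
move=> z _; rewrite mul1r indicE; case: (z \in A); rewrite ?mul1r // mul0r expr0n /=.
exact: sqr_ge0.
Qed.

(** The bound is kept in squared form, so that the estimates for real and imaginary part can be
    added without losing a constant. *)
Lemma combes_thomas (c s t : R) (A : set plane) f U : 0 <= s -> 0 < t ->
  s ^+ 2 < ls - lam -> L2 f -> weak_solution D Gam lam f U ->
  (forall z, D z -> z.1 < c -> f z = 0) ->
  measurable A -> (forall z, D z -> A z -> z.1 <= c - t) ->
  4 * (ls - lam - s ^+ 2) ^+ 2 * expR (2 * (s * t)) *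
    dot (fun z => \1_A z * U.1.1 z) (fun z => \1_A z * U.1.1 z) <= dot f f.
Proof.
move=> s0 t0 sd Lf [VU hU] f0 mA Ac.
set d := ls - lam - s ^+ 2.
have d0 : 0 < d by rewrite subr_gt0.
have WU := sobolev_L2 VU; have [Lu _ _] := WU.
pose eta := exp_weight c s.
have Leu : L2 (fun z => eta z * U.1.1 z) := L2_exp_weight c mD DL s Lu.
(* The whole half-plane right of [c], measurable by construction; the source [f] vanishes on [D]
   outside it. *)
pose B : set plane := fst @^-1` `[c, +oo[%classic.
have mB : measurable B.
  have := @measurable_fst _ _ (measurableTypeR R) (measurableTypeR R) measurableT
    _ (measurable_itv `[c, +oo[).
  by rewrite setTI.
have BE z : (z \in B) = (c <= z.1).
  by apply/idP/idP; rewrite inE /B /= in_itv /= andbT.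
pose uA z := \1_A z * U.1.1 z.
pose uB z := \1_B z * (eta z * U.1.1 z).
have LA : L2 uA := L2_indic mA Lu.
have LB : L2 uB := L2_indic mB Leu.
pose k := expR (s * t).
have kk : k ^+ 2 = expR (2 * (s * t)) by rewrite expr2 -expRD; congr expR; ring.
have energy : d * mass (weighted c s U) (weighted c s U) <= dot f (weighted c (2 * s) U).1.1.
  have := hU _ (sobolev_weighted c mD DL (2 * s) VU).
  rewrite /shifted_form (grad_weighted2 c mD DL) // mass_weighted2 => <-.
  have := grad_ge (sobolev_weighted c mD DL s VU).
  by rewrite /d; move: (mass _ _) (grad _ _) => m g; lra.
(* On [A] the weight is at least [k], and t > 0 separates [A] from [B]; hence the two contributions
   are orthogonal and add up. *)
have split_AB : k ^+ 2 * dot uA uA + dot uB uB <= mass (weighted c s U) (weighted c s U).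
  have LkA := L2Z mD k LA.
  have LS := L2D mD LB LkA.
  have AB0 z : D z -> uA z * uB z = 0.
    move=> Dz; rewrite /uA /uB !indicE BE; case: (boolP (z \in A)) => zA; last by rewrite !mul0r.
    rewrite inE in zA; have := Ac z Dz zA => h.
    by rewrite (_ : (c <= z.1) = false) ?mul0r ?mulr0 //; apply/negbTE; rewrite -ltNge; lra.
  have dAB : dot uB uA = 0.
    rewrite dotC /dot /Rintegral integral0_eq // => z Dz; congr EFin; exact: AB0.
  have h1 : dot (fun z => uB z + k * uA z) (fun z => uB z + k * uA z) <= 1 * mass (weighted c s U) (weighted c s U).
    apply: (dot_le mD ler01 LS Leu) => z Dz; rewrite mul1r.
    have -> : (uB z + k * uA z) ^+ 2 = uB z ^+ 2 + k ^+ 2 * uA z ^+ 2.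
      move: (AB0 z Dz); move: (uA z) (uB z) => a b ab.
      rewrite -[RHS]addr0 -(mulr0 (2 * k)) -ab; ring.
    rewrite /uA /uB !indicE BE; case: (boolP (z \in A)) => zA.
      rewrite inE in zA; have h := Ac z Dz zA.
      have -> : (c <= z.1) = false by apply/negbTE; rewrite -ltNge; lra.
      rewrite mul0r expr0n add0r mul1r -exprMn.
      rewrite !exprMn ler_wpM2r ?sqr_ge0 // ler_pXn2r ?nnegrE ?expR_ge0 //.
      by rewrite ler_expR ler_wpM2l //; lra.
    rewrite !mul0r expr0n mulr0 addr0; case: (c <= z.1); rewrite ?mul1r // mul0r expr0n.
    exact: sqr_ge0.
  rewrite mul1r in h1; apply: le_trans h1.
  have := @form_comb _ _ _ (@L2_subspace _ _ _ pm D mD) _ (@dot_psd _ _ _ pm D mD) _ k _ LB LA.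
  rewrite dAB mulr0 addr0 => h1.
  by rewrite [leRHS]h1 addrC.
(* One factor of the weight goes to [f], where it is at most 1, the other to [U]; as [f] lives on
   [B], only [uB] is seen. *)
have cs : dot f (weighted c (2 * s) U).1.1 ^+ 2 <= dot f f * dot uB uB.
  have Lef := L2_exp_weight c mD DL s Lf.
  have -> : dot f (weighted c (2 * s) U).1.1 = dot (fun z => eta z * f z) uB.
    apply: eq_Rintegral => z; rewrite inE => Dz.
    rewrite /uB indicE BE /weighted /= -exp_weightM -/eta.
    case: (leP c z.1) => [_|zc]; first by rewrite mul1r; ring.
    by rewrite f0 // mulr0 !mul0r.
  apply: (le_trans (dot_cauchy_schwarz mD Lef LB)).
  rewrite ler_wpM2r ?dot_ge0 // -[leRHS]mul1r.
  apply: (dot_le mD ler01 Lef Lf) => z Dz; rewrite mul1r.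
  case: (leP c z.1) => [cz|zc]; last by rewrite f0 // mulr0.
  rewrite exprMn -[leRHS]mul1r ler_wpM2r ?sqr_ge0 // exprn_ile1 ?expR_ge0 //.
  by rewrite -expR0 ler_expR mulr_ge0_le0 // subr_le0.
rewrite -kk -/uA.
have X0 := dot_ge0 pm D uB; have F0 := dot_ge0 pm D f.
have Y0 : 0 <= k ^+ 2 * dot uA uA by rewrite mulr_ge0 ?sqr_ge0 ?dot_ge0.
have h := le_trans (ler_wpM2l (ltW d0) split_AB) energy.
rewrite -mulrA; move: X0 F0 Y0 h cs.
move: (dot uB uB) (dot f f) (k ^+ 2 * dot uA uA) (dot f (weighted c (2 * s) U).1.1) => X F Y y X0 F0 Y0 h cs.
have dYX : 0 <= d * (Y + X) by apply: mulr_ge0; [exact: ltW|exact: addr_ge0].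
have sq : (d * (Y + X)) ^+ 2 <= F * X.
  apply: le_trans cs; have y0 := le_trans dYX h.
  by rewrite ler_pXn2r ?nnegrE.
(* From d^2 (Y + X)^2 <= F X the claim 4 d^2 Y <= F follows after division by [X], since (Y + X)^2 -
   4 X Y is a square. For X = 0 the inequality forces Y = 0. *)
have [Xz|Xn0] := eqVneq X 0.
  have : (d * (Y + X)) ^+ 2 = 0 by apply/eqP; rewrite eq_le sqr_ge0 andbT (le_trans sq) // Xz mulr0.
  move/eqP; rewrite sqrf_eq0 mulf_eq0 (gt_eqF d0) /= Xz addr0 => /eqP ->.
  by rewrite mulr0.
have Xp : 0 < X by rewrite lt_def Xn0.
rewrite -(ler_pM2r Xp); apply: le_trans sq.
rewrite -subr_ge0.
rewrite [X in 0 <= X](_ : _ = (d * (Y - X)) ^+ 2); last by ring.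
exact: sqr_ge0.
Qed.

End CombesThomas.

(** * Complex-valued functions and the resolvent *)

Lemma lte_sum3 (R : realType) (a b c e : \bar R) : (0 <= a -> 0 <= b -> 0 <= c ->
  a + b + c < e -> [/\ a < e, b < e & c < e])%E.
Proof.
move=> a0 b0 c0 lt; split; apply: le_lt_trans lt.
- by rewrite -addeA leeDl // adde_ge0.
- by rewrite addeAC leeDr // adde_ge0.
- by rewrite leeDr // adde_ge0.
Qed.

Lemma lte_sum3_split (R : realType) (a b c a' b' c' e : \bar R) :
  (0 <= a -> 0 <= b -> 0 <= c -> 0 <= a' -> 0 <= b' -> 0 <= c' ->
   (a + a') + (b + b') + (c + c') < e -> a + b + c < e /\ a' + b' + c' < e)%E.
Proof.
move=> a0 b0 c0 a0' b0' c0' lt; split; apply: le_lt_trans lt; rewrite !leeD //;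
  by rewrite ?leeDl ?leeDr.
Qed.

Section ComplexValued.
Local Open Scope complex_scope.
Variable R : realType.
Local Notation plane := (measurableTypeR R * measurableTypeR R)%type.
Local Notation pm := (plane_measure R).
Local Notation E := ((R * R -> R) * (R * R -> R) * (R * R -> R))%type.

Definition re (u : R * R -> R[i]) (z : R * R) : R := complex.Re (u z).
Definition im (u : R * R -> R[i]) (z : R * R) : R := complex.Im (u z).

Lemma reB u v : re (fun z => u z - v z) = (fun z => re u z - re v z).
Proof. by apply/funext => z; rewrite /re; case: (u z) (v z) => a b [c d]. Qed.

Lemma imB u v : im (fun z => u z - v z) = (fun z => im u z - im v z).
Proof. by apply/funext => z; rewrite /im; case: (u z) (v z) => a b [c d]. Qed.

Lemma reDZ u v (lam : R) : re (fun z => u z + lam%:C * v z) = (fun z => re u z + lam * re v z).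
Proof.
by apply/funext => z; rewrite /re; case: (u z) (v z) => a b [c d] /=; rewrite mul0r subr0.
Qed.

Lemma imDZ u v (lam : R) : im (fun z => u z + lam%:C * v z) = (fun z => im u z + lam * im v z).
Proof.
by apply/funext => z; rewrite /im; case: (u z) (v z) => a b [c d] /=; rewrite mul0r addr0.
Qed.

Lemma reZ v (lam : R) : re (fun z => lam%:C * v z) = (fun z => lam * re v z).
Proof. by apply/funext => z; rewrite /re; case: (v z) => c d /=; rewrite mul0r subr0. Qed.

Lemma imZ v (lam : R) : im (fun z => lam%:C * v z) = (fun z => lam * im v z).
Proof. by apply/funext => z; rewrite /im; case: (v z) => c d /=; rewrite mul0r addr0. Qed.

Lemma re_indicator (A : set plane) v : re (indicator_mul A v) = (fun z => \1_A z * re v z).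
Proof.
apply/funext => z; rewrite /re /indicator_mul; case: (v z) => c d /=.
by rewrite mul0r subr0.
Qed.

Lemma im_indicator (A : set plane) v : im (indicator_mul A v) = (fun z => \1_A z * im v z).
Proof.
apply/funext => z; rewrite /im /indicator_mul; case: (v z) => c d /=.
by rewrite mul0r addr0.
Qed.

Variables (D Gam : set plane).
Hypothesis mD : measurable D.
Local Notation L2 := (L2 pm D).
Local Notation dot := (dot pm D).
Local Notation sqnorm := (sqnorm pm D).
Local Notation V := (sobolev D Gam).
Local Notation mass := (mass_form D).
Local Notation grad := (grad_form D).

Lemma L2sqnormE u : measurable_fun D (re u) -> measurable_fun D (im u) ->
  L2sqnorm D u = (sqnorm (re u) + sqnorm (im u))%E.
Proof.
move=> mr mi; rewrite /sqnorm -ge0_integralD //.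
- by move=> z _; rewrite lee_fin sqr_ge0.
- exact: measurable_sqr.
- by move=> z _; rewrite lee_fin sqr_ge0.
- exact: measurable_sqr.
Qed.

Lemma in_L2P u : in_L2 D u <-> L2 (re u) /\ L2 (im u).
Proof.
split.
  move=> [mr mi]; rewrite L2sqnormE // => fin.
  have r0 : (0 <= sqnorm (re u))%E := sqnorm_ge0 _ _ _.
  have i0 : (0 <= sqnorm (im u))%E := sqnorm_ge0 _ _ _.
  split; split => //.
    by apply: le_lt_trans fin; rewrite leeDl.
  by apply: le_lt_trans fin; rewrite leeDr.
move=> [[mr fr] [mi fi]]; split => //.
by rewrite L2sqnormE // lte_add_pinfty.
Qed.

Lemma L2sqnorm_dot u : in_L2 D u ->
  L2sqnorm D u = (dot (re u) (re u) + dot (im u) (im u))%:E.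
Proof.
move=> /in_L2P[Lr Li]; rewrite L2sqnormE; [|by case: Lr|by case: Li].
by rewrite !sqnormE.
Qed.

Lemma L2norm_dot u : in_L2 D u ->
  L2norm D u = Num.sqrt (dot (re u) (re u) + dot (im u) (im u)).
Proof. by move=> Lu; rewrite /L2norm L2sqnorm_dot. Qed.

Definition re_triple (u p q : R * R -> R[i]) : E := (re u, re p, re q).
Definition im_triple (u p q : R * R -> R[i]) : E := (im u, im p, im q).

Definition cplx (f g : R * R -> R) (z : R * R) : R[i] := f z +i* g z.

Lemma C1_measurable f : C1_real f -> [/\ measurable_fun D f, measurable_fun D (dx f)
  & measurable_fun D (dy f)].
Proof.
move=> [df cx cy].
have cf : continuous f by move=> z; exact: (differentiable_continuous (df z)).
split; [exact: (measurable_funTS (plane_continuous_measurable cf))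
  | exact: (measurable_funTS (plane_continuous_measurable cx))
  | exact: (measurable_funTS (plane_continuous_measurable cy))].
Qed.

Lemma form_sum_sqnorm (U : E) : L2_triple D U ->
  (form_sum grad mass U U)%:E = (sqnorm U.1.1 + sqnorm U.1.2 + sqnorm U.2)%E.
Proof.
move=> [Lu Lp Lq]; rewrite !sqnormE // -!EFinD; congr EFin.
by rewrite /form_sum /grad_form /mass_form; ring.
Qed.

(** A C^1 function at finite form distance from an [L2_triple] is itself square integrable with its
    gradient; the integrability built into [test_gradients] is therefore automatic for
    approximants. *)
Lemma sobolev_approx f (U : E) (e : R) : L2_triple D U -> C1_real f ->
  (forall x, Gam x -> f x = 0) ->
  (sqnorm (fun z => (f z - U.1.1 z)%R) + sqnorm (fun z => (dx f z - U.1.2 z)%R)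
    + sqnorm (fun z => (dy f z - U.2 z)%R) < e%:E)%E ->
  test_gradients D Gam (gradient f) /\ form_sum grad mass (gradient f - U) (gradient f - U) < e.
Proof.
move=> [Lu Lp Lq] C1f zf lt.
have [mf mx my] := C1_measurable C1f.
have s1 := sqnorm_ge0 pm D (fun z => (f z - U.1.1 z)%R).
have s2 := sqnorm_ge0 pm D (fun z => (dx f z - U.1.2 z)%R).
have s3 := sqnorm_ge0 pm D (fun z => (dy f z - U.2 z)%R).
have Lof (g k : R * R -> R) : measurable_fun D g -> L2 k -> (sqnorm (fun z => (g z - k z)%R) < e%:E)%E -> L2 g.
  move=> mg Lk ltk; have Lgk : L2 (fun z => g z - k z).
    by split; [apply: measurable_funB => //; case: Lk|apply: lt_le_trans ltk _; exact: leey].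
  by have := L2D mD Lgk Lk; congr L2; apply/funext => z; rewrite subrK.
have [l1 l2 l3] := lte_sum3 s1 s2 s3 lt.
have Lf : L2 f := Lof _ _ mf Lu l1.
have Lx : L2 (dx f) := Lof _ _ mx Lp l2.
have Ly : L2 (dy f) := Lof _ _ my Lq l3.
have LW : L2_triple D (gradient f) := And3 Lf Lx Ly.
split; first by split; [exact: LW|exists f; split].
have LU : L2_triple D U := And3 Lu Lp Lq.
have LB : L2_triple D (gradient f - U) := subspaceB (L2_triple_subspace mD) LW LU.
by rewrite -lte_fin (form_sum_sqnorm LB); exact: lt.
Qed.

(** The squared distances are sums over real and imaginary parts, so a complex approximant yields
    two real ones, and two real ones within e/2 combine into a complex one. *)
Lemma form_domain_sobolev u p q : form_domain D Gam u p q <->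
  V (re_triple u p q) /\ V (im_triple u p q).
Proof.
split.
  move=> [/in_L2P[ur ui] /in_L2P[pr pi'] /in_L2P[qr qi] app].
  have Wr : L2_triple D (re_triple u p q) := And3 ur pr qr.
  have Wi : L2_triple D (im_triple u p q) := And3 ui pi' qi.
  have key (e : R) : 0 < e -> exists f1 f2,
    [/\ test_gradients D Gam (gradient f1), test_gradients D Gam (gradient f2),
      form_sum grad mass (gradient f1 - re_triple u p q) (gradient f1 - re_triple u p q) < e &
      form_sum grad mass (gradient f2 - im_triple u p q) (gradient f2 - im_triple u p q) < e].
    move=> /app[phi [[C1r C1i] zphi]].
    have [mr mrx mry] := C1_measurable C1r.
    have [mi mix miy] := C1_measurable C1i.
    have mre f g : measurable_fun D (re f) -> L2 (re g) -> measurable_fun D (re (fun z => f z - g z)).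
      by move=> mf Lg; rewrite reB; apply: measurable_funB => //; case: Lg.
    have mim f g : measurable_fun D (im f) -> L2 (im g) -> measurable_fun D (im (fun z => f z - g z)).
      by move=> mf Lg; rewrite imB; apply: measurable_funB => //; case: Lg.
    rewrite (L2sqnormE (mre phi u mr ur) (mim phi u mi ui)).
    rewrite (L2sqnormE (mre (partial (1, 0) phi) p mrx pr) (mim (partial (1, 0) phi) p mix pi')).
    rewrite (L2sqnormE (mre (partial (0, 1) phi) q mry qr) (mim (partial (0, 1) phi) q miy qi)).
    rewrite !reB !imB => lt.
    have n0 (f : plane -> R) : (0 <= sqnorm f)%E := sqnorm_ge0 pm D f.
    exists (re phi), (im phi).
    have [lr li] := lte_sum3_split (n0 _) (n0 _) (n0 _) (n0 _) (n0 _) (n0 _) lt.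
    have zr x : Gam x -> re phi x = 0 by move=> /zphi; rewrite /re => ->.
    have zi x : Gam x -> im phi x = 0 by move=> /zphi; rewrite /im => ->.
    have [t1 l1] := @sobolev_approx (re phi) (re_triple u p q) e Wr C1r zr lr.
    have [t2 l2] := @sobolev_approx (im phi) (im_triple u p q) e Wi C1i zi li.
    by exact: (And4 t1 t2 l1 l2).
  split; split; [exact: Wr| |exact: Wi|]; move=> e /key[f1 [f2 [t1 t2 l1 l2]]].
    by exists (gradient f1); [exact: t1|exact: l1].
  by exists (gradient f2); [exact: t2|exact: l2].
move=> [[[ur pr qr] hr] [[ui pi' qi] hi]]; split; try by apply/in_L2P.
move=> e e0; have e2 : 0 < e / 2 by rewrite divr_gt0.
have [g1 [W1 [f1 [C1f1 z1 E1]]] l1] := hr _ e2.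
have [g2 [W2 [f2 [C1f2 z2 E2]]] l2] := hi _ e2.
rewrite {}E1 in W1 l1; rewrite {}E2 in W2 l2.
have [f1u f1p f1q] : L2_triple D (gradient f1 - re_triple u p q).
  exact: (subspaceB (L2_triple_subspace mD) W1 (And3 ur pr qr)).
have [f2u f2p f2q] : L2_triple D (gradient f2 - im_triple u p q).
  exact: (subspaceB (L2_triple_subspace mD) W2 (And3 ui pi' qi)).
exists (cplx f1 f2); split.
- by split; [exact: C1f1|exact: C1f2].
- by move=> x Gx; rewrite /cplx z1 // z2.
have step (phi v : R * R -> R[i]) (a b : plane -> R) : L2 a -> L2 b ->
    re (fun z => phi z - v z) = a -> im (fun z => phi z - v z) = b ->
    L2sqnorm D (fun z => phi z - v z) = (dot a a + dot b b)%:E.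
  move=> La Lb ra ib; rewrite L2sqnorm_dot ?ra ?ib //.
  by apply/in_L2P; rewrite ra ib.
rewrite (step (cplx f1 f2) u _ _ f1u f2u (reB _ _) (imB _ _)).
rewrite (step (partial (1, 0) (cplx f1 f2)) p _ _ f1p f2p (reB _ _) (imB _ _)).
rewrite (step (partial (0, 1) (cplx f1 f2)) q _ _ f1q f2q (reB _ _) (imB _ _)).
have halves (a1 a2 a3 b1 b2 b3 : R) : a2 + a3 + a1 < e / 2 -> b2 + b3 + b1 < e / 2 ->
    a1 + b1 + (a2 + b2) + (a3 + b3) < e by lra.
by rewrite -!EFinD lte_fin; exact: halves l1 l2.
Qed.

Lemma L2innerE u v : in_L2 D u -> in_L2 D v -> L2inner D u v =
  (dot (re u) (re v) + dot (im u) (im v)) +i* (dot (im u) (re v) - dot (re u) (im v)).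
Proof.
move=> /in_L2P[ur ui] /in_L2P[vr vi]; congr (_ +i* _).
  rewrite -RintegralD //; try exact: integrableM.
  apply: eq_Rintegral => z _; rewrite /re /im; case: (u z) (v z) => a b [c d] /=; ring.
rewrite -RintegralB //; try exact: integrableM.
by apply: eq_Rintegral => z _; rewrite /re /im; case: (u z) (v z) => a b [c d] /=; ring.
Qed.

Lemma dot0r f g : g = (fun=> 0) -> dot f g = 0.
Proof. by move=> ->; rewrite /dot /Rintegral integral0_eq // => z _; rewrite mulr0. Qed.

Lemma re_cplx f g : re (cplx f g) = f. Proof. by []. Qed.
Lemma im_cplx f g : im (cplx f g) = g. Proof. by []. Qed.

(** For a real-valued test function the real and imaginary parts of the complex identity are exactly
    the two real equations. *)
Lemma mixed_laplacian_re_im u f : mixed_laplacian D Gam u f ->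
  in_L2 D f /\ exists p q, [/\ V (re_triple u p q), V (im_triple u p q),
    forall X, V X -> grad (re_triple u p q) X = dot (re f) X.1.1 &
    forall X, V X -> grad (im_triple u p q) X = dot (im f) X.1.1].
Proof.
move=> [Lf [p [q [dom eqn]]]]; split => //; exists p, q.
have [Vr Vi] := (form_domain_sobolev u p q).1 dom.
have [_ Lp Lq _] := dom.
have key X : V X -> grad (re_triple u p q) X = dot (re f) X.1.1 /\
    grad (im_triple u p q) X = dot (im f) X.1.1.
  move=> VX; have [LX1 LX2 LX3] := sobolev_L2 VX.
  pose z0 : R * R -> R := fun=> 0.
  have V0 : V (z0, z0, z0) by have [h _ _] := sobolev_subspace Gam mD; exact: h.
  have L0 : L2 z0 := L2_0 pm D.
  have domX : form_domain D Gam (cplx X.1.1 z0) (cplx X.1.2 z0) (cplx X.2 z0).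
    apply/form_domain_sobolev; split; last exact: V0.
    by move: VX; case: (X) => [[? ?] ?].
  have inL2 g : L2 g -> in_L2 D (cplx g z0) by move=> Lg; apply/in_L2P.
  have := eqn _ _ _ domX.
  rewrite (L2innerE Lp (inL2 _ LX2)) (L2innerE Lq (inL2 _ LX3)) (L2innerE Lf (inL2 _ LX1)).
  rewrite !re_cplx !im_cplx !(@dot0r _ z0) // => -[h1 h2].
  by move: h1 h2; rewrite !addr0 !subr0 /grad_form /= => -> ->.
by split => // X VX; case: (key X VX).
Qed.

Lemma mixed_laplacian_cplx (U1 U2 : E) f : in_L2 D f -> V U1 -> V U2 ->
  (forall X, V X -> grad U1 X = dot (re f) X.1.1) ->
  (forall X, V X -> grad U2 X = dot (im f) X.1.1) ->
  mixed_laplacian D Gam (cplx U1.1.1 U2.1.1) f.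
Proof.
move=> Lf V1 V2 h1 h2; split => //.
exists (cplx U1.1.2 U2.1.2), (cplx U1.2 U2.2).
have [L11 L12 L13] := sobolev_L2 V1; have [L21 L22 L23] := sobolev_L2 V2.
have Lp : in_L2 D (cplx U1.1.2 U2.1.2) by apply/in_L2P.
have Lq : in_L2 D (cplx U1.2 U2.2) by apply/in_L2P.
split.
  apply/form_domain_sobolev; split.
    by move: V1; case: (U1) => [[? ?] ?].
  by move: V2; case: (U2) => [[? ?] ?].
move=> v r s dom; have [Vr Vi] := (form_domain_sobolev v r s).1 dom.
have [Lv Lr Ls _] := dom.
rewrite (L2innerE Lp Lr) (L2innerE Lq Ls) (L2innerE Lf Lv) !re_cplx !im_cplx.
have := h1 _ Vr; have := h1 _ Vi; have := h2 _ Vr; have := h2 _ Vi.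
rewrite /grad_form /= => <- <- <- <-.
by rewrite -[LHS]/(_ +i* _); congr (_ +i* _); ring.
Qed.

End ComplexValued.

(** * Spectral bound and resolvent of the mixed Laplacian *)

Section Resolvent.
Local Open Scope complex_scope.
Variable R : realType.
Local Notation plane := (measurableTypeR R * measurableTypeR R)%type.
Local Notation pm := (plane_measure R).
Local Notation E := ((R * R -> R) * (R * R -> R) * (R * R -> R))%type.

Variables (D Gam : set plane).
Hypothesis mD : measurable D.
Local Notation L2 := (L2 pm D).
Local Notation dot := (dot pm D).
Local Notation V := (sobolev D Gam).
Local Notation mass := (mass_form D).
Local Notation grad := (grad_form D).
Local Notation H := (mixed_laplacian D Gam).

Lemma eigenvalue_of_form lam (U : E) : V U -> 0 < mass U U ->
  (forall X, V X -> grad U X = lam * mass U X) -> Defs.eigenvalue D H lam.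
Proof.
move=> VU mU hU.
pose z0 : R * R -> R := fun=> 0.
have V0 : V (z0, z0, z0) by have [h _ _] := sobolev_subspace Gam mD; exact: h.
have L0 : L2 z0 := L2_0 pm D.
have [LU _ _] := sobolev_L2 VU.
have Lu : in_L2 D (cplx U.1.1 z0) by apply/in_L2P.
exists (cplx U.1.1 z0); split.
  rewrite (L2sqnorm_dot mD Lu) re_cplx im_cplx (@dot0r _ _ _ z0) // addr0.
  by rewrite eqe gt_eqF.
have rf : re (fun x => lam%:C * cplx U.1.1 z0 x) = (fun z => lam * U.1.1 z) by rewrite reZ.
have imf : im (fun x => lam%:C * cplx U.1.1 z0 x) = z0.
  by rewrite imZ; apply/funext => z; rewrite im_cplx mulr0.
apply: (mixed_laplacian_cplx mD _ VU V0).
- by apply/in_L2P => //; rewrite rf imf; split => //; exact: L2Z.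
- move=> X VX; rewrite hU // rf; have [LX _ _] := sobolev_L2 VX.
  by rewrite (dotZl mD lam LU LX).
- move=> X VX; rewrite imf /grad_form /= dotC [X in _ + X]dotC [RHS]dotC.
  by rewrite !(@dot0r _ _ _ z0) // addr0.
Qed.

Lemma grad_ge_of_eigenvalues (ls : R) : relatively_compact V grad mass ->
  (forall lam, Defs.eigenvalue D H lam -> ls <= lam) ->
  forall U, V U -> ls * mass U U <= grad U U.
Proof.
move=> comp hls U VU.
apply: (lowest_eigenvalue_le_form (sobolev_subspace Gam mD) (sobolev_grad_psd Gam mD)
  (sobolev_mass_psd Gam mD) (@sobolev_complete _ _ Gam mD) comp _ VU) => lam X VX mX hX.
by apply: hls; exact: eigenvalue_of_form VX mX hX.
Qed.

Variables (ls lam : R).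
Hypothesis grad_ge : forall U, V U -> ls * mass U U <= grad U U.
Hypothesis lam_lt : lam < ls.
Let delta := ls - lam.
Let delta0 : 0 < delta. Proof. by rewrite subr_gt0. Qed.

Lemma resolvent_weak f u : resolvent H lam f u -> in_L2 D f /\ exists p q,
  weak_solution D Gam lam (re f) (re_triple u p q) /\
  weak_solution D Gam lam (im f) (im_triple u p q).
Proof.
move=> /(mixed_laplacian_re_im mD)[/(in_L2P mD)[]].
rewrite reDZ imDZ => Lr Li [p [q [Vr Vi hr hi]]].
have [Lur _ _] := sobolev_L2 Vr; have [Lui _ _] := sobolev_L2 Vi.
have cancelL (g v : R * R -> R) : L2 v -> L2 (fun z => g z + lam * v z) -> L2 g.
  move=> Lv Lgv; have := L2B mD Lgv (L2Z mD lam Lv); congr L2.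
  by apply/funext => z; rewrite addrK.
have Lfr : L2 (re f) := cancelL _ _ Lur Lr.
have Lfi : L2 (im f) := cancelL _ _ Lui Li.
split; first by apply/in_L2P.
have weak (U : E) g : V U -> L2 g ->
    (forall X, V X -> grad U X = dot (fun z => g z + lam * U.1.1 z) X.1.1) ->
    weak_solution D Gam lam g U.
  move=> VU Lg h; split => // X VX; have [LX _ _] := sobolev_L2 VX.
  have [LU _ _] := sobolev_L2 VU.
  rewrite /shifted_form h // (dotDl mD Lg (L2Z mD lam LU) LX) (dotZl mD lam LU LX).
  by rewrite addrK.
by exists p, q; split; apply: weak.
Qed.

Lemma weak_resolvent f (U1 U2 : E) : in_L2 D f ->
  weak_solution D Gam lam (re f) U1 -> weak_solution D Gam lam (im f) U2 ->
  resolvent H lam f (cplx U1.1.1 U2.1.1).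
Proof.
move=> /(in_L2P mD)[Lr Li] [V1 h1] [V2 h2].
have [L1 _ _] := sobolev_L2 V1; have [L2' _ _] := sobolev_L2 V2.
apply: (mixed_laplacian_cplx mD _ V1 V2).
- by apply/in_L2P => //; rewrite reDZ imDZ; split; apply: L2D => //; exact: L2Z.
- move=> X VX; have [LX _ _] := sobolev_L2 VX; rewrite reDZ.
  rewrite (dotDl mD Lr (L2Z mD lam L1) LX) (dotZl mD lam L1 LX) -h1 // /shifted_form.
  by rewrite subrK.
- move=> X VX; have [LX _ _] := sobolev_L2 VX; rewrite imDZ.
  rewrite (dotDl mD Li (L2Z mD lam L2') LX) (dotZl mD lam L2' LX) -h2 // /shifted_form.
  by rewrite subrK.
Qed.

Lemma sqrt_sum_le (a b a' b' k : R) : 0 <= k -> k ^+ 2 * a <= a' -> k ^+ 2 * b <= b' ->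
  k * Num.sqrt (a + b) <= Num.sqrt (a' + b').
Proof.
move=> k0 ha hb; rewrite -{1}(ger0_norm k0) -sqrtr_sqr -sqrtrM ?sqr_ge0 //.
by apply: ler_wsqrtr; rewrite mulrDr lerD.
Qed.

Lemma resolvent_bound f u : resolvent H lam f u -> in_L2 D u /\ delta * L2norm D u <= L2norm D f.
Proof.
move=> /resolvent_weak[Lf [p [q [w1 w2]]]].
have [Lr Li] := (in_L2P mD f).1 Lf.
have [L1 _ _] := sobolev_L2 w1.1; have [L2' _ _] := sobolev_L2 w2.1.
have Lu : in_L2 D u by apply/in_L2P.
split => //; rewrite !(L2norm_dot mD) //; apply: sqrt_sum_le; first exact: ltW.
  exact: (weak_solution_bound mD grad_ge lam_lt Lr w1).
exact: (weak_solution_bound mD grad_ge lam_lt Li w2).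
Qed.

Lemma below_form_in_resolvent_set : in_resolvent_set D H lam.
Proof.
exists delta^-1; first by rewrite invr_ge0 ltW.
move=> f Lf; have [Lr Li] := (in_L2P mD f).1 Lf.
have [U1 w1] := weak_solution_exists mD grad_ge lam_lt Lr.
have [U2 w2] := weak_solution_exists mD grad_ge lam_lt Li.
have res := weak_resolvent Lf w1 w2.
have [Lu bu] := resolvent_bound res.
exists (cplx U1.1.1 U2.1.1); split => //.
- move=> u' res'; have [Lu' _] := resolvent_bound res'.
  have [_ [p [q [w1' w2']]]] := resolvent_weak res'.
  have [r1 r2] := (in_L2P mD _).1 Lu; have [r1' r2'] := (in_L2P mD _).1 Lu'.
  have LB : in_L2 D (fun x => u' x - cplx U1.1.1 U2.1.1 x).
    by apply/in_L2P => //; rewrite reB imB; split; exact: L2B.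
  rewrite (L2sqnorm_dot mD LB) reB imB re_cplx im_cplx.
  have e1 := weak_solution_unique mD grad_ge lam_lt w1 w1'.
  have e2 := weak_solution_unique mD grad_ge lam_lt w2 w2'.
  by rewrite [X in (X + _)%:E]e1 [X in (_ + X)%:E]e2 addr0.
- by rewrite mulrC ler_pdivlMr // mulrC.
Qed.

(** No measurability of [B] is assumed. That the cut function lies in L^2 is part of the resolvent
    relation in which it occurs. *)
Lemma L2norm_indicator_le (B : set plane) f : in_L2 D f -> in_L2 D (indicator_mul B f) ->
  L2norm D (indicator_mul B f) <= L2norm D f.
Proof.
move=> Lf LBf; have [Lr Li] := (in_L2P mD f).1 Lf.
have [] := (in_L2P mD _).1 LBf; rewrite re_indicator im_indicator => LBr LBi.
rewrite !(L2norm_dot mD) // re_indicator im_indicator; apply: ler_wsqrtr.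
have ind (g : R * R -> R) z : D z -> (\1_B z * g z) ^+ 2 <= 1 * g z ^+ 2.
  move=> _; rewrite mul1r indicE; case: (z \in B); rewrite ?mul1r // mul0r expr0n /=.
  exact: sqr_ge0.
have := dot_le mD ler01 LBr Lr (ind (re f)); have := dot_le mD ler01 LBi Li (ind (im f)).
by rewrite !mul1r => *; exact: lerD.
Qed.

Lemma eq_L2norm u v : {in D, u =1 v} -> L2norm D u = L2norm D v.
Proof.
by move=> uv; rewrite /L2norm /L2sqnorm; congr (Num.sqrt (fine _)); apply: eq_integral => z zD; rewrite uv.
Qed.

(** The bound without decay, for sets with no horizontal gap. [A'] is a measurable set that agrees
    with [A] inside [D]. *)
Lemma cut_resolvent_bound (A A' B : set plane) f v : measurable A' ->
  (forall z, D z -> A z <-> A' z) -> in_L2 D f -> cut_resolvent H lam A B f v ->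
  delta * L2norm D v <= L2norm D f.
Proof.
move=> mA' AA' Lf [u res ->].
have [Lu bu] := resolvent_bound res.
have [LBf _] := resolvent_weak res.
apply: le_trans (L2norm_indicator_le Lf LBf); apply: le_trans bu.
apply: ler_wpM2l; first exact: ltW.
rewrite (@eq_L2norm _ (indicator_mul A' u)).
  apply: L2norm_indicator_le => //; apply/in_L2P => //.
  have [Lr Li] := (in_L2P mD _).1 Lu; rewrite re_indicator im_indicator.
  by split; exact: L2_indic.
move=> z; rewrite inE => Dz; rewrite /indicator_mul !indicE.
suff -> : (z \in A) = (z \in A') by [].
by apply/idP/idP; rewrite !inE => /AA'; apply.
Qed.

Variable L : R.
Hypothesis DL : forall z, D z -> 0 < z.1 < L.

Lemma cut_resolvent_decay (A A' B : set plane) (c s t : R) f v : measurable A' ->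
  (forall z, D z -> A z <-> A' z) -> (forall z, D z -> A' z -> z.1 <= c - t) ->
  (forall z, D z -> z.1 < c -> ~ B z) -> 0 <= s -> 0 < t -> s ^+ 2 < delta ->
  in_L2 D f -> cut_resolvent H lam A B f v ->
  2 * (delta - s ^+ 2) * expR (s * t) * L2norm D v <= L2norm D f.
Proof.
move=> mA' AA' Ac Bc s0 t0 sd Lf [u res ->].
have [Lu bu] := resolvent_bound res.
have [LBf [p [q [w1 w2]]]] := resolvent_weak res.
apply: le_trans (L2norm_indicator_le Lf LBf).
have [Lr Li] := (in_L2P mD _).1 Lu.
have [Lfr Lfi] := (in_L2P mD _).1 LBf.
have LAu : in_L2 D (indicator_mul A' u).
  apply/in_L2P => //; rewrite re_indicator im_indicator.
  by split; exact: L2_indic.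
rewrite (@eq_L2norm _ (indicator_mul A' u)); last first.
  move=> z; rewrite inE => Dz; rewrite /indicator_mul !indicE.
  suff -> : (z \in A) = (z \in A') by [].
  by apply/idP/idP; rewrite !inE => /AA'; apply.
have d0 : 0 < delta - s ^+ 2 by rewrite subr_gt0.
have kE : (2 * (delta - s ^+ 2) * expR (s * t)) ^+ 2 =
    4 * (ls - lam - s ^+ 2) ^+ 2 * expR (2 * (s * t)).
  rewrite (_ : 2 * (s * t) = s * t + s * t); last by ring.
  by rewrite expRD /delta; ring.
have zB z : D z -> z.1 < c -> \1_B z = 0 :> R.
  move=> Dz zc; rewrite indicE; case: (boolP (z \in B)) => //.
  by rewrite inE => /(Bc z Dz zc).
rewrite !(L2norm_dot mD) //; apply: sqrt_sum_le.
- by rewrite !mulr_ge0 ?expR_ge0 // ltW.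
- rewrite kE re_indicator.
  apply: (combes_thomas mD DL grad_ge s0 t0 sd Lfr w1 _ mA' Ac).
  by move=> z Dz zc; rewrite re_indicator zB // mul0r.
- rewrite kE im_indicator.
  apply: (combes_thomas mD DL grad_ge s0 t0 sd Lfi w2 _ mA' Ac).
  by move=> z Dz zc; rewrite im_indicator zB // mul0r.
Qed.

End Resolvent.

(** * The random waveguide *)

Section Profile.
Variables (R : realType) (l : R) (g : R -> R).
Hypothesis hl : 1 <= l.
Hypothesis hg : C2_compact_support l g.
Hypothesis hg1 : normalized_profile l g.

Let l0 : 0 < l. Proof. exact: lt_le_trans ltr01 hl. Qed.

Lemma profile_support x : g x != 0 -> 0 < x < l.
Proof.
move=> gx; have [_ _ _ sub] := hg.
by have := sub x (@subset_closure _ [set x | g x != 0] x gx); rewrite /= in_itv.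
Qed.

Lemma profile_is_derive (x : R) : is_derive x (1 : R) g (derive1 g x).
Proof. by have [dg _ _ _] := hg; rewrite derive1E; exact: derivableP. Qed.

Lemma profile_derive_continuous : continuous (derive1 g).
Proof.
by have [_ dg _ _] := hg => x; exact/differentiable_continuous/derivable1_diffP.
Qed.

Lemma profile_le1 x : `|g x| <= 1.
Proof.
have cg : continuous (fun x => `|g x|).
  move=> y; apply: cvg_norm; apply/differentiable_continuous/derivable1_diffP.
  by case: hg.
have [->|gx] := eqVneq (g x) 0; first by rewrite normr0.
have [c _ hc] := EVT_max (ltW l0) (continuous_subspaceT cg).
have <- := hg1; rewrite !le_max; apply/orP; left; apply/orP; left.
apply: ub_le_sup.
  by exists `|g c| => _ [y /= yl <-]; exact: hc.
exists x => //=; rewrite in_itv /=.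
by have /andP[x0 xl] := profile_support gx; rewrite !ltW.
Qed.

Variable w : Omega R.
Local Notation term x := (fun k : int => (w k)%:num * g (x - k%:~R * l)).

(** The k-th bump is supported strictly between k l and (k + 1) l, so bumps do not overlap. *)
Lemma term_unique x (i j : int) : term x i != 0 -> term x j != 0 -> i = j.
Proof.
rewrite !mulf_eq0 !negb_or => /andP[_ /profile_support /andP[i0 il]].
move=> /andP[_ /profile_support /andP[j0 jl]].
have lt (a b : int) : a%:~R * l < x -> x < b%:~R * l + l -> a <= b.
  move=> ax xb; have : a%:~R * l < (b + 1)%:~R * l by rewrite rmorphD /= mulrDl mul1r; lra.
  by rewrite ltr_pM2r // ltr_int ltzD1.
by apply/eqP; rewrite eq_le; apply/andP; split; apply: lt; lra.
Qed.

Lemma randomG_term x : exists k : int, randomG l g w x = term x k.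
Proof.
have [[k nk]|none] := pselect (exists k, term x k != 0).
  exists k; rewrite /randomG -(fsbig_widen [set k]) ?fsbig_set1 // => i [_ /= ik].
  by apply/eqP; apply: contra_notT ik => ti; exact: term_unique ti nk.
exists 0; rewrite /randomG fsbig1.
  by apply/esym/eqP; apply: contra_notT none => h; exists 0.
by move=> i _; apply/eqP; apply: contra_notT none => h; exists i.
Qed.

Lemma randomG_le1 x : (forall k, (w k)%:num <= 1) -> `|randomG l g w x| <= 1.
Proof.
move=> w1; have [k ->] := randomG_term x; rewrite normrM ger0_norm //.
by rewrite -[leRHS]mul1r; apply: ler_pM => //; exact: profile_le1.
Qed.

(* The bumps that meet [0 < x < N l]; unlike [randomG] this is a sum of fixed
   length, hence obviously C^1. *)
Definition partial_profile (kappa : R) (N : nat) (x : R) : R :=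
  \sum_(k < N) (kappa * (w k%:Z)%:num) * g (x - k%:Z%:~R * l).

Definition partial_slope (kappa : R) (N : nat) (x : R) : R :=
  \sum_(k < N) (kappa * (w k%:Z)%:num) * derive1 g (x - k%:Z%:~R * l).

Lemma partial_profileE kappa N x : 0 < x < N%:R * l ->
  partial_profile kappa N x = kappa * randomG l g w x.
Proof.
move=> /andP[x0 xN].
(* A nonzero bump at [x] requires i l < x < (i + 1) l; together with 0 < x < N l this leaves -1 < i
   < N. *)
rewrite /randomG -(fsbig_widen [set Posz k | k in `I_N]) //; last first.
  move=> i [_ /= ni]; apply/eqP; apply: contra_notT ni.
  rewrite mulf_eq0 negb_or => /andP[_ /profile_support /andP[i0 il]].
  have iN : i < N%:Z by rewrite -(ltr_int R) -(ltr_pM2r l0); lra.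
  have i1 : - 1 < i.
    by rewrite -(ltr_int R) -(ltr_pM2r l0) rmorphN /=; lra.
  case: i i0 il iN i1 => [k|k] _ _ kN // _; exists k => //.
rewrite (reindex_fsbig Posz `I_N); last first.
  by apply: inj_bij => i j _ _ [].
rewrite -fsbig_ord mulr_sumr; apply: eq_bigr => k _.
by rewrite mulrA.
Qed.

Lemma partial_profile_is_derive kappa N (x : R) :
  is_derive x (1 : R) (partial_profile kappa N) (partial_slope kappa N x).
Proof.
have -> : partial_profile kappa N =
    \sum_(k < N) (fun x => (kappa * (w k%:Z)%:num) * g (x - k%:Z%:~R * l)).
  by apply/funext => y; rewrite fct_sumE.
apply: is_derive_sum => k.
have d1 : is_derive x (1 : R) (fun x => x - k%:Z%:~R * l) 1.
  have := @is_deriveB _ _ _ id (cst (k%:Z%:~R * l)) x 1 1 0 (is_derive_id _ _) (is_derive_cst _ _ _).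
  by rewrite subr0.
have := @is_derive1_comp _ g (fun x => x - k%:Z%:~R * l) x _ _ (profile_is_derive _) d1.
rewrite mulr1 => d2.
exact: (@is_deriveZ _ _ _ _ (kappa * (w k%:Z)%:num) x 1 _ d2).
Qed.

Lemma partial_slope_continuous kappa N : continuous (partial_slope kappa N).
Proof.
elim: N => [|N IH].
  rewrite (_ : partial_slope kappa 0 = fun=> 0); first exact: cst_continuous.
  by apply/funext => x; rewrite /partial_slope big_ord0.
rewrite (_ : partial_slope kappa N.+1 = fun x => partial_slope kappa N x +
    (kappa * (w N%:Z)%:num) * derive1 g (x - N%:Z%:~R * l)); last first.
  by apply/funext => x; rewrite /partial_slope big_ord_recr.
apply: continuous_add => //; apply: continuous_mul; first exact: cst_continuous.
move=> x; apply: (@continuous_comp _ _ _ (fun x => x - N%:Z%:~R * l) (derive1 g)).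
  by apply: cvgB; [exact: cvg_id|exact: cvg_cst].
exact: profile_derive_continuous.
Qed.

Lemma waveguideE kappa N :
  waveguide kappa l g w N = curved_strip (partial_profile kappa N) (N%:R * l).
Proof.
apply/seteqP; split => -[x y]; rewrite /waveguide /strip /curved_strip /curved_cell /= !in_itv /=.
  move=> [xN /andP[h1 h2]]; split => //; rewrite partial_profileE //.
  by apply/andP; split; lra.
move=> [xN]; rewrite partial_profileE // => /andP[h1 h2]; split => //.
by apply/andP; split; lra.
Qed.

(* Since [|kappa G| <= 1] and [pi > 2], any two cross sections meet a common
   horizontal line. *)
Lemma strip_distance_le kappa alpha beta L : 0 <= kappa <= 1 -> 0 <= L ->
  0 <= alpha -> 0 <= beta -> (forall k, (w k)%:num <= 1) ->
  euclidean_dist (strip kappa l g w `[0, alpha]) (strip kappa l g w `[L - beta, L])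
    <= Num.max (L - beta - alpha) 0.
Proof.
move=> /andP[k0 k1] L0 a0 b0 w1.
(* If pi were 2, the zero of the cosine at pi/2 would contradict cos 1 > 0. Strictness is needed
   because cross sections are open and shift by up to 2. *)
have pi2 : 2 < pi :> R.
  rewrite lt_def pi_ge2 andbT; apply/eqP => pi2.
  have := cos_pihalf R; rewrite pi2 divff // => c1.
  by have := cos1_gt0 R; rewrite c1 ltxx.
have G1 x : - 1 <= kappa * randomG l g w x <= 1.
  rewrite -ler_norml normrM (ger0_norm k0) -[leRHS]mul1r.
  by apply: ler_pM => //; exact: randomG_le1.
have pt (x1 x2 : R) : 0 <= x1 <= alpha -> L - beta <= x2 <= L ->
    euclidean_dist (strip kappa l g w `[0, alpha]) (strip kappa l g w `[L - beta, L])
    <= `|x1 - x2|.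
  (* [y] is the mean of the midheights of the two cross sections; it lies in both because their
     offsets differ by at most 2 < pi. *)
  move=> hx1 hx2; pose y := (kappa * randomG l g w x1 + kappa * randomG l g w x2 + pi) / 2.
  have /andP[p1 p2] := G1 x1; have /andP[q1 q2] := G1 x2.
  apply: ge_inf.
    by exists 0 => _ [u _ [v _ <-]]; exact: sqrtr_ge0.
  exists (x1, y).
    split; first by rewrite /= in_itv.
    by rewrite /= /y; apply/andP; split; lra.
  exists (x2, y).
    split; first by rewrite /= in_itv.
    by rewrite /= /y; apply/andP; split; lra.
  by rewrite /= subrr expr0n addr0 sqrtr_sqr.
(* Without a gap both strips contain the cross section at the larger of 0 and L - beta; otherwise
   the facing ends are joined. *)
case: (leP (L - beta - alpha) 0) => h.
  have := pt (Num.max 0 (L - beta)) (Num.max 0 (L - beta)).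
  rewrite subrr normr0; apply; apply/andP; split.
  - by rewrite le_max lexx.
  - by rewrite ge_max a0; lra.
  - by rewrite le_max lexx orbT.
  - by rewrite ge_max L0; lra.
have := pt alpha (L - beta); rewrite ler0_norm; last by lra.
by rewrite (_ : - (alpha - (L - beta)) = L - beta - alpha); [apply; lra|ring].
Qed.

End Profile.

(** * Null sets, and inner and outer probability *)

Section Probability.
Variables (R : realType) (mu : probability (measurableTypeR R) R).
Variables (P : probability (Omega R) R).

Lemma coordinates_le1_ae : is_product_measure mu P -> mu `[0, 1]%classic = 1%E ->
  P.-negligible [set w : Omega R | ~ forall k, (w k)%:num <= 1].
Proof.
move=> hP mu1.
have one (k : int) : P.-negligible [set w : Omega R | ~ (w k)%:num <= 1].
  pose X : set R := `[0, 1]%classic.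
  have mE : measurable ([set w | X (w k)%:num] : set (Omega R)).
    by apply: sub_sigma_algebra; exists k, X; split => //; exact: measurable_itv.
  have PE : P [set w : Omega R | X (w k)%:num] = 1%E.
    have := hP [:: k] (fun=> X) isT (fun=> measurable_itv `[0, 1]).
    rewrite big_seq1 mu1 => <-; congr (P _); apply/seteqP; split => w /=.
      by move=> Xw j; rewrite inE => /eqP ->.
    by apply; rewrite inE.
  exists (~` [set w : Omega R | X (w k)%:num]); split.
  - exact: measurableC.
  - by have := probability_setC P mE; rewrite PE subee.
  - by move=> w /= h Xw; apply: h; move: Xw; rewrite /X /= in_itv /= => /andP[].
apply: (@negligibleS _ _ _ P (\bigcup_n ([set w : Omega R | ~ (w (Posz n))%:num <= 1] `|`
    [set w : Omega R | ~ (w (Negz n))%:num <= 1]))).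
  move=> w /= /existsNP[[n|n] hk]; exists n => //; [by left|by right].
by apply: negligible_bigcup => n; apply: negligibleU; exact: one.
Qed.

(** Neither event need be measurable: a nearly optimal measurable cover of [bad], enlarged by a null
    set containing [Z], has a measurable complement inside [good]. *)
Lemma inner_prob_ge (bad good : set (Omega R)) (p : R) (Z : set (Omega R)) :
  P.-negligible Z -> (outer_prob P bad <= p%:E)%E ->
  (forall w, ~ bad w -> ~ Z w -> good w) ->
  ((1 - p)%:E <= inner_prob P good)%E.
Proof.
move=> [N [mN N0 ZN]] outer h; apply/lee_subgt0Pr => e e0.
have [_ [F [mF badF] <-] PF] : exists2 y, [set P F | F in [set F | measurable F /\ bad `<=` F]] y
    & (y < (p + e)%:E)%E.
  by apply: ereal_inf_lt; apply: (le_lt_trans outer); rewrite lte_fin ltrDl.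
have mFN : measurable (F `|` N) by exact: measurableU.
have PFN : (P (F `|` N) <= (p + e)%:E)%E.
  apply: (le_trans (measureU2 _ mF mN)); rewrite [X in (_ + X)%E]N0 adde0.
  exact: ltW.
apply: (@le_trans _ _ (P (~` (F `|` N)))).
  rewrite probability_setC // -EFinB.
  have : P (F `|` N) \is a fin_num by exact: fin_num_measure.
  move: PFN; case: (P _) => [x| |] //; rewrite -EFinB !lee_fin => xp _.
  by lra.
apply: ereal_sup_ubound; exists (~` (F `|` N)) => //; split; first exact: measurableC.
move=> w /= nFN; apply: h => [/badF Fw|/ZN Nw]; apply: nFN; [by left|by right].
Qed.

End Probability.

(** * Resolvent decay for the random waveguide *)

Lemma lowest_eigenvalue_le (R : realType) (D : set (R * R)) (H : graph R) :
  lowest_eigenvalue D H != 0 ->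
  forall lam, Defs.eigenvalue D H lam -> lowest_eigenvalue D H <= lam.
Proof.
rewrite /lowest_eigenvalue; case: xgetP => [x -> [_ hx] _|_]; first exact: hx.
by rewrite eqxx.
Qed.

Theorem corollary3p3 (R : realType)
  (l : R) (hl : 1 <= l)
  (g : R -> R) (hg : C2_compact_support l g) (hg1 : normalized_profile l g)
  (mu : probability (measurableTypeR R) R)
  (mu_supp : mu `[0, 1]%classic = 1%E) (mu_nontrivial : mu [set 0] != 1%E)
  (P : probability (Omega R) R) (hP : is_product_measure mu P)
  (gamma : R) (hgamma : 34 < gamma)
  (N1 : nat) (c4 : R) (hc4 : 0 < c4)
  (hN1 : forall N : nat, (0 < N)%N -> (N1 <= N)%N ->
     kappa_interval P l g gamma N !=set0 /\
     forall kappa : R, kappa_interval P l g gamma N kappa ->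
       (outer_prob P
          [set w | (waveguide_lowest kappa l g w N - 1
                    <= N%:R `^ (- 2^-1))%R]
        <= (N%:R `^ (1 - gamma^-1) * expR (- c4 * N%:R `^ (gamma^-1)))%:E)%E)
  (N : nat) (hN0 : (0 < N)%N) (hN : (N1 <= N)%N)
  (kappa : R) (hkappa : kappa_interval P l g gamma N kappa)
  (hkappa1 : 0 <= kappa <= 1)
  (alpha beta : R) (halpha : 2 <= alpha) (hbeta : 2 <= beta) :
  let L := N%:R * l in
  let D := fun w : Omega R => waveguide kappa l g w N in
  let H := fun w : Omega R => waveguide_laplacian kappa l g w N in
  let A := fun w : Omega R => strip kappa l g w `[0, alpha] in
  let B := fun w : Omega R => strip kappa l g w `[L - beta, L] in
  (forall w, (plane_measure R).-negligible (A w `\` D w) /\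
             (plane_measure R).-negligible (B w `\` D w)) ->
  ((1 - N%:R `^ (1 - gamma^-1) * expR (- c4 * N%:R `^ (gamma^-1)))%:E
   <= inner_prob P
        [set w | forall lam : R,
           (1 <= lam <= 1 + (2 * Num.sqrt N%:R)^-1)%R ->
           in_resolvent_set (D w) (H w) lam /\
           operator_norm (D w) (cut_resolvent (H w) lam (A w) (B w))
           <= (2 * Num.sqrt N%:R *
               expR (- euclidean_dist (A w) (B w)
                       / (48 * Num.sqrt N%:R)))%:E])%E.
Proof.
move=> L D H A B _.
have [_ /(_ _ hkappa) outer] := hN1 N hN0 hN.
apply: (inner_prob_ge (coordinates_le1_ae hP mu_supp) outer) => w /= good /contrapT w1 lam /andP[_ lam_le].
pose r : R := Num.sqrt N%:R.
have r1 : 1 <= r by rewrite -sqrtr1 ler_wsqrtr // ler1n.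
have r0 : 0 < r by lra.
have sqrtN : N%:R `^ (- 2^-1) = r^-1 by rewrite powRN powR12_sqrt.
pose ls := 1 + r^-1.
have l0 : 0 < l by lra.
have L0 : 0 < L by rewrite mulr_gt0 // ltr0n.
have low : ls < waveguide_lowest kappa l g w N.
  by move/negP: good; rewrite -ltNge sqrtN /ls; lra.
have ev lam' : Defs.eigenvalue (D w) (H w) lam' -> ls <= lam'.
  move=> hlam; apply: le_trans (ltW low) _; apply: lowest_eigenvalue_le => //.
  rewrite gt_eqF //; apply: lt_trans low.
  by rewrite addr_gt0 // invr_gt0.
pose h := partial_profile l g w kappa N.
have hdh := partial_profile_is_derive hg w kappa N.
have cdh : continuous (partial_slope l g w kappa N) by exact: partial_slope_continuous.
have DE : D w = curved_strip h L := waveguideE hl hg w kappa N.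
pose Gam := waveguide_walls kappa l g w N.
have mD : measurable (D w : set (measurableTypeR R * measurableTypeR R)).
  by rewrite DE; exact: (curved_strip_measurable L hdh).
have comp : relatively_compact (sobolev (D w) Gam) (grad_form (D w)) (mass_form (D w)).
  by rewrite DE; exact: (strip_relatively_compact Gam hdh cdh L0).
have grad_ge := grad_ge_of_eigenvalues mD comp ev.
(* The worst gap: [ls] is 1 + 1/r and [lam] at most 1 + 1/(2r). *)
pose d0 := (2 * r)^-1.
have d00 : 0 < d0 by rewrite invr_gt0; lra.
have d0r : d0 * (2 * r) = 1 by rewrite mulVf // gt_eqF //; lra.
have r_inv : r^-1 = 2 * d0 by rewrite /d0 invfM mulrA divff ?mul1r.
have gap : d0 <= ls - lam by rewrite /ls r_inv; move: lam_le; rewrite -/r -/d0; lra.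
have lam_lt : lam < ls by rewrite -subr_gt0; apply: lt_le_trans gap.
split; first exact: (below_form_in_resolvent_set mD grad_ge lam_lt).
apply: ge_ereal_sup => _ [v [f [Lf f1 Tv]] <-]; rewrite lee_fin -/r.
pose t := L - beta - alpha.
(* A half-plane: inside [D] the walls and the condition 0 <= z.1 in [A] hold anyway. *)
pose A' : set (measurableTypeR R * measurableTypeR R) := fst @^-1` `]-oo, alpha]%classic.
have mA' : measurable A'.
  have := @measurable_fst _ _ (measurableTypeR R) (measurableTypeR R) measurableT
    _ (measurable_itv `]-oo, alpha]).
  by rewrite setTI.
have AA' z : D w z -> A w z <-> A' z.
  move=> [z1 z2]; rewrite /A /strip /A' /= !in_itv /=; move: z1; rewrite /= in_itv /= => /andP[z1 _].
  by split => [[/andP[]]//|za]; split => //; rewrite (ltW z1).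
have dist_le : euclidean_dist (A w) (B w) <= Num.max t 0.
  by apply: strip_distance_le => //; lra.
have v0 : 0 <= L2norm (D w) v by exact: sqrtr_ge0.
move: (euclidean_dist (A w) (B w)) dist_le => dist dist_le.
(* If there is no gap, the distance is at most 0, the exponential factor is at least 1 and the plain
   resolvent bound suffices. *)
case: (leP t 0) dist_le => [t0|t0] dist_le.
  have E1 : 1 <= expR (- dist / (48 * r)).
    by rewrite -expR0 ler_expR; apply: divr_ge0; [rewrite oppr_ge0|rewrite mulr_ge0 // ltW].
  have b1 := cut_resolvent_bound mD grad_ge lam_lt mA' AA' Lf Tv.
  have b2 : d0 * L2norm (D w) v <= 1.
    by apply: le_trans f1; apply: le_trans b1; rewrite ler_wpM2r.
  apply: (@le_trans _ _ (2 * r)); last by rewrite ler_peMr //; lra.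
  have -> : L2norm (D w) v = 2 * r * (d0 * L2norm (D w) v).
    by rewrite mulrA [2 * r * d0]mulrC d0r mul1r.
  by rewrite -[leRHS]mulr1; apply: ler_wpM2l => //; lra.
(* With this choice 2 (d0 - s^2) = d0, so the decay bound has exactly the prefactor 1/d0 = 2 sqrt
   N. *)
pose s := Num.sqrt (d0 / 2).
have s2 : s ^+ 2 = d0 / 2 by rewrite sqr_sqrtr //; lra.
have s0 : 0 <= s by exact: sqrtr_ge0.
have sd : s ^+ 2 < ls - lam by rewrite s2; lra.
have DL z : D w z -> 0 < z.1 < L by move=> [z1 _]; move: z1; rewrite /= in_itv.
have Ac z : D w z -> A' z -> z.1 <= L - beta - t.
  by move=> _; rewrite /A' /= in_itv /= /t => za; lra.
have Bc z : D w z -> z.1 < L - beta -> ~ B w z.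
  by move=> _ zb [z1 _]; move: z1; rewrite /= in_itv /= leNgt zb.
have b1 := cut_resolvent_decay mD grad_ge lam_lt DL mA' AA' Ac Bc s0 t0 sd Lf Tv.
have e0 := expR_gt0 (s * t).
have b2 : d0 * (expR (s * t) * L2norm (D w) v) <= 1.
  apply: le_trans f1; apply: le_trans b1; rewrite -[leRHS]mulrA.
  by apply: ler_wpM2r; [rewrite mulr_ge0 // ltW|rewrite s2; lra].
apply: (@le_trans _ _ (2 * r * expR (- (s * t)))).
  have -> : L2norm (D w) v = 2 * r * expR (- (s * t)) * (d0 * (expR (s * t) * L2norm (D w) v)).
    have ee : expR (- (s * t)) * expR (s * t) = 1 by rewrite -expRD addNr expR0.
    rewrite (_ : 2 * r * _ * _ = d0 * (2 * r) * (expR (- (s * t)) * expR (s * t)) * L2norm (D w) v).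
      by rewrite d0r ee !mul1r.
    by ring.
  rewrite -[leRHS]mulr1; apply: ler_wpM2l => //.
  by rewrite !mulr_ge0 ?expR_ge0 //; lra.
apply: ler_wpM2l; first lra.
rewrite ler_expR mulNr lerN2.
have d0le : d0 <= 2^-1 by rewrite /d0 lef_pV2 ?posrE ?mulr_gt0 // ler_peMr.
(* The claimed rate 1/(48 r) is d0/24; since d0 <= 1/2, its square is at most d0/2. *)
have sd0 : d0 / 24 <= s.
  rewrite -(@ler_pXn2r _ 2) ?nnegrE //; last by lra.
  by rewrite s2; nra.
have -> : dist / (48 * r) = dist * (d0 / 24).
  by rewrite /d0; field; rewrite gt_eqF.
apply: (@le_trans _ _ (t * (d0 / 24))).
  by apply: ler_wpM2r => //; lra.
by rewrite mulrC; apply: ler_wpM2r => //; exact: ltW.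
Qed.
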